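(* Let $\alpha>2$, $\beta>0$, $\lambda>0$, and let $q^*\ge2$ be a fixed integer with $q^*<\alpha$. Let $X(t)$ be a stationary gamma Ornstein-Uhlenbeck (OU) type stochastic process with parameter $\lambda$ and marginal distribution $\Gamma(\beta,\alpha)$ (see context), let $$\Lambda(t)=\exp\{X(t)-c_X\},\qquad c_X=\log\frac1{\bigl(1-\frac1\alpha\bigr)^\beta},$$ and let $\Lambda^{(j)}$, $j=0,1,2,\dots$, be independent copies of $\Lambda$. Put $Q=\{q:0<q<q^*\}$. Then, for any $$b>\left[\Bigl(1-\frac1\alpha\Bigr)^{\beta q^*}\Big/\Bigl(1-\frac{q^*}\alpha\Bigr)^{\beta}\right]^{\frac1{q^*-1}},$$ the stochastic processes $$A_n(t)=\int_0^t\prod_{j=0}^n\Lambda^{(j)}(sb^j)\,ds,\qquad t\in[0,1],$$ converge in $\mathcal{L}_q$, $q\in Q$, to a stochastic process $A(t)$ as $n\to\infty$, such that $A(t)\in\mathcal{L}_q$ and $$\mathrm{E}A(t)^q\sim t^{\varsigma(q)},$$ where the scaling function $\varsigma(q)$ is given by $$\varsigma(q)=q\left(1+\frac1{\log b}\log\frac1{\bigl(1-\frac1\alpha\bigr)^\beta}\right)+\frac{\beta}{\log b}\log\Bigl(1-\frac q\alpha\Bigr),\qquad q\in Q.$$ Moreover, $$\mathrm{Var}\,A(t)\ge\int_0^t\!\!\int_0^t\bigl(M(1,1;u-w)-1\bigr)\,du\,dw,$$ where $M(\zeta_1,\zeta_2;t_1-t_2)=e^{-c_X(\zeta_1+\z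eta_2)}\,\mathrm{E}\exp\{\zeta_1X(t_1)+\zeta_2X(t_2)\}$.
   Context: Gamma law $\Gamma(\beta,\alpha)$, $\alpha,\beta>0$: the distribution with moment generating function $\mathrm{E}e^{\zeta X}=(1-\zeta/\alpha)^{-\beta}$, $\zeta<\alpha$. It is self-decomposable. Stationary OU type process with a given self-decomposable marginal law $D$ and parameter $\lambda>0$: a strictly stationary process with $X(0)\sim D$ and $X(t)=e^{-\lambda t}X(0)+\int_{(0,t]}e^{-\lambda(t-s)}\,dZ(\lambda s)$, $t\ge0$, where $Z$ is a L\'evy process independent of $X(0)$ (the background driving L\'evy process, determined by $D$). The mother process $\Lambda$ is measurable and separable. Convergence in $\mathcal{L}_q$ means $\mathrm{E}|A_n(t)-A(t)|^q\to0$ for each fixed $t\in[0,1]$. Notation: $\mathrm{E}A(t)^q\sim t^{p}$ means that there are constants $0<\underline{C}\le\overline{C}<\infty$ (possibly depending on $q$ but not on $t$) with $\underline{C}\,t^{p}\le\mathrm{E}A(t)^q\le\overline{C}\,t^{p}$ for all $t\in[0,1]$. *)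

(* Defs.v *)
From HB Require Import structures.
From mathcomp Require Import all_boot all_order all_algebra.
From mathcomp Require Import all_classical all_reals all_analysis.

Set Implicit Arguments.
Unset Strict Implicit.
Unset Printing Implicit Defensive.

Import Order.TTheory GRing.Theory Num.Theory.
Import numFieldNormedType.Exports.

Local Open Scope classical_set_scope.
Local Open Scope ring_scope.

(** Processes have time set [0, +oo[; they are functions R -> T -> R whose
    values at negative times are irrelevant. *)

Section independence.
Context d (T : measurableType d) (R : realType) (P : probability T R).

Definition sigma_process (X : R -> T -> R) : set (set T) :=
  <<s [set E | exists t, 0 <= t /\
        exists B : set R, measurable B /\ E = X t @^-1` B] >>.

Definition sigma_rv (X : T -> R) : set (set T) :=
  preimage_set_system setT X measurable.

Definition independent2 (F G : set (set T)) : Prop :=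
  forall A B, F A -> G B -> P (A `&` B) = (P A * P B)%E.

Definition mutually_independent (J : choiceType) (F : J -> set (set T)) : Prop :=
  forall (s : seq J) (E : J -> set T), uniq s ->
    (forall j, j \in s -> F j (E j)) ->
    P (\bigcap_(j in [set` s]) E j) = (\prod_(j <- s) P (E j))%E.

End independence.

Section path_properties.
Context d (T : measurableType d) (R : realType) (P : probability T R).

Definition measurable_process (X : R -> T -> R) : Prop :=
  measurable_fun ([set p | 0 <= p.1] : set (R * T)) (fun p => X p.1 p.2).

(** Doob separability with respect to the class of closed sets. The separating
    set [S] is automatically dense in [0, +oo[ (take [F] empty). *)
Definition separable_process (X : R -> T -> R) : Prop :=
  exists S : set R, [/\ countable S, S `<=` [set t | 0 <= t] &
    {ae P, forall w, forall (I : interval R) (F : set R),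
      open [set` I] -> closed F ->
      (forall s, S s -> s \in I -> F (X s w)) ->
      forall t, 0 <= t -> t \in I -> F (X t w)}].

Definition cadlag (x : R -> R) : Prop :=
  (forall t, 0 <= t -> x s @[s --> t^'+] --> x t) /\
  (forall t, 0 < t -> cvg (x s @[s --> t^'-])).

End path_properties.

Section same_law.
Context (R : realType).

Definition fdd_vector d (T : measurableType d) (X : R -> T -> R)
    (n : nat) (t : n.-tuple R) : T -> n.-tuple R :=
  fun w => [tuple X (tnth t i) w | i < n].

Definition same_fdd d1 d2 (T1 : measurableType d1) (T2 : measurableType d2)
    (P1 : probability T1 R) (P2 : probability T2 R)
    (X : R -> T1 -> R) (Y : R -> T2 -> R) : Prop :=
  forall (n : nat) (t : n.-tuple R), (forall i, 0 <= tnth t i) ->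
  forall B : set (n.-tuple R), measurable B ->
    P1 (fdd_vector X t @^-1` B) = P2 (fdd_vector Y t @^-1` B).

Definition strictly_stationary d (T : measurableType d) (P : probability T R)
    (X : R -> T -> R) : Prop :=
  forall h, 0 <= h -> same_fdd P P (fun t => X (t + h)) X.

End same_law.

Section levy.
Context d (T : measurableType d) (R : realType) (P : probability T R).

Definition independent_increments (Z : R -> T -> R) : Prop :=
  forall u : nat -> R, 0 <= u 0%N -> {homo u : m n / (m <= n)%N >-> m <= n} ->
    mutually_independent P (fun k : nat => sigma_rv (Z (u k.+1) \- Z (u k))).

Definition stationary_increments (Z : R -> T -> R) : Prop :=
  forall s t : R, 0 <= s -> 0 <= t -> forall B : set R, measurable B ->
    P ((Z (s + t) \- Z s) @^-1` B) = P ((Z t \- Z 0) @^-1` B).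

Definition stochastically_continuous (Z : R -> T -> R) : Prop :=
  forall t e : R, 0 <= t -> 0 < e ->
    P [set w | e <= `|Z s w - Z t w|]
      @[s --> within [set s | 0 <= s] (nbhs t)] --> 0%E.

Definition levy_process (Z : R -> T -> R) : Prop :=
  [/\ {ae P, forall w, Z 0 w = 0},
      independent_increments Z,
      stationary_increments Z,
      stochastically_continuous Z &
      {ae P, forall w, cadlag (fun t => Z t w)}].

Definition tagged_partition (a b mesh : R) (n : nat) (s xi : nat -> R) : Prop :=
  [/\ s 0%N = a, s n = b &
      forall k, (k < n)%N -> s k <= xi k <= s k.+1 /\ s k.+1 - s k < mesh].

(** [I] is the integral over ]a, b] of the deterministic function [f] against
    the process [Y]: the limit in probability of the Riemann-Stieltjes sums as
    the mesh of the tagged partition tends to 0. *)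
Definition is_stochastic_integral (f : R -> R) (Y : R -> T -> R) (a b : R)
    (I : T -> R) : Prop :=
  forall e eta : R, 0 < e -> 0 < eta -> exists2 mesh : R, 0 < mesh &
    forall (n : nat) (s xi : nat -> R), tagged_partition a b mesh n s xi ->
      (P [set w | (e <= `| \sum_(k < n) f (xi k) * (Y (s k.+1) w - Y (s k) w)
                           - I w |)%R]
        <= eta%:E)%E.

(** The marginal law is prescribed separately, through the law of [X 0]. *)
Definition stationary_OU_type (lambda : R) (X : R -> {RV P >-> R}) : Prop :=
  strictly_stationary P (fun t => X t) /\
  exists Z : R -> {RV P >-> R},
    [/\ levy_process (fun t => Z t),
        independent2 P (sigma_process (fun t => Z t)) (sigma_rv (X 0)) &
        forall t, 0 <= t -> exists I : {RV P >-> R},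
          is_stochastic_integral (fun s => expR (- lambda * (t - s)))
            (fun s => Z (lambda * s)) 0 t I /\
          {ae P, forall w, X t w = expR (- lambda * t) * X 0 w + I w}].

(** Law Gamma(beta, alpha), with shape [beta] and rate [alpha]. *)
Definition gamma_law (beta alpha : R) (X : {RV P >-> R}) : Prop :=
  forall zeta, zeta < alpha ->
    mmt_gen_fun P X zeta = ((1 - zeta / alpha) `^ (- beta))%:E.

(** For stationary [X] this depends on [t1] and [t2] only through [t1 - t2]. *)
Definition bivariate_mgf (c : R) (X : R -> T -> R) (zeta1 zeta2 t1 t2 : R)
    : \bar R :=
  ((expR (- c * (zeta1 + zeta2)))%:E
     * 'E_P[fun w => (expR (zeta1 * X t1 w + zeta2 * X t2 w))%R])%E.

End levy.

Definition mean_log_factor (R : realType) (beta alpha : R) : R :=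
  ln (1 / (1 - 1 / alpha) `^ beta).

Section multifractal_product.
Context d (T : measurableType d) (R : realType) (P : probability T R).

(** A possibly infinite integral (which happens with probability 0 only, in the
    cases of interest) is read as 0. *)
Definition cascade (b : R) (Lam : nat -> R -> T -> R) (n : nat) (t : R)
    : T -> R :=
  fun w => \int[lebesgue_measure]_(s in `[0, t])
             (\prod_(j < n.+1) Lam j (s * b ^+ j) w).

(** [Lam 0], [Lam 1], ... are independent, and each is a measurable and
    separable process with the finite-dimensional laws of [Lambda]. *)
Definition independent_copies d0 (T0 : measurableType d0)
    (P0 : probability T0 R) (Lambda : R -> T0 -> R) (Lam : nat -> R -> T -> R)
    : Prop :=
  [/\ forall j, same_fdd P P0 (Lam j) Lambda,
      forall j, measurable_process (Lam j) /\ separable_process P (Lam j) &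
      mutually_independent P (fun j => sigma_process (Lam j))].

End multifractal_product.

Definition gamma_scaling (R : realType) (beta alpha b q : R) : R :=
  q * (1 + (ln b)^-1 * ln (1 / (1 - 1 / alpha) `^ beta))
  + beta / ln b * ln (1 - q / alpha).

(* Main.v *)
Require Import Defs.
From HB Require Import structures.
From mathcomp Require Import all_boot all_order all_algebra.
From mathcomp Require Import all_classical all_reals all_analysis.
From mathcomp Require Import measurable_realfun.
From mathcomp Require Import ring lra.

(** Write [m] for the integer [qstar] and [g] for the logarithm of the moment
    generating function of the gamma law. By the Markov property of [X], the logarithm
    of a mixed moment of order [m] at ordered times is at most a sum, over the
    successive gaps, of a function that equals the slope
    [theta = (g m - m * g 1) / (m - 1)] at gap [0] and decays exponentially at large
    gaps. Summed over the levels of the cascade, a gap [D] costs a factor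
    [D ^ (- theta / ln b)], which is summable exactly because [theta < ln b], the
    hypothesis on [b]. Hence the masses [A_n t] are bounded in L^m.

    Since [E (A_n A_N)] depends only on [min n N], the masses are Cauchy in L^2, and
    boundedness in L^m upgrades this to convergence in L^q; [E A^2 >= E A_0^2] is
    the variance bound.

    At scale [t ~ b^-n] the first [n] levels are almost constant on [0, t], and the
    remaining ones form a cascade on a unit interval, independent of the former and
    with moments of order [1]. The moment of order [q] of the mass is thus comparable
    to [t^q (E Lambda^q)^n], a power of [t]. All this is carried out for Riemann sums
    and transferred to the limit by an L^1 approximation. *)

Set Implicit Arguments.
Unset Strict Implicit.
Unset Printing Implicit Defensive.

Import Order.TTheory GRing.Theory Num.Theory.
Import numFieldNormedType.Exports.
Local Open Scope classical_set_scope.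
Local Open Scope ring_scope.

(** * Independence *)

(** The stochastic integral behind [X] is given only as a limit in probability of Riemann sums, and
    mixed exponential moments are not known to be finite beforehand. Independence of past and
    innovation is therefore established for exponentials directly: they are capped, hence bounded
    and Lipschitz; the capped identities survive limits in probability; monotone convergence removes
    the cap.

    In a mixed moment the latest time is removed first. Its exponent [z] reappears at the preceding
    time as [z * expR (- lambda * gap)], so exponents pile up at the remaining times, without ever
    exceeding [m]. This is where [m < alpha] enters, and convexity of [g] on [1, m] turns the
    accumulated excess into [theta].

    The comparison of moments of order [q] splits at [q = 1], where the power changes from concave
    to convex. On each side of 1, one of the two bounds integrates out the past and uses moments of
    the averaged future weights; the other biases the mean of the mass by the power [q - 1] of the
    past density at time 0. *)

Section independence_lemmas.
Context d (T : measurableType d) (R : realType) (P : probability T R).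

(** As functions of [A] both sides are finite measures; agreeing on a pi-system that contains the
    whole space, they agree on the sigma-algebra it generates. *)
Lemma independent_event_g_sigma (G : set (set T)) (C : set T) :
  measurable C -> G `<=` measurable -> G setT -> setI_closed G ->
  (forall A, G A -> P (A `&` C) = (P A * P C)%E) ->
  forall A, <<s G >> A -> P (A `&` C) = (P A * P C)%E.
Proof.
move=> mC Gm GT GI GC A sA.
have [c cE] : exists c : {nonneg R}, c%:num%:E = P C.
  have PC0 : 0 <= fine (P C) by rewrite fine_ge0.
  by exists (NngNum PC0); rewrite /= fineK// fin_num_measure.
rewrite -cE muleC.
apply: (@g_sigma_algebra_measure_unique _ R T G Gm (fun=> setT) (fun=> GT) _
  (mrestr P mC) (mscale c P) GI _ _ A sA).
- by rewrite bigcup_const//; exists 0%N.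
- by move=> B GB; transitivity (P B * P C)%E; [exact: GC|rewrite -cE muleC].
- move=> _ /=; rewrite /mrestr setTI.
  by rewrite (le_lt_trans (probability_le1 P mC))// ltry.
Qed.

Lemma independent2_g_sigma (G H : set (set T)) :
  G `<=` measurable -> G setT -> setI_closed G ->
  H `<=` measurable -> H setT -> setI_closed H ->
  independent2 P G H -> independent2 P <<s G >> <<s H >>.
Proof.
move=> Gm GT GI Hm HT HI GH A B sA sB.
have sm (K : set (set T)) : K `<=` measurable -> <<s K >> `<=` measurable.
  by move=> Km; apply: smallest_sub => //; exact: sigma_algebra_measurable.
apply: independent_event_g_sigma sA => //; first exact: sm sB.
move=> {}A GA; rewrite setIC muleC.
apply: independent_event_g_sigma sB => //; first exact: Gm.
by move=> {}B HB; rewrite setIC muleC; exact: GH.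
Qed.

Lemma independent2_sub (F F' G G' : set (set T)) :
  F `<=` F' -> G `<=` G' -> independent2 P F' G' -> independent2 P F G.
Proof. by move=> FF' GG' I A B /FF' FA /GG' GB; exact: I. Qed.

(** The pi-system generated by the classes [F k] with [k] in [S], when each class contains the whole
    space and is closed under intersection. *)
Definition finite_meets (F : nat -> set (set T)) (S : set nat) : set (set T) :=
  [set A | exists (s : seq nat) (E : nat -> set T),
     [/\ [set` s] `<=` S, forall k, F k (E k) &
         A = \bigcap_(k in [set` s]) E k] ].

Lemma block_independence (F : nat -> set (set T)) (n : nat) :
  (forall k, F k `<=` measurable) -> (forall k, F k setT) ->
  (forall k, setI_closed (F k)) -> mutually_independent P F ->
  independent2 P <<s \bigcup_(k in [set k | (k < n)%N]) F k >>
                 <<s \bigcup_(k in [set k | (n <= k)%N]) F k >>.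
Proof.
move=> Fm FT FI PF.
pose PI S := finite_meets F S.
have PIm S : PI S `<=` measurable.
  move=> _ [s [E [_ FE ->]]]; apply: fin_bigcap_measurable => //.
  by move=> k _; exact: Fm (FE k).
have PIT S : PI S setT.
  by exists [::], (fun=> setT); split => //; rewrite set_nil bigcap_set0.
have PII S : setI_closed (PI S).
  move=> _ _ [s [E [sS FE ->]]] [s' [E' [sS' FE' ->]]].
  exists (s ++ s'), (fun k => (if k \in s then E k else setT) `&`
                              (if k \in s' then E' k else setT)); split.
  - by move=> k /=; rewrite mem_cat => /orP[/sS|/sS'].
  - by move=> k; apply: FI; case: ifP.
  - apply/seteqP; split=> [w [sw sw'] k /= ks|w sw].
      by split; case: ifPn => // ki; [exact: sw|exact: sw'].
    split=> k /= ks; have /= := sw k; rewrite mem_cat ks ?orbT/= => /(_ isT)[];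
    by rewrite ?ks.
have PIsub S : \bigcup_(k in S) F k `<=` <<s PI S >>.
  move=> A [k Sk FA]; apply: sub_sigma_algebra.
  exists [:: k], (fun i => if i == k then A else setT); split.
  - by move=> i /=; rewrite inE => /eqP ->.
  - by move=> i; case: eqP => // ->.
  - by rewrite set_cons1 bigcap_set1 eqxx.
have sPI S : <<s \bigcup_(k in S) F k >> `<=` <<s PI S >>.
  by apply: smallest_sub => //; exact: smallest_sigma_algebra.
apply: independent2_sub (sPI _) (sPI _) _.
apply: independent2_g_sigma => //.
move=> _ _ [s [E [sS FE ->]]] [s' [E' [sS' FE' ->]]].
(* Mutual independence speaks of duplicate-free index lists, hence [undup]. The two lists are
   disjoint, so one family [E2] serves both and the union is treated as a single list. *)
pose r := undup s; pose r' := undup s'.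
have rr' k : k \in r -> k \notin r'.
  rewrite !mem_undup => /sS /= kn; apply/negP => /sS' /=.
  by rewrite leqNgt kn.
have sr : [set` s] = [set` r] by apply/seteqP; split=> k /=; rewrite mem_undup.
have sr' : [set` s'] = [set` r'] by apply/seteqP; split=> k /=; rewrite mem_undup.
pose E2 k := if k \in r then E k else E' k.
have E1E : \bigcap_(k in [set` s]) E k = \bigcap_(k in [set` r]) E2 k.
  by rewrite sr; apply: eq_bigcapr => k /= kr; rewrite /E2 kr.
have E2E : \bigcap_(k in [set` s']) E' k = \bigcap_(k in [set` r']) E2 k.
  rewrite sr'; apply: eq_bigcapr => k /= kr; rewrite /E2 ifN//.
  by apply/negP => /rr'; rewrite kr.
have FE2 k : F k (E2 k) by rewrite /E2; case: ifP.
rewrite E1E E2E -bigcap_setU.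
have -> : [set` r] `|` [set` r'] = [set` r ++ r'].
  by apply/seteqP; split=> k /=; rewrite mem_cat => /orP.
rewrite !PF ?undup_uniq// ?big_cat//.
rewrite cat_uniq !undup_uniq/= andbT; apply/hasPn => k kr' /=.
by apply/negP => /rr'; rewrite kr'.
Qed.

End independence_lemmas.

Section expectation_nonneg.
Context d (T : measurableType d) (R : realType) (P : probability T R).
Local Notation mf := (measurable_fun [set: T]).
Implicit Types f g : T -> R.

Lemma expectation_mono f g : mf f -> mf g -> (forall w, 0 <= f w) ->
  (forall w, f w <= g w) -> ('E_P[f] <= 'E_P[g])%E.
Proof.
move=> mf_ mg f0 fg; rewrite unlock; apply: ge0_le_integral => //=.
all: try exact/measurable_EFinP.
all: by move=> w _; rewrite lee_fin ?(le_trans (f0 w)).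
Qed.

Lemma expectation_add f g : mf f -> mf g -> (forall w, 0 <= f w) ->
  (forall w, 0 <= g w) ->
  ('E_P[fun w => (f w + g w)%R] = 'E_P[f] + 'E_P[g])%E.
Proof.
move=> mf_ mg f0 g0; rewrite unlock.
under eq_integral do rewrite EFinD.
rewrite ge0_integralD//=; try exact/measurable_EFinP.
all: by move=> w _; rewrite lee_fin.
Qed.

Lemma expectation_scale (k : R) f : 0 <= k -> mf f -> (forall w, 0 <= f w) ->
  ('E_P[fun w => (k * f w)%R] = k%:E * 'E_P[f])%E.
Proof.
move=> k0 mf_ f0; rewrite unlock.
under eq_integral do rewrite EFinM.
rewrite ge0_integralZl_EFin//=; try exact/measurable_EFinP.
by move=> w _; rewrite lee_fin.
Qed.

Lemma expectation_bigsum (I : Type) (s : seq I) (f : I -> T -> R) :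
  (forall i, mf (f i)) -> (forall i w, 0 <= f i w) ->
  ('E_P[fun w => (\sum_(i <- s) f i w)%R] = \sum_(i <- s) 'E_P[f i])%E.
Proof.
move=> mf_ f0; rewrite unlock.
under eq_integral do rewrite -sumEFin.
rewrite ge0_integral_sum//=; first by move=> i; exact/measurable_EFinP.
by move=> i w _; rewrite lee_fin.
Qed.

Lemma expectation_eq_ae f g : {ae P, forall w, f w = g w} -> mf f -> mf g ->
  ('E_P[f] = 'E_P[g])%E.
Proof.
move=> fg mf_ mg; rewrite unlock; apply: ae_eq_integral => //.
- exact/measurable_EFinP.
- exact/measurable_EFinP.
- by apply: filterS fg => w /= ->.
Qed.

Lemma sigma_rv_comp (U : T -> R) (phi : R -> R) : measurable_fun setT phi ->
  sigma_rv (phi \o U) `<=` sigma_rv U.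
Proof.
move=> mphi _ [B mB <-]; exists (phi @^-1` B).
  by rewrite -(setTI (_ @^-1` _)); exact: mphi.
by [].
Qed.

Lemma sigma_rv_subset (U : T -> R) (G : set (set T)) :
  (forall B : set R, measurable B -> G (U @^-1` B)) -> sigma_rv U `<=` G.
Proof. by move=> UG _ [B mB <-]; rewrite setTI; exact: UG. Qed.

Lemma expectation_independentM (U V : T -> R) : mf U -> mf V ->
  (forall w, 0 <= U w) -> (forall w, 0 <= V w) ->
  independent2 P (sigma_rv U) (sigma_rv V) ->
  ('E_P[fun w => (U w * V w)%R] = 'E_P[U] * 'E_P[V])%E.
Proof.
move=> mU mV U0 V0 UV; rewrite unlock.
have mUV := measurable_fun_pair mU mV.
pose uM := isMeasurableFun.Build _ _ _ _ _ mU.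
pose u : {mfun T >-> R} := HB.pack U uM.
pose vM := isMeasurableFun.Build _ _ _ _ _ mV.
pose v : {mfun T >-> R} := HB.pack V vM.
pose uvM := isMeasurableFun.Build _ _ _ _ _ mUV.
pose uv : {mfun T >-> (R * R)%type} := HB.pack (fun w => (U w, V w)) uvM.
(* The absolute value makes the integrand nonnegative on the whole plane, as Tonelli requires; it
   changes nothing on the range of [(U, V)]. *)
pose f (z : R * R) : \bar R := (`|z.1 * z.2|%R)%:E.
have mf0 : measurable_fun setT f.
  apply/measurable_EFinP; apply: measurableT_comp => //.
  by apply: measurable_funM.
have f0 z : (0 <= f z)%E by rewrite lee_fin.
transitivity (\int[distribution P uv]_z f z)%E.
  rewrite ge0_integral_distribution//; apply: eq_integral => w _ /=.
  by rewrite /f/= ger0_norm// mulr_ge0.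
transitivity (\int[distribution P u \x distribution P v]_z f z)%E.
  apply/esym/eq_measure_integral => A mA _.
  apply: (@product_measure_unique _ _ _ _ _ (distribution P u) (distribution P v)
    (distribution P uv)) => // B C mB mC.
  change (P (U @^-1` B `&` V @^-1` C) = (P (U @^-1` B) * P (V @^-1` C))%E).
  by apply: UV; [exists B|exists C]; rewrite ?setTI.
rewrite fubini_tonelli1; [|exact: mf0|exact: f0].
rewrite /fubini_F.
have mn : measurable_fun [set: R] (fun y : R => (`|y|%R)%:E).
  by apply/measurable_EFinP; exact: normr_measurable.
transitivity (\int[distribution P u]_x ((`|x|%R)%:E *
    \int[P]_w (V w)%:E))%E.
  apply: eq_integral => x _; rewrite /f /=.
  transitivity (\int[distribution P v]_y ((`|x|%R)%:E * (`|y|%R)%:E))%E.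
    by apply: eq_integral => y _; rewrite normrM EFinM.
  rewrite ge0_integralZl_EFin//= ge0_integral_distribution//.
  congr (_ * _)%E; apply: eq_integral => w _ /=. by rewrite ger0_norm.
rewrite ge0_integralZr//=; last first.
  by apply: integral_ge0 => w _; rewrite lee_fin.
rewrite ge0_integral_distribution//.
by congr (_ * _)%E; apply: eq_integral => w _ /=; rewrite ger0_norm.
Qed.

End expectation_nonneg.

(** * Exponential moments of independent limits in probability *)

Section truncation.
Context d (T : measurableType d) (R : realType) (P : probability T R).
Local Notation mf := (measurable_fun [set: T]).

Lemma expectation_cvg_stationary (f : nat -> T -> R) (g : T -> R) :
  (forall n, mf (f n)) -> (forall n w, 0 <= f n w) ->
  (forall w, {homo f^~ w : m n / (m <= n)%N >-> m <= n}) ->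
  (forall w, \forall n \near \oo, f n w = g w) ->
  ('E_P[f n] @[n --> \oo] --> 'E_P[g])%E.
Proof.
move=> mf_ f0 fnd fg; rewrite unlock.
have cvgf w : (f n w)%:E @[n --> \oo] --> (g w)%:E.
  by apply: cvg_near_cst; apply: filterS (fg w) => n ->.
under [X in _ --> X]eq_integral => w _ do rewrite -(cvg_lim _ (cvgf w))//.
apply: cvg_monotone_convergence => //.
- by move=> n; exact/measurable_EFinP.
- by move=> n w _; rewrite lee_fin.
- by move=> w _ m n mn; rewrite lee_fin fnd.
Qed.

Lemma expectation_le_trunc (f : nat -> T -> R) (g : T -> R) (C : \bar R) :
  (forall n, mf (f n)) -> (forall n w, 0 <= f n w) ->
  (forall w, {homo f^~ w : m n / (m <= n)%N >-> m <= n}) ->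
  (forall w, \forall n \near \oo, f n w = g w) ->
  (forall n, 'E_P[f n] <= C)%E -> ('E_P[g] <= C)%E.
Proof.
move=> mf_ f0 fnd fg fC; have cf := expectation_cvg_stationary mf_ f0 fnd fg.
by rewrite -(cvg_lim _ cf)//; apply: lime_le; [exact: cvgP cf|exact: nearW].
Qed.

Lemma expectation_indicator (A : set T) : measurable A ->
  'E_P[\1_A : T -> R]%E = P A.
Proof. by move=> mA; rewrite expectation_indic. Qed.

Lemma expectation_bounded (f : T -> R) (B : R) : mf f ->
  (forall w, 0 <= f w <= B) -> ('E_P[f] = (fine 'E_P[f])%:E)%E.
Proof.
move=> mf_ fB; rewrite fineK// ge0_fin_numE; last first.
  by apply: expectation_ge0 => w; case/andP: (fB w).
rewrite (@le_lt_trans _ _ B%:E) ?ltry// -(@expectation_cst _ _ _ P).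
apply: expectation_mono => //; first by move=> w; case/andP: (fB w).
by move=> w; case/andP: (fB w).
Qed.

(** How closeness in probability acts on bounded expectations: off the exceptional event [D] the
    excess is at most [delta], and on [D] only the bound [B] is used. *)
Lemma expectation_bounded_le (f g : T -> R) (B delta eta : R) (D : set T) :
  mf f -> mf g -> measurable D -> 0 <= delta ->
  (forall w, 0 <= f w <= B) -> (forall w, 0 <= g w <= B) ->
  (forall w, f w <= g w + delta + B * \1_D w) -> (P D <= eta%:E)%E ->
  fine ('E_P[f])%E <= fine ('E_P[g])%E + delta + B * eta.
Proof.
move=> mf_ mg mD d0 fB gB fg PD.
have B0 : 0 <= B.
  by case/andP: (fB point) => /le_trans; apply.
have g0 w : 0 <= g w by case/andP: (gB w).
have f0 w : 0 <= f w by case/andP: (fB w).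
have mI : mf (\1_D : T -> R) by exact: measurable_indic.
rewrite -lee_fin -(expectation_bounded mf_ fB).
apply: (@le_trans _ _ ('E_P[fun w => ((g w + delta) + B * \1_D w)%R])%E).
  apply: expectation_mono => //.
  by apply: measurable_funD; [exact: measurable_funD|exact: measurable_funM].
rewrite (@expectation_add _ _ _ P (fun w => g w + delta) (fun w => B * \1_D w)).
- rewrite (@expectation_add _ _ _ P g (cst delta))//.
  rewrite expectation_cst (@expectation_scale _ _ _ P B (\1_D : T -> R))//.
  rewrite expectation_indicator// !EFinD EFinM -(expectation_bounded mg gB).
  by rewrite leeD2l// lee_wpmul2l// lee_fin.
- exact: measurable_funD.
- exact: measurable_funM.
- by move=> w; rewrite addr_ge0.
- by move=> w; rewrite mulr_ge0.
Qed.

End truncation.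

Section truncated_exponential.
Context (R : realType).
Implicit Types x y K : R.

(** Capping the exponent makes the exponential bounded and Lipschitz, so that its expectation is
    stable under limits in probability, and it increases to [expR x] with [K], so that monotone
    convergence recovers the exponential. *)
Definition texp K x : R := expR (Num.min x K).

Lemma texp_ge0 K x : 0 <= texp K x. Proof. exact: expR_ge0. Qed.

Lemma texp_le K x : texp K x <= expR K.
Proof. by rewrite ler_expR ge_min lexx orbT. Qed.

Lemma measurable_texp K : measurable_fun setT (texp K).
Proof. by apply: measurableT_comp => //; exact: measurable_minr. Qed.

Lemma texp_nd x K K' : K <= K' -> texp K x <= texp K' x.
Proof. by move=> KK'; rewrite ler_expR le_min ge_min lexx/= ge_min KK' orbT. Qed.

Lemma texpE K x : x <= K -> texp K x = expR x.
Proof. by move=> xK; rewrite /texp min_l. Qed.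

Lemma texp_lipschitz K x y : texp K x <= texp K y + expR K * `|x - y|.
Proof.
have Kxy : 0 <= expR K * `|x - y| by rewrite mulr_ge0// expR_ge0.
have [xy|/ltW yx] := leP x y.
  rewrite (@le_trans _ _ (texp K y)) ?lerDl//.
  by rewrite ler_expR le_min !ge_min xy lexx orbT.
rewrite -lerBlDl /texp.
have -> : expR (Num.min y K) =
    expR (Num.min x K) * expR (Num.min y K - Num.min x K).
  by rewrite -expRD addrC subrK.
have /(ler_wpM2l (expR_ge0 (Num.min x K))) :=
  expR_ge1Dx (Num.min y K - Num.min x K).
rewrite mulrDr mulr1 => h.
have m0 : 0 <= Num.min x K - Num.min y K.
  by rewrite subr_ge0 le_min !ge_min yx lexx orbT.
have mxy : Num.min x K - Num.min y K <= `|x - y|.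
  rewrite ger0_norm ?subr_ge0//.
  by have [] := leP x K; have [] := leP y K => *; lra.
rewrite (@le_trans _ _ (expR (Num.min x K) * (Num.min x K - Num.min y K)))//.
  by move: h; rewrite !mulrBr; lra.
by rewrite ler_pM ?expR_ge0 ?texp_le.
Qed.

End truncated_exponential.

Section approximate_independence.
Context d (T : measurableType d) (R : realType) (P : probability T R).
Local Notation mf := (measurable_fun [set: T]).

(** [U] is a limit in probability of variables, each measurable for some sigma-algebra of the
    collection [S]. A collection is needed because finer Riemann sums see more increments. One [e]
    bounds both the distance and the probability, as in the Ky Fan metric. *)
Definition approximable (S : set (set (set T))) (U : T -> R) : Prop :=
  forall e : R, 0 < e -> exists G U',
    [/\ S G, mf U', sigma_rv U' `<=` G &
        (P [set w | (e <= `|U w - U' w|)%R] <= e%:E)%E].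

Lemma measurable_large (U V : T -> R) (e : R) : mf U -> mf V ->
  measurable [set w | e <= `|U w - V w|].
Proof.
move=> mU mV; rewrite -[X in measurable X]setTI.
have mUV : mf (fun w => `|U w - V w|).
  by apply: measurableT_comp; [exact: normr_measurable|exact: measurable_funB].
exact: (measurable_fun_ler (@measurable_cst _ _ _ _ setT e) mUV measurableT
  (Y := [set true])).
Qed.

Let texp_approx (U U' : T -> R) (e K : R) (w : T) : 0 <= e ->
  texp K (U w) <= texp K (U' w) + expR K * e +
    expR K * \1_[set w | e <= `|U w - U' w|] w.
Proof.
move=> e0; rewrite indicE; have [eU|Ue] := leP e `|U w - U' w|.
  rewrite mem_set// mulr1.
  have := texp_le K (U w); have := texp_ge0 K (U' w).
  by have := mulr_ge0 (expR_ge0 K) e0; lra.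
rewrite memNset ?mulr0 ?addr0; last by rewrite /= leNgt Ue.
apply: (le_trans (texp_lipschitz K (U w) (U' w))).
by rewrite lerD2l ler_wpM2l ?expR_ge0// ltW.
Qed.

Section fixed_truncation.
Variables (U V : T -> R) (K : R).
Hypotheses (mU : mf U) (mV : mf V).
Let E f := fine ('E_P[f])%E.
Let k := expR K.
Let k0 : 0 <= k. Proof. exact: expR_ge0. Qed.
Let mt (W : T -> R) : mf W -> mf (texp K \o W).
Proof. by move=> mW; apply: measurableT_comp => //; exact: measurable_texp. Qed.

Let E_texp_approx (W W' : T -> R) (e : R) : mf W -> mf W' -> 0 <= e ->
  (P [set w | (e <= `|W w - W' w|)%R] <= e%:E)%E ->
  E (texp K \o W) <= E (texp K \o W') + k * e + k * e.
Proof.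
move=> mW mW' e0 We.
apply: (@expectation_bounded_le _ _ _ P _ _ _ _ _ _ _ _ _ _ _ _ _ We).
- exact: mt.
- exact: mt.
- exact: measurable_large.
- exact: mulr_ge0.
- by move=> w; rewrite texp_ge0 texp_le.
- by move=> w; rewrite texp_ge0 texp_le.
- by move=> w; exact: texp_approx.
Qed.

Let E_texpM_approx (W W' X X' : T -> R) (e : R) :
  mf W -> mf W' -> mf X -> mf X' -> 0 <= e ->
  (P [set w | (e <= `|W w - W' w|)%R] <= e%:E)%E ->
  (P [set w | (e <= `|X w - X' w|)%R] <= e%:E)%E ->
  E (fun w => texp K (W w) * texp K (X w)) <=
  E (fun w => texp K (W' w) * texp K (X' w)) + 4 * k ^+ 2 * e.
Proof.
move=> mW mW' mX mX' e0 We Xe.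
have mM (A B : T -> R) : mf A -> mf B -> mf (fun w => texp K (A w) * texp K (B w)).
  by move=> mA mB; apply: measurable_funM; exact: mt.
have bM (A B : T -> R) w : 0 <= texp K (A w) * texp K (B w) <= k ^+ 2.
  by rewrite mulr_ge0 ?texp_ge0//= expr2 ler_pM ?texp_ge0 ?texp_le.
(* One factor is replaced at a time, each time at a cost of [2 * k ^+ 2 * e]. *)
have step (A A' B : T -> R) : mf A -> mf A' -> mf B ->
    (P [set w | (e <= `|A w - A' w|)%R] <= e%:E)%E ->
    E (fun w => texp K (A w) * texp K (B w)) <=
    E (fun w => texp K (A' w) * texp K (B w)) + k ^+ 2 * e + k ^+ 2 * e.
  move=> mA mA' mB Ae.
  apply: (@expectation_bounded_le _ _ _ P _ _ _ _ _ _ _ _ _ _ _ _ _ Ae).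
  - exact: mM.
  - exact: mM.
  - exact: measurable_large.
  - by rewrite mulr_ge0// exprn_ge0.
  - by move=> w; exact: bM.
  - by move=> w; exact: bM.
  - move=> w; have := @texp_approx A A' e K w e0; set D := \1__ _ => h.
    have D0 : 0 <= D by [].
    have B0 := texp_ge0 K (B w); have B1 := texp_le K (B w).
    have eD : 0 <= k * e + k * D by rewrite addr_ge0 ?mulr_ge0.
    have := ler_wpM2r B0 h; have := ler_wpM2l eD B1.
    rewrite -/k => h1 h2; move: h1 h2.
    by rewrite expr2; nra.
have := step W W' X mW mW' mX We.
have := step X X' W' mX mX' mW' Xe.
have -> : (fun w => texp K (X w) * texp K (W' w)) =
          (fun w => texp K (W' w) * texp K (X w)).
  by apply/funext => w; rewrite mulrC.
have -> : (fun w => texp K (X' w) * texp K (W' w)) =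
          (fun w => texp K (W' w) * texp K (X' w)).
  by apply/funext => w; rewrite mulrC.
by lra.
Qed.

Lemma texp_independent (S S' : set (set (set T))) :
  approximable S U -> approximable S' V ->
  (forall G G', S G -> S' G' -> independent2 P G G') ->
  ('E_P[fun w => (texp K (U w) * texp K (V w))%R] =
   'E_P[texp K \o U] * 'E_P[texp K \o V])%E.
Proof.
move=> SU SV SS'.
have bt (W : T -> R) w : 0 <= (texp K \o W) w <= k.
  by rewrite /= texp_ge0 texp_le.
have bM (A B : T -> R) w : 0 <= texp K (A w) * texp K (B w) <= k ^+ 2.
  by rewrite mulr_ge0 ?texp_ge0//= expr2 ler_pM ?texp_ge0 ?texp_le.
have mM (A B : T -> R) : mf A -> mf B -> mf (fun w => texp K (A w) * texp K (B w)).
  by move=> mA mB; apply: measurable_funM; exact: mt.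
have E0 (W : T -> R) : 0 <= E (texp K \o W).
  by rewrite fine_ge0// expectation_ge0// => w; exact: texp_ge0.
have Ek (W : T -> R) : mf W -> E (texp K \o W) <= k.
  move=> mW; rewrite -lee_fin -(expectation_bounded _ (mt mW) (bt W)).
  rewrite -(@expectation_cst _ _ _ P); apply: expectation_mono => //.
  - exact: mt.
  - by move=> w; exact: texp_ge0.
  - by move=> w; exact: texp_le.
rewrite (expectation_bounded _ (mM _ _ mU mV) (bM U V)).
rewrite (expectation_bounded _ (mt mU) (bt U)).
rewrite (expectation_bounded _ (mt mV) (bt V)) -EFinM; congr (_%:E).
rewrite -/(E _) -/(E (texp K \o U)) -/(E (texp K \o V)).
set a := E (texp K \o U); set b := E (texp K \o V); set m := E _.
(* Passing to the approximants costs [4 * k ^+ 2 * e] in the mixed expectation and as much again in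
   the product of expectations; for the approximants the factorisation is exact. *)
have main e : 0 < e -> e <= 1 -> `|m - a * b| <= (8 * k ^+ 2 + 0) * e.
  move=> e0 e1.
  have [G [U' [SG mU' UG PU]]] := SU e e0.
  have [G' [V' [SG' mV' VG PV]]] := SV e e0.
  have PU' : (P [set w | (e <= `|U' w - U w|)%R] <= e%:E)%E.
    by under eq_set do rewrite distrC.
  have PV' : (P [set w | (e <= `|V' w - V w|)%R] <= e%:E)%E.
    by under eq_set do rewrite distrC.
  pose a' := E (texp K \o U'); pose b' := E (texp K \o V').
  pose m' := E (fun w => texp K (U' w) * texp K (V' w)).
  have m'E : m' = a' * b'.
    rewrite /m' /a' /b' /E.
    rewrite (@expectation_independentM _ _ _ P (texp K \o U') (texp K \o V')).
    - rewrite (expectation_bounded _ (mt mU') (bt U')).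
      by rewrite (expectation_bounded _ (mt mV') (bt V')) -EFinM.
    - exact: mt.
    - exact: mt.
    - by move=> w; exact: texp_ge0.
    - by move=> w; exact: texp_ge0.
    - apply: independent2_sub (SS' _ _ SG SG').
      + exact: subset_trans (sigma_rv_comp (measurable_texp K)) UG.
      + exact: subset_trans (sigma_rv_comp (measurable_texp K)) VG.
  have := E_texpM_approx mU mU' mV mV' (ltW e0) PU PV.
  have := E_texpM_approx mU' mU mV' mV (ltW e0) PU' PV'.
  have := E_texp_approx mU mU' (ltW e0) PU.
  have := E_texp_approx mU' mU (ltW e0) PU'.
  have := E_texp_approx mV mV' (ltW e0) PV.
  have := E_texp_approx mV' mV (ltW e0) PV'.
  have : 0 <= a by exact: E0. have : 0 <= b by exact: E0.
  have : 0 <= a' by exact: E0. have : 0 <= b' by exact: E0.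
  have : a <= k by exact: Ek. have : b <= k by exact: Ek.
  have : a' <= k by exact: Ek. have : b' <= k by exact: Ek.
  rewrite -/a -/b -/m -/m' m'E -/a' -/b' => Hb' Ha' Hb Ha b'0 a'0 b0 a0 h1 h2 h3 h4 h5 h6.
  have ab : `|a' * b' - a * b| <= 4 * k ^+ 2 * e.
    have -> : a' * b' - a * b = a' * (b' - b) + (a' - a) * b by ring.
    apply: (le_trans (ler_normD _ _)); rewrite !normrM.
    have n1 : `|b' - b| <= 2 * k * e by rewrite ler_norml; lra.
    have n2 : `|a' - a| <= 2 * k * e by rewrite ler_norml; lra.
    have h7 : `|a'| * `|b' - b| <= k * (2 * k * e).
      by apply: ler_pM => //; rewrite ger0_norm.
    have h8 : `|a' - a| * `|b| <= (2 * k * e) * k.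
      by apply: ler_pM => //; rewrite ger0_norm.
    by rewrite expr2; lra.
  move: ab; rewrite !ler_norml => /andP[ab1 ab2].
  by apply/andP; split; lra.
apply/eqP; rewrite -subr_eq0 -normr_le0; apply/ler_addgt0Pr => e e0.
rewrite add0r; set C := _ + 0 in main.
have C0 : 0 <= C by rewrite /C addr0 mulr_ge0// exprn_ge0.
have C1 : 0 < C + 1 by rewrite ltr_wpDl.
pose e' := Num.min 1 (e / (C + 1)).
have e'0 : 0 < e' by rewrite lt_min ltr01 divr_gt0.
rewrite (le_trans (main e' e'0 _)) ?ge_min ?lexx//.
have : e' <= e / (C + 1) by rewrite ge_min lexx orbT.
by rewrite ler_pdivlMr// mulrDr mulr1 => h; lra.
Qed.

End fixed_truncation.

Lemma expectation_exp_independent (S S' : set (set (set T))) (U V : T -> R) :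
  mf U -> mf V -> approximable S U -> approximable S' V ->
  (forall G G', S G -> S' G' -> independent2 P G G') ->
  ('E_P[fun w => expR (U w + V w)] =
   'E_P[fun w => expR (U w)] * 'E_P[fun w => expR (V w)])%E.
Proof.
move=> mU mV SU SV SS'.
have mt (W : T -> R) K : mf W -> mf (texp K \o W).
  by move=> mW; apply: measurableT_comp => //; exact: measurable_texp.
have trunc (W : T -> R) w : \forall n \near \oo, texp n%:R (W w) = expR (W w).
  near=> n; apply: texpE; near: n; exact: nbhs_infty_ger.
have cvg1 (W : T -> R) : mf W ->
    ('E_P[texp n%:R \o W] @[n --> \oo] --> 'E_P[fun w => expR (W w)])%E.
  move=> mW; apply: expectation_cvg_stationary.
  - by move=> n; exact: mt.
  - by move=> n w; exact: texp_ge0.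
  - by move=> w m n mn; apply: texp_nd; rewrite ler_nat.
  - exact: trunc.
have cvg2 : ('E_P[fun w => (texp n%:R (U w) * texp n%:R (V w))%R] @[n --> \oo]
    --> 'E_P[fun w => expR (U w + V w)])%E.
  apply: expectation_cvg_stationary.
  - by move=> n; apply: measurable_funM; exact: mt.
  - by move=> n w; rewrite mulr_ge0 ?texp_ge0.
  - move=> w m n mn; apply: ler_pM; rewrite ?texp_ge0//;
    by apply: texp_nd; rewrite ler_nat.
  - move=> w; near=> n; rewrite expRD; congr (_ * _); near: n; exact: trunc.
(* The product of the limits is the limit of the products only if [0 * +oo] is excluded; hence the
   strict positivity. *)
have Epos (W : T -> R) : mf W -> (0 < 'E_P[fun w => expR (W w)])%E.
  move=> mW; rewrite lt0e expectation_ge0 ?andbT; last by move=> w; exact: expR_ge0.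
  apply/eqP; rewrite unlock => E0.
  have mexp : measurable_fun setT (fun w => (expR (W w))%:E).
    by apply/measurable_EFinP; exact: measurableT_comp.
  have : (\int[P]_w `|(expR (W w))%:E| = 0)%E.
    by rewrite -[RHS]E0; apply: eq_integral => w _; rewrite gee0_abs ?lee_fin ?expR_ge0.
  move=> /(ae_eq_integral_abs P measurableT mexp) H.
  have PT : (0 < P setT)%E by rewrite probability_setT.
  have [w /= /(_ Logic.I)[]] :=
    @filter_ex _ _ (ae_properfilter_algebraOfSetsType PT) _ H.
  by apply/eqP; rewrite gt_eqF ?expR_gt0.
have cvg3 := cvgeM _ (cvg1 _ mU) (cvg1 _ mV).
rewrite (eq_cvg _ _ (fun n => texp_independent _ mU mV SU SV SS')) in cvg2.
rewrite -(cvg_lim _ cvg2)//; apply/cvg_lim => //; apply: cvg3.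
by rewrite neq0_mule_def// mule_eq0 negb_or !gt_eqF ?Epos.
Unshelve. all: by end_near. Qed.

End approximate_independence.

(** * Innovations of the Ornstein-Uhlenbeck process *)

Section levy_increments.
Context d (T : measurableType d) (R : realType) (P : probability T R).
Local Notation mf := (measurable_fun [set: T]).
Variable Z : R -> {RV P >-> R}.

Definition increments_system (l : seq R) : set (set T) :=
  [set A | exists u v (B : set R),
     [/\ u \in l, v \in l, u <= v, measurable B & A = (Z v \- Z u) @^-1` B] ].

Definition increments_sigma (l : seq R) : set (set T) :=
  <<s increments_system l >>.

Lemma increments_sigma_sub (l l' : seq R) : {subset l <= l'} ->
  increments_sigma l `<=` increments_sigma l'.
Proof.
move=> ll'; apply: sub_smallest2r; first exact: smallest_sigma_algebra.
by move=> A [u [v [B [ul vl uv mB ->]]]]; exists u, v, B; split; rewrite ?ll'.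
Qed.

(** An increment between two points of a monotone grid telescopes into consecutive increments, the
    only ones about which independence of increments says anything. *)
Lemma increments_sigma_block (l : seq R) (x : nat -> R) (S : set nat) :
  (forall k k', (k <= k')%N -> x k <= x k') ->
  (forall u v, u \in l -> v \in l -> exists i k,
     [/\ u = x i, v = x k & forall p, (i <= p < k)%N -> S p]) ->
  increments_sigma l `<=`
    <<s \bigcup_(k in S) sigma_rv (Z (x k.+1) \- Z (x k)) >>.
Proof.
move=> xnd lx; set F := \bigcup_(k in S) _.
apply: smallest_sub; first exact: smallest_sigma_algebra.
move=> _ [u [v [B [ul vl uv mB ->]]]].
have [i [k [ui vk iS]]] := lx _ _ ul vl.
pose TF := g_sigma_algebraType F.
have mW p : S p -> measurable_fun [set: TF] (Z (x p.+1) \- Z (x p) : TF -> R).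
  move=> Sp _ C mC; apply: sub_sigma_algebra; exists p => //.
  by exists C.
suff : measurable_fun [set: TF] (Z v \- Z u : TF -> R).
  by move=> /(_ measurableT B mB); rewrite setTI.
have [ik|/ltnW ki] := leqP i k.
  have -> : (Z v \- Z u : TF -> R) =
      (fun w => \sum_(p <- index_iota i k) (Z (x p.+1) w - Z (x p) w)).
    by apply/funext => w; rewrite (telescope_sumr (fun p => Z (x p) w) ik) -ui -vk.
  rewrite (_ : (fun w => _) = (fun w : TF => \sum_(p <- index_iota i k)
      (if p \in index_iota i k then Z (x p.+1) w - Z (x p) w else 0))); last first.
    by apply/funext => w; apply: eq_big_seq => p pik; rewrite pik.
  apply: measurable_sum => p.
  case: (boolP (p \in index_iota i k)) => [|_]; last exact: measurable_cst.
  by rewrite mem_index_iota => /iS; exact: mW.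
(* The points come in the order opposite to their indices, which on a nondecreasing grid forces them
   to coincide: the increment is 0. *)
have -> : u = v by apply: le_anti; rewrite uv ui vk xnd.
rewrite (_ : _ \- _ = cst 0); first exact: measurable_cst.
by apply/funext => w /=; rewrite subrr.
Qed.

Lemma increments_independent (l l' : seq R) (a : R) :
  independent_increments P (fun t => Z t) -> 0 <= a ->
  (forall u, u \in l -> 0 <= u <= a) -> (forall u, u \in l' -> a <= u) ->
  independent2 P (increments_sigma l) (increments_sigma l').
Proof.
move=> PZ a0 la l'a.
pose L := sort <=%R l ++ sort <=%R l'.
have sL : sorted <=%R L.
  rewrite sorted_pairwise; last exact: le_trans.
  rewrite pairwise_cat -!(sorted_pairwise le_trans) !(sort_sorted le_total) !andbT.
  apply/allrelP => u v; rewrite !mem_sort => /la /andP[_ ua] /l'a.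
  exact: le_trans.
have L0 u : u \in L -> 0 <= u.
  rewrite mem_cat !mem_sort => /orP[/la /andP[]//|/l'a]; exact: le_trans.
(* Independence of increments is stated for infinite sequences, so the sorted list is prolonged by
   repeating its last point. The two blocks are cut at index [size l]. *)
pose x k := nth 0 L (minn k (size L).-1).
have xnd k k' : (k <= k')%N -> x k <= x k'.
  move=> kk'; rewrite /x; have [->//|Lnil] := eqVneq L [::].
  have sL0 : (0 < size L)%N by case: L Lnil {sL L0 x}.
  apply: (sorted_leq_nth le_trans lexx) => //; rewrite ?inE.
  - by rewrite (leq_ltn_trans (geq_minr _ _))// prednK.
  - by rewrite (leq_ltn_trans (geq_minr _ _))// prednK.
  - by rewrite leq_min geq_minr andbT (leq_trans (geq_minl _ _)).
have x0 : 0 <= x 0%N.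
  rewrite /x min0n; have [->//|Lnil] := eqVneq L [::].
  by apply/L0/mem_nth; case: L Lnil {sL L0 x xnd}.
have xi k : (k < size L)%N -> x k = nth 0 L k.
  by move=> kL; rewrite /x (minn_idPl _)// -ltnS prednK// (leq_ltn_trans _ kL).
have sl : size (sort <=%R l) = size l by rewrite size_sort.
apply: (independent2_sub (increments_sigma_block (S := [set k | (k < size l)%N]) xnd _)
  (increments_sigma_block (S := [set k | (size l <= k)%N]) xnd _)).
- move=> u v ul vl.
  have ixL w : w \in l -> exists2 i, (i < size l)%N & w = x i.
    move=> wl; exists (index w (sort <=%R l)).
      by rewrite -sl index_mem mem_sort.
    have wi : (index w (sort <=%R l) < size (sort <=%R l))%N.
      by rewrite index_mem mem_sort.
    rewrite xi; last by rewrite size_cat (leq_trans wi)// leq_addr.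
    by rewrite nth_cat wi nth_index// mem_sort.
  have [i il ->] := ixL _ ul; have [k kl ->] := ixL _ vl.
  exists i, k; split => // p /andP[_ pk] /=; exact: ltn_trans pk kl.
- move=> u v ul vl.
  have ixL w : w \in l' -> exists2 i, (size l <= i)%N & w = x i.
    move=> wl; exists (size l + index w (sort <=%R l'))%N; first exact: leq_addr.
    have wi : (index w (sort <=%R l') < size (sort <=%R l'))%N.
      by rewrite index_mem mem_sort.
    rewrite xi; last by rewrite size_cat sl ltn_add2l.
    by rewrite nth_cat sl ltnNge leq_addr/= addKn nth_index// mem_sort.
  have [i il ->] := ixL _ ul; have [k kl ->] := ixL _ vl.
  by exists i, k; split => // p /andP[ip _] /=; exact: leq_trans il ip.
- apply: block_independence => [k|k|k|].
  + by apply: sigma_rv_subset => B mB; rewrite -[X in measurable X]setTI;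
      apply: measurable_funB.
  + by exists setT => //; rewrite preimage_setT setTI.
  + by move=> _ _ [B mB <-] [C mC <-]; exists (B `&` C);
      [exact: measurableI|rewrite !setTI].
  + exact: PZ.
Qed.

End levy_increments.

Section approximable_closure.
Context d (T : measurableType d) (R : realType) (P : probability T R).
Local Notation mf := (measurable_fun [set: T]).
Variable Z : R -> {RV P >-> R}.

Lemma probability_union_le (A B C : set T) (a b : R) :
  measurable A -> measurable B -> measurable C -> A `<=` B `|` C ->
  (P B <= a%:E)%E -> (P C <= b%:E)%E -> (P A <= (a + b)%:E)%E.
Proof.
move=> mA mB mC ABC Ba Cb; rewrite EFinD.
apply: (le_trans _ (leeD Ba Cb)); apply: (@le_trans _ _ (P (B `|` C))).
  by apply: le_measure => //; rewrite inE//; exact: measurableU.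
exact: measureU2.
Qed.

Lemma approximable_ae (S : set (set (set T))) (U V : T -> R) :
  mf U -> mf V -> {ae P, forall w, U w = V w} ->
  approximable P S V -> approximable P S U.
Proof.
move=> mU mV [N [mN PN UVN]] SV e e0.
have [G [V' [SG mV' V'G PV]]] := SV e e0; exists G, V'; split => //.
rewrite -[e]add0r; apply: (probability_union_le _ mN _ _ _ PV).
- by rewrite add0r; exact: measurable_large.
- exact: measurable_large.
- move=> w /=; rewrite add0r => eU.
  by have [UV|/UVN] := pselect (U w = V w); [right; rewrite -UV|left].
- by rewrite PN.
Qed.

Lemma approximable_self (U : T -> R) : mf U ->
  approximable P [set sigma_rv U] U.
Proof.
move=> mU e e0; exists (sigma_rv U), U; split => //.
rewrite [X in P X](_ : _ = set0) ?measure0 ?lee_fin ?ltW//.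
by apply/seteqP; split => // w /=; rewrite subrr normr0 leNgt e0.
Qed.

Lemma approximable_scale (S : set (set (set T))) (c : R) (U : T -> R) : mf U ->
  approximable P S U -> approximable P S (fun w => c * U w).
Proof.
move=> mU SU e e0.
have c1 : 0 < `|c| + 1 by rewrite ltr_wpDl.
have c1' : 1 <= `|c| + 1 by rewrite lerDr.
have e'0 : 0 < e / (`|c| + 1) by rewrite divr_gt0.
have [G [U' [SG mU' U'G PU]]] := SU _ e'0.
exists G, (fun w => c * U' w); split => //.
- exact: measurable_funM.
- apply: subset_trans U'G; apply: (sigma_rv_comp (phi := fun x => c * x)).
  exact: measurable_funM.
- apply: (@le_trans _ _ (P [set w | e / (`|c| + 1) <= `|U w - U' w|])).
    apply: le_measure; rewrite ?inE//=.
    + apply: measurable_large; exact: measurable_funM.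
    + exact: measurable_large.
    + move=> w /=; rewrite -mulrBr normrM ler_pdivrMr// => /le_trans; apply.
      by rewrite mulrC ler_wpM2l// lerDl.
  by rewrite (le_trans PU)// lee_fin ler_pdivrMr// ler_peMr// ltW.
Qed.

Lemma generated_sigma_add (F : set (set T)) (U V : T -> R) :
  sigma_rv U `<=` <<s F >> -> sigma_rv V `<=` <<s F >> ->
  sigma_rv (fun w => U w + V w) `<=` <<s F >>.
Proof.
move=> UF VF; pose TF := g_sigma_algebraType F.
have m (W : T -> R) : sigma_rv W `<=` <<s F >> ->
    measurable_fun [set: TF] (W : TF -> R).
  by move=> WF _ B mB; apply: WF; exists B.
have mUV : measurable_fun [set: TF] (fun w : TF => U w + V w).
  by apply: measurable_funD; exact: m.
apply: sigma_rv_subset => B mB.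
by have := mUV measurableT B mB; rewrite setTI.
Qed.

(** Finite lists of times are what Riemann sums see; approximants with different lists are brought
    together by concatenating them. *)
Definition window (D : set R) : set (set (set T)) :=
  [set G | exists2 l : seq R, {in l, forall u, D u} & G = increments_sigma Z l].

Lemma approximable_add (D : set R) (U V : T -> R) : mf U -> mf V ->
  approximable P (window D) U -> approximable P (window D) V ->
  approximable P (window D) (fun w => U w + V w).
Proof.
move=> mU mV aU aV e e0; have e2 : 0 < e / 2 by rewrite divr_gt0.
have [_ [U' [[l lD ->] mU' U'l PU]]] := aU _ e2.
have [_ [V' [[k kD ->] mV' V'k PV]]] := aV _ e2.
exists (increments_sigma Z (l ++ k)), (fun w => U' w + V' w); split.
- by exists (l ++ k) => // u; rewrite mem_cat => /orP[/lD|/kD].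
- exact: measurable_funD.
- apply: generated_sigma_add.
    apply: (subset_trans U'l); apply: increments_sigma_sub => u ul.
    by rewrite mem_cat ul.
  apply: (subset_trans V'k); apply: increments_sigma_sub => u ul.
  by rewrite mem_cat ul orbT.
- rewrite [X in (_ <= X%:E)%E]splitr.
  apply: (probability_union_le _ _ _ _ PU PV).
  + by apply: measurable_large; exact: measurable_funD.
  + exact: measurable_large.
  + exact: measurable_large.
  + move=> w /= h.
    have [UU'|UU'] := leP (e / 2) `|U w - U' w|; first by left.
    right; move: h; have -> : U w + V w - (U' w + V' w) =
      (U w - U' w) + (V w - V' w) by ring.
    by have := ler_normD (U w - U' w) (V w - V' w); lra.
Qed.

Lemma approximable_window0 (D : set R) : approximable P (window D) (cst 0).
Proof.
move=> e e0; exists (increments_sigma Z [::]), (cst 0); split => //.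
- by exists [::].
- apply: sigma_rv_subset => B mB; rewrite preimage_cst.
  have sA : sigma_algebra setT (increments_sigma Z [::]).
    exact: smallest_sigma_algebra.
  case: ifP => _; last by case: sA.
  by case: sA => s0 /(_ _ s0); rewrite setD0.
- rewrite [X in P X](_ : _ = set0) ?measure0 ?lee_fin ?ltW//.
  by apply/seteqP; split => // w /=; rewrite subrr normr0 leNgt e0.
Qed.

Lemma approximable_sum (D : set R) (I : eqType) (s : seq I) (U : I -> T -> R) :
  (forall i, mf (U i)) -> {in s, forall i, approximable P (window D) (U i)} ->
  approximable P (window D) (fun w => \sum_(i <- s) U i w).
Proof.
move=> mU; elim: s => [_|i s ih aU].
  by under eq_fun do rewrite big_nil; exact: approximable_window0.
under eq_fun do rewrite big_cons; apply: approximable_add => //.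
- exact: measurable_sum.
- by apply: aU; rewrite mem_head.
- by apply: ih => k ks; apply: aU; rewrite inE ks orbT.
Qed.

Lemma increments_sigma_sum (l : seq R) (I : eqType) (s : seq I) (c : I -> R)
    (u v : I -> R) :
  {in s, forall i, [/\ u i \in l, v i \in l & u i <= v i]} ->
  sigma_rv (fun w => \sum_(i <- s) c i * (Z (v i) w - Z (u i) w))
    `<=` increments_sigma Z l.
Proof.
elim: s => [_|i s ih h].
  apply: sigma_rv_subset => B mB.
  under eq_fun do rewrite big_nil.
  rewrite preimage_cst.
  have sA : sigma_algebra setT (increments_sigma Z l).
    exact: smallest_sigma_algebra.
  case: ifP => _; last by case: sA.
  by case: sA => s0 /(_ _ s0); rewrite setD0.
under eq_fun do rewrite big_cons.
apply: generated_sigma_add; last first.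
  by apply: ih => k ks; apply: h; rewrite inE ks orbT.
have [ul vl uv] := h i (mem_head _ _).
apply: (@subset_trans _ (sigma_rv (Z (v i) \- Z (u i)))).
  apply: (sigma_rv_comp (phi := fun x => c i * x)); exact: measurable_funM.
apply: sigma_rv_subset => B mB; apply: sub_sigma_algebra.
by exists (u i), (v i), B.
Qed.

End approximable_closure.

Section two_piece_partition.
Context (R : realType).

(* The grid contains [r], so that Riemann sums of the integrals defining [X r] and
   [X s] cancel on [0, r]. *)
Definition two_piece (r s : R) (N k : nat) : R :=
  if (k <= N)%N then k%:R * (r / N%:R) else r + (k - N)%:R * ((s - r) / N%:R).

Lemma two_piece_tagged (r s mesh : R) (N : nat) : (0 < N)%N -> 0 <= r <= s ->
  r / N%:R < mesh -> (s - r) / N%:R < mesh ->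
  tagged_partition 0 r mesh N (two_piece r s N) (two_piece r s N) /\
  tagged_partition 0 s mesh (N + N) (two_piece r s N) (two_piece r s N).
Proof.
move=> N0 /andP[r0 rs] rm sm.
have Nr : (N%:R : R) != 0 by rewrite pnatr_eq0 -lt0n.
have x0 : two_piece r s N 0 = 0 by rewrite /two_piece leq0n mul0r.
have xN : two_piece r s N N = r by rewrite /two_piece leqnn mulrC divfK.
have x2N : two_piece r s N (N + N) = s.
  rewrite /two_piece leqNgt -[X in (X < _)%N]addn0 ltn_add2l N0/= addnK.
  by rewrite mulrC divfK// addrC subrK.
have step k : two_piece r s N k <= two_piece r s N k.+1 /\
    two_piece r s N k.+1 - two_piece r s N k < mesh.
  rewrite /two_piece; case: (ltngtP k N) => [kN|kN|->].
  - suff -> : k.+1%:R * (r / N%:R) = k%:R * (r / N%:R) + r / N%:R :> R.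
      by have := divr_ge0 r0 (ler0n R N); lra.
    by rewrite -natr1 mulrDl mul1r.
  - have -> : (k.+1 - N)%:R = (k - N)%:R + 1 :> R by rewrite subSn ?(ltnW kN)// natr1.
    rewrite [(_ + 1) * _]mulrDl mul1r.
    have : 0 <= (s - r) / N%:R by rewrite divr_ge0// subr_ge0.
    by lra.
  - rewrite subSnn mul1r mulrC divfK//.
    have : 0 <= (s - r) / N%:R by rewrite divr_ge0// subr_ge0.
    by lra.
split; split => // k _; have [h1 h2] := step k; by rewrite lexx h1.
Qed.

Lemma two_piece_ge (r s : R) (N k : nat) : 0 <= r <= s -> (N <= k)%N ->
  (0 < N)%N -> r <= two_piece r s N k.
Proof.
move=> /andP[r0 rs] Nk N0; rewrite /two_piece; case: leqP => [kN|_].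
  have -> : k = N by apply/eqP; rewrite eqn_leq kN.
  by rewrite mulrC divfK// pnatr_eq0 -lt0n.
by rewrite lerDl mulr_ge0// divr_ge0// subr_ge0.
Qed.

Lemma two_piece_le (r s : R) (N k : nat) : 0 <= r <= s -> (N <= k <= N + N)%N ->
  (0 < N)%N -> two_piece r s N k <= s.
Proof.
move=> /andP[r0 rs] /andP[Nk kN2] N0; rewrite /two_piece; case: leqP => [kN|_].
  have -> : k = N by apply/eqP; rewrite eqn_leq kN.
  by rewrite mulrC divfK// pnatr_eq0 -lt0n.
rewrite -lerBrDl mulrC mulrAC ler_pdivrMr ?ltr0n//.
by rewrite ler_wpM2l ?subr_ge0// ler_nat leq_subLR.
Qed.

End two_piece_partition.

Section OU_markov.
Context d (T : measurableType d) (R : realType) (P : probability T R).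
Local Notation mf := (measurable_fun [set: T]).
Variables (alpha beta lambda : R) (X : R -> {RV P >-> R}).
Hypotheses (halpha : 0 < alpha) (hlambda : 0 < lambda).

Section with_driver.
Variable Z : R -> {RV P >-> R}.
Hypothesis hZ : levy_process P (fun t => Z t).
Hypothesis ZX : independent2 P (sigma_process (fun t => Z t)) (sigma_rv (X 0)).
Hypothesis XI : forall t, 0 <= t -> exists I : {RV P >-> R},
  is_stochastic_integral P (fun s => expR (- lambda * (t - s)))
    (fun s => Z (lambda * s)) 0 t I /\
  {ae P, forall w, X t w = expR (- lambda * t) * X 0 w + I w}.

(* The innovation: the integral over ]r, s]. *)
Let J (r s : R) (w : T) := X s w - expR (- lambda * (s - r)) * X r w.

Let mJ r s : mf (J r s).
Proof. by apply: measurable_funB => //; exact: measurable_funM. Qed.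

(** The kernel at [s] is [expR (- lambda * (s - r))] times the kernel at [r]. Hence [X 0] drops out
    of the innovation, which is a combination of the two integrals, and in the same combination of
    Riemann sums only the increments after [lambda * r] remain. *)
Lemma OU_innovation_approximable (r s : R) : 0 <= r <= s ->
  approximable P (window Z `[lambda * r, lambda * s]) (J r s).
Proof.
move=> /andP[r0 rs]; have s0 : 0 <= s := le_trans r0 rs.
have [Ir [Ir_int XIr]] := XI r0; have [Is [Is_int XIs]] := XI s0.
pose c := expR (- lambda * (s - r)).
have c1 : `|c| <= 1.
  rewrite ger0_norm ?expR_ge0// -expR0 ler_expR mulNr oppr_le0.
  by rewrite mulr_ge0 ?subr_ge0// ltW.
have cE x : expR (- lambda * (s - x)) = c * expR (- lambda * (r - x)).
  by rewrite /c -expRD; congr expR; ring.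
have mI : mf (fun w => Is w - c * Ir w).
  by apply: measurable_funB => //; exact: measurable_funM.
apply: (approximable_ae (V := fun w => Is w - c * Ir w)) => //.
  apply: filterS2 XIr XIs => w; rewrite /J => -> ->.
  have -> : expR (- lambda * s) = c * expR (- lambda * r).
    by have := cE 0; rewrite !subr0.
  by rewrite -/c; ring.
move=> e e0; have e2 : 0 < e / 2 by rewrite divr_gt0.
have [mr mr0 Hr] := Ir_int _ _ e2 e2; have [ms ms0 Hs] := Is_int _ _ e2 e2.
pose mesh := Num.min mr ms; have mesh0 : 0 < mesh by rewrite lt_min mr0.
(* Both [r] and [s - r] are at most [s], so this [N] makes both halves of the grid fine enough. *)
have [N N0 sN] : exists2 N, (0 < N)%N & s / N%:R < mesh.
  have : 0 <= s / mesh by rewrite divr_ge0// ltW.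
  move=> /Num.Theory.archi_boundP; set N := Num.bound _ => sN.
  have N0 : (0 < N)%N by rewrite -(ltr_nat R) (le_lt_trans _ sN)// divr_ge0// ltW.
  exists N => //; rewrite ltr_pdivrMr ?ltr0n// mulrC -ltr_pdivrMr//.
have rsN : 0 <= r <= s by rewrite r0 rs.
have rN : r / N%:R < mesh.
  by rewrite (le_lt_trans _ sN)// ler_pM2r// invr_gt0 ltr0n.
have srN : (s - r) / N%:R < mesh.
  by rewrite (le_lt_trans _ sN)// ler_pM2r ?invr_gt0 ?ltr0n// gerBl.
pose x := two_piece r s N.
have [tr _] : tagged_partition 0 r mr N x x /\ tagged_partition 0 s mr (N + N) x x.
  by apply: two_piece_tagged => //; [apply: (lt_le_trans rN)|apply: (lt_le_trans srN)];
    rewrite ge_min lexx.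
have [_ ts] : tagged_partition 0 r ms N x x /\ tagged_partition 0 s ms (N + N) x x.
  by apply: two_piece_tagged => //; [apply: (lt_le_trans rN)|apply: (lt_le_trans srN)];
    rewrite ge_min lexx orbT.
pose Ss w := \sum_(k < N + N) expR (- lambda * (s - x k)) *
  (Z (lambda * x k.+1) w - Z (lambda * x k) w).
pose Sr w := \sum_(k < N) expR (- lambda * (r - x k)) *
  (Z (lambda * x k.+1) w - Z (lambda * x k) w).
have PSs : (P [set w | (e / 2 <= `|Ss w - Is w|)%R] <= (e / 2)%:E)%E.
  exact: Hs ts.
have PSr : (P [set w | (e / 2 <= `|Sr w - Ir w|)%R] <= (e / 2)%:E)%E.
  exact: Hr tr.
pose J' w := \sum_(k <- index_iota N (N + N))
  expR (- lambda * (s - x k)) * (Z (lambda * x k.+1) w - Z (lambda * x k) w).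
have mJ' : mf J' by apply: measurable_sum => k; apply: measurable_funM => //;
  exact: measurable_funB.
have J'E w : J' w = Ss w - c * Sr w.
  rewrite /J' /Ss /Sr.
  rewrite -(big_mkord xpredT (fun k => expR (- lambda * (s - x k)) *
    (Z (lambda * x k.+1) w - Z (lambda * x k) w))).
  rewrite -(big_mkord xpredT (fun k => expR (- lambda * (r - x k)) *
    (Z (lambda * x k.+1) w - Z (lambda * x k) w))).
  rewrite [in RHS](big_cat_nat (n := N)) ?leq_addr//= mulr_sumr addrAC.
  rewrite [X in _ = X + _](_ : _ = 0) ?add0r//.
  rewrite -sumrB big1// => k _; rewrite cE; ring.
pose l := [seq lambda * x k | k <- iota N N.+1].
have inl k : (N <= k <= N + N)%N -> lambda * x k \in l.
  by move=> kN; apply/mapP; exists k => //; rewrite mem_iota addnS ltnS.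
exists (increments_sigma Z l), J'; split => //.
- exists l => // _ /mapP[k + ->]; rewrite mem_iota addnS ltnS => kN.
  case/andP: (kN) => Nk _ /=.
  rewrite in_itv/= !ler_pM2l//; apply/andP; split.
    exact: two_piece_ge.
  exact: two_piece_le.
- apply: increments_sigma_sum => k; rewrite mem_index_iota => /andP[Nk kN].
  split; [apply: inl|apply: inl|]; rewrite ?Nk ?(ltnW kN)//.
    by rewrite (leq_trans Nk).
  rewrite ler_pM2l//.
  by case: ts => _ _ /(_ k kN)[/andP[h1 h2] _]; exact: le_trans h2.
- rewrite [X in (_ <= X%:E)%E]splitr.
  apply: (probability_union_le _ _ _ _ PSs PSr).
  + exact: measurable_large.
  + apply: measurable_large => //; apply: measurable_sum => k.
    by apply: measurable_funM => //; exact: measurable_funB.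
  + apply: measurable_large => //; apply: measurable_sum => k.
    by apply: measurable_funM => //; exact: measurable_funB.
  + move=> w /=; rewrite J'E => h.
    have [hs|hs] := leP (e / 2) `|Ss w - Is w|; first by left.
    right; move: h; have -> : Is w - c * Ir w - (Ss w - c * Sr w) =
      c * (Sr w - Ir w) - (Ss w - Is w) by ring.
    have := ler_normB (c * (Sr w - Ir w)) (Ss w - Is w).
    rewrite normrM; have := ler_wpM2r (normr_ge0 (Sr w - Ir w)) c1.
    by lra.
Qed.

(** Three independent sources: [X 0], the driver before [lambda * r], and the driver after it. Every
    past value is a multiple of [X 0] plus an innovation from time 0, so the past is [a * X 0 + V].
    The initial value is split off on both sides, then [V] is separated from the last innovation. *)
Lemma OU_innovation_independent (s : seq (R * R)) (z r t : R) :
  {in s, forall p, 0 <= p.2 <= r} -> 0 <= r <= t ->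
  ('E_P[fun w => expR (\sum_(p <- s) p.1 * X p.2 w + z * J r t w)] =
   'E_P[fun w => expR (\sum_(p <- s) p.1 * X p.2 w)] *
   'E_P[fun w => expR (z * J r t w)])%E.
Proof.
move=> sr rt; have r0 : 0 <= r by case/andP: rt.
pose V w := \sum_(p <- s) p.1 * J 0 p.2 w.
pose a := \sum_(p <- s) p.1 * expR (- lambda * p.2).
have mV : mf V by apply: measurable_sum => p; exact: measurable_funM.
have mzJ : mf (fun w => z * J r t w) by exact: measurable_funM.
have maX : mf (fun w => a * X 0 w) by exact: measurable_funM.
have YE w : \sum_(p <- s) p.1 * X p.2 w = a * X 0 w + V w.
  rewrite /a /V mulr_suml -big_split/=; apply: eq_bigr => p _.
  by rewrite /J subr0; ring.
have aV : approximable P (window Z `[0, lambda * r]) V.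
  apply: approximable_sum => [p|p ps]; first exact: measurable_funM.
  apply: approximable_scale => //.
  have /andP[p0 pr] := sr _ ps.
  have : (0 : R) <= 0 <= p.2 by apply/andP.
  move=> /OU_innovation_approximable h e e0.
  have [G [U' [[l lD ->] mU' U'G PU]]] := h e e0.
  exists (increments_sigma Z l), U'; split => //; exists l => // u /lD /=.
  rewrite !in_itv/= mulr0 => /andP[-> /le_trans]; apply.
  by rewrite ler_pM2l.
have azJ : approximable P (window Z `[lambda * r, lambda * t]) (fun w => z * J r t w).
  exact: approximable_scale (OU_innovation_approximable rt).
have lr0 : 0 <= lambda * r by rewrite mulr_ge0// ltW.
have aa (D : set R) (U : T -> R) : D `<=` [set u | 0 <= u] ->
    approximable P (window Z D) U -> approximable P
    [set sigma_process (fun t => Z t)] U.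
  move=> D0 aU e e0; have [_ [U' [[l lD ->] mU' U'G PU]]] := aU e e0.
  exists (sigma_process (fun t => Z t)), U'; split => //.
  apply: (subset_trans U'G); apply: smallest_sub.
    exact: smallest_sigma_algebra.
  move=> _ [u [v [B [ul vl uv mB ->]]]].
  pose F := [set E | exists t, 0 <= t /\
        exists B : set R, measurable B /\ E = Z t @^-1` B].
  pose TF := g_sigma_algebraType F.
  have mZ x : 0 <= x -> measurable_fun [set: TF] (Z x : TF -> R).
    move=> x0 _ C mC; apply: sub_sigma_algebra; exists x; split => //.
    by exists C; rewrite setTI.
  have : measurable_fun [set: TF] (Z v \- Z u : TF -> R).
    by apply: measurable_funB; apply: mZ; apply: D0; apply: lD.
  by move=> /(_ measurableT B mB); rewrite setTI.
have D1 : [set` `[0, lambda * r]] `<=` [set u : R | 0 <= u].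
  by move=> u /=; rewrite in_itv/= => /andP[].
have D2 : [set` `[lambda * r, lambda * t]] `<=` [set u : R | 0 <= u].
  by move=> u /=; rewrite in_itv/= => /andP[+ _]; exact: le_trans.
have IX (G G' : set (set T)) : [set sigma_rv (fun w => a * X 0 w)] G ->
    [set sigma_process (fun t => Z t)] G' -> independent2 P G G'.
  move=> /= -> -> A B XA ZB; rewrite setIC muleC; apply: ZX => //.
  move: A XA; apply: (sigma_rv_comp (phi := fun x => a * x)).
  exact: measurable_funM.
have IZ (G G' : set (set T)) : window Z `[0, lambda * r] G ->
    window Z `[lambda * r, lambda * t] G' -> independent2 P G G'.
  move=> [l lD ->] [l' lD' ->]; apply: (increments_independent (a := lambda * r)).
  - by case: hZ.
  - exact: lr0.
  - by move=> u /lD /=; rewrite in_itv.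
  - by move=> u /lD' /=; rewrite in_itv/= => /andP[].
under eq_fun do rewrite YE -addrA.
under [in RHS]eq_fun do rewrite YE.
rewrite (expectation_exp_independent (S := [set sigma_rv (fun w => a * X 0 w)])
  (S' := [set sigma_process (fun t => Z t)]) maX _ _ _ IX); last 3 first.
- exact: measurable_funD.
- exact: approximable_self.
- have sub0 (D D' : set R) U : D `<=` D' -> approximable P (window Z D) U ->
      approximable P (window Z D') U.
    move=> DD' aU e e0; have [G [U' [[l lD ->] mU' U'G PU]]] := aU e e0.
    exists (increments_sigma Z l), U'; split => //.
    by exists l => // u /lD; exact: DD'.
  apply: (aa [set u : R | 0 <= u]) => //; apply: approximable_add => //.
    exact: sub0 aV.
  exact: sub0 azJ.
rewrite (expectation_exp_independent (S := [set sigma_rv (fun w => a * X 0 w)])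
  (S' := [set sigma_process (fun t => Z t)]) maX mV _ _ IX); last 2 first.
- exact: approximable_self.
- exact: aa aV.
by rewrite (expectation_exp_independent mV mzJ aV azJ IZ) muleA.
Qed.

End with_driver.
End OU_markov.

(** * Exponential moments of the Ornstein-Uhlenbeck process *)

Section log_gamma_mgf.
Context (R : realType) (alpha beta : R).
Hypotheses (alpha0 : 0 < alpha) (beta0 : 0 < beta).

Lemma ln_sub_le (u v : R) : 0 < u -> 0 < v -> ln u - ln v <= (u - v) / v.
Proof.
move=> u0 v0; rewrite -ln_div ?posrE//.
have -> : u / v = 1 + (u - v) / v by rewrite mulrBl divff ?gt_eqF// addrC subrK.
apply: le_ln1Dx; rewrite mulrBl divff ?gt_eqF//.
by have := divr_gt0 u0 v0; lra.
Qed.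

Lemma concave_ln_convex_comb (s u v : R) : 0 <= s <= 1 -> 0 < u -> 0 < v ->
  s * ln u + (1 - s) * ln v <= ln (s * u + (1 - s) * v).
Proof.
move=> /andP[s0 s1] u0 v0; set w := s * u + _.
have w0 : 0 < w.
  have [s00|s'] := eqVneq s 0.
    by rewrite /w s00 mul0r add0r subr0 mul1r.
  have sp : 0 < s by rewrite lt0r s'.
  by rewrite /w ltr_pwDl ?mulr_gt0// mulr_ge0 ?subr_ge0// ltW.
have := ler_wpM2l s0 (ln_sub_le u0 w0).
have s1' : 0 <= 1 - s by rewrite subr_ge0.
have := ler_wpM2l s1' (ln_sub_le v0 w0).
have : s * ((u - w) / w) + (1 - s) * ((v - w) / w) = 0.
  rewrite !mulrA -mulrDl (_ : _ + _ = 0) ?mul0r// /w; ring.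
by lra.
Qed.

(* The logarithm of the moment generating function. *)
Definition gam (z : R) : R := - beta * ln (1 - z / alpha).

Let pos z : z < alpha -> 0 < 1 - z / alpha.
Proof. by move=> za; rewrite subr_gt0 ltr_pdivrMr// mul1r. Qed.

Lemma gam0 : gam 0 = 0.
Proof. by rewrite /gam mul0r subr0 ln1 mulr0. Qed.

Lemma gam_nd x z : x <= z -> z < alpha -> gam x <= gam z.
Proof.
move=> xz za; rewrite /gam; apply: ler_wnM2l; first by rewrite oppr_le0 ltW.
rewrite ler_ln ?posrE ?pos//; last exact: le_lt_trans za.
by rewrite lerD2l lerN2 ler_pM2r ?invr_gt0.
Qed.

Lemma gam_ge0 z : 0 <= z < alpha -> 0 <= gam z.
Proof. by move=> /andP[z0 za]; rewrite -gam0 gam_nd. Qed.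

Lemma gam_sub_le x z : x < alpha -> z < alpha ->
  gam z - gam x <= beta * (z - x) / (alpha - z).
Proof.
move=> xa za; have az : 0 < alpha - z by rewrite subr_gt0.
have := ln_sub_le (pos xa) (pos za).
have -> : (1 - x / alpha - (1 - z / alpha)) / (1 - z / alpha) =
   (z - x) / (alpha - z).
  by field; rewrite !gt_eqF.
move=> /(ler_wpM2l (ltW beta0)); rewrite /gam mulrA; lra.
Qed.

Lemma gam_convex s x z : 0 <= s <= 1 -> x < alpha -> z < alpha ->
  gam (s * x + (1 - s) * z) <= s * gam x + (1 - s) * gam z.
Proof.
move=> s01 xa za; have := concave_ln_convex_comb s01 (pos xa) (pos za).
move=> /(ler_wpM2l (ltW beta0)); rewrite /gam.
have -> : s * (1 - x / alpha) + (1 - s) * (1 - z / alpha) =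
  1 - (s * x + (1 - s) * z) / alpha by ring.
by lra.
Qed.

Lemma expR_gam z : z < alpha -> expR (gam z) = (1 - z / alpha) `^ (- beta).
Proof. by move=> za; rewrite /powR gt_eqF ?pos// /gam. Qed.

Lemma mean_log_factorE : 1 < alpha -> mean_log_factor beta alpha = gam 1.
Proof.
move=> a1; rewrite /mean_log_factor div1r lnV ?posrE ?powR_gt0 ?pos//.
by rewrite ln_powR /gam mulNr.
Qed.

Variable m : R.
Hypotheses (m1 : 1 < m) (ma : m < alpha).

(* The hypothesis on [b] in the theorem reads [slope < ln b], see gamma_threshold. *)
Definition slope : R := (gam m - gam 1 * m) / (m - 1).

Let a1 : 1 < alpha. Proof. exact: lt_trans ma. Qed.
Let m0 : 0 < m. Proof. exact: lt_trans m1. Qed.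

Lemma gam1_ge0 : 0 <= gam 1. Proof. by rewrite gam_ge0// ler01 a1. Qed.

Lemma gam_le_linear q : 0 <= q <= 1 -> gam q <= gam 1 * q.
Proof.
move=> q01; have := gam_convex q01 a1 alpha0.
by rewrite !mulr1 !mulr0 gam0 mulr0 !addr0 mulrC.
Qed.

(** Convexity and [gam 0 = 0] give [gam 1 <= gam m / m]. *)
Lemma slope_ge0 : 0 <= slope.
Proof.
apply: divr_ge0; last by rewrite subr_ge0 ltW.
have h : 0 <= m^-1 <= 1 by rewrite invr_ge0 ltW//= invf_le1// ltW.
have := gam_convex h ma alpha0.
rewrite mulVf ?gt_eqF// mulr0 gam0 mulr0 !addr0 => /(ler_wpM2r (ltW m0)).
have -> : m^-1 * gam m * m = gam m by field; rewrite gt_eqF.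
by rewrite subr_ge0.
Qed.

(** The right side is the chord of the convex function [gam] over [1, m]. *)
Lemma gam_le_slope z : 1 <= z <= m -> gam z <= gam 1 * z + slope * (z - 1).
Proof.
move=> /andP[z1 zm]; have m1' : 0 < m - 1 by rewrite subr_gt0.
pose s := (m - z) / (m - 1).
have s01 : 0 <= s <= 1.
  by rewrite divr_ge0 ?subr_ge0 ?(ltW m1)//= ler_pdivrMr// mul1r; lra.
have := gam_convex s01 a1 ma.
have -> : s * 1 + (1 - s) * m = z by rewrite /s; field; rewrite gt_eqF.
move=> /le_trans; apply; rewrite le_eqVlt; apply/orP; left; apply/eqP.
by rewrite /s /slope; field; rewrite gt_eqF.
Qed.

Variable lambda : R.
Hypothesis lambda0 : 0 < lambda.

(** [near_cst] bounds the growth of [gam] from [z * expR (- lambda * D)] to [z <= m]: the exponent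
    moves by at most [m * lambda * D], and [gam] has slope at most [beta / (alpha - m)] there.
    [far_cst] bounds [(gam 1 + slope) * x] for a decayed exponent [x], which is what remains of the
    interaction at large gaps. *)
Definition near_cst : R := beta * lambda * m / (alpha - m).
Definition far_cst : R := (gam 1 + slope) * m.

(* The cost of a gap [D] between successive times in a mixed moment: the first branch
   is sharp at coinciding times, the second one reflects exponential decorrelation. *)
Definition log_gap (D : R) : R :=
  Num.min (slope + near_cst * D) (far_cst * expR (- lambda * D)).

Lemma near_cst_ge0 : 0 <= near_cst.
Proof.
rewrite /near_cst divr_ge0 ?subr_ge0 ?(ltW ma)//.
by rewrite !mulr_ge0// ltW.
Qed.

Lemma far_cst_ge0 : 0 <= far_cst.
Proof. by rewrite mulr_ge0 ?addr_ge0 ?gam1_ge0 ?slope_ge0// ltW. Qed.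

Lemma expRN_le1 (x : R) : 0 <= x -> 0 < expR (- x) <= 1.
Proof. by move=> x0; rewrite expR_gt0 -expR0 ler_expR oppr_le0. Qed.

(** The price of removing the latest time: its exponent [z] becomes [x] at distance [D]. The linear
    terms record the change of [gam 1 * z + slope * (z - 1)] when [1 + x] replaces [z]. The near
    bound discards nonnegative terms and uses the slope of [gam]; the far bound uses the chord and
    [gam x >= 0]. *)
Lemma log_gap_step z x D : 1 <= z <= m -> 0 <= D ->
  x = z * expR (- lambda * D) ->
  gam z - gam x - gam 1 * (z - x) - slope * (z - 1 - x) <= log_gap D.
Proof.
move=> /andP[z1 zm] D0; set e := expR _ => xE.
have lD : 0 <= lambda * D by rewrite mulr_ge0// ltW.
have /andP[e0 e1] : 0 < e <= 1 by rewrite /e mulNr expRN_le1.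
have eD : 1 - e <= lambda * D.
  by have := expR_ge1Dx (- lambda * D); rewrite -/e; lra.
have z0 : 0 < z by rewrite (lt_le_trans _ z1).
have za : z < alpha := le_lt_trans zm ma.
have xz : x <= z by rewrite xE ler_piMr// ltW.
have x0 : 0 < x by rewrite xE mulr_gt0.
have xa : x < alpha := le_lt_trans xz za.
have c0 := gam1_ge0; have t0 := slope_ge0.
rewrite /log_gap -/e le_min; apply/andP; split.
  have h1 := gam_sub_le xa za.
  have h2 : beta * (z - x) / (alpha - z) <= near_cst * D.
    rewrite /near_cst.
    have : (alpha - z)^-1 <= (alpha - m)^-1.
      by rewrite lef_pV2 ?posrE ?subr_gt0// lerD2l lerN2.
    have h : beta * (z - x) <= beta * lambda * m * D.
      rewrite -!mulrA ler_pM2l// xE.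
      have -> : z - z * e = z * (1 - e) by ring.
      have -> : lambda * (m * D) = m * (lambda * D) by ring.
      by apply: ler_pM => //; [exact: ltW|rewrite subr_ge0].
    have h0 : 0 <= beta * (z - x) by rewrite mulr_ge0 ?subr_ge0// ltW.
    have hi : 0 <= (alpha - z)^-1 by rewrite invr_ge0 subr_ge0 ltW.
    by move=> /(ler_pM h0 hi h) /le_trans; apply; rewrite mulrAC.
  have : 0 <= gam 1 * (z - x) by rewrite mulr_ge0// subr_ge0.
  have : 0 <= slope * (z - x) by rewrite mulr_ge0// subr_ge0.
  by lra.
have h1 : gam z <= gam 1 * z + slope * (z - 1) by rewrite gam_le_slope// z1.
have h2 : 0 <= gam x by rewrite gam_ge0// ltW.
have h3 : (gam 1 + slope) * x <= far_cst * e.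
  rewrite /far_cst xE mulrA ler_pM2r// ler_wpM2l// addr_ge0//.
move: h1 h3; set g1 := gam 1; set sl := slope => h1 h3.
have -> : g1 * (z - x) = g1 * z - g1 * x by ring.
have -> : sl * (z - 1 - x) = sl * (z - 1) - sl * x by ring.
by move: h3; rewrite mulrDl; lra.
Qed.

End log_gamma_mgf.

Section same_law_expectation.
Context (R : realType) d1 d2 (T1 : measurableType d1) (T2 : measurableType d2).
Context (P1 : probability T1 R) (P2 : probability T2 R).

(** The exponent depends on finitely many coordinates, so both sides integrate one function against
    a common law. [h] is the identity for stationarity and [ln] for the copies of [Lambda]. *)
Lemma same_fdd_expectation_exp (X : R -> T1 -> R) (Y : R -> T2 -> R) (h : R -> R)
    (s : seq (R * R)) :
  same_fdd P1 P2 X Y -> (forall t, measurable_fun setT (X t)) ->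
  (forall t, measurable_fun setT (Y t)) -> measurable_fun setT h ->
  {in s, forall p, 0 <= p.2} ->
  ('E_P1[fun w => expR (\sum_(p <- s) p.1 * h (X p.2 w))] =
   'E_P2[fun w => expR (\sum_(p <- s) p.1 * h (Y p.2 w))])%E.
Proof.
move=> XY mX mY mh s0.
pose n := size s; pose ts : n.-tuple R := map_tuple snd (in_tuple s).
pose phi (v : n.-tuple R) : R :=
  expR (\sum_(i < n) (tnth (in_tuple s) i).1 * h (tnth v i)).
have mphi : measurable_fun setT phi.
  apply: measurableT_comp => //; apply: measurable_sum => i.
  apply: measurable_funM => //; apply: measurableT_comp => //.
  exact: measurable_tnth.
have mfdd d (T : measurableType d) (U : R -> T -> R) :
    (forall t, measurable_fun setT (U t)) -> measurable_fun setT (fdd_vector U ts).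
  move=> mU; apply/measurable_fun_tnthP => i.
  rewrite (_ : _ \o _ = U (tnth ts i))//.
  by apply/funext => w /=; rewrite tnth_mktuple.
have E d (T : measurableType d) (P : probability T R) (U : R -> T -> R)
    (mU : forall t, measurable_fun setT (U t)) :
    ('E_P[fun w => expR (\sum_(p <- s) p.1 * h (U p.2 w))] =
     \int[pushforward P (fdd_vector U ts)]_v (phi v)%:E)%E.
  rewrite ge0_integral_pushforward//; last 3 first.
  - exact: mfdd.
  - exact/measurable_EFinP.
  - by move=> v _; rewrite lee_fin expR_ge0.
  rewrite preimage_setT unlock; apply: eq_integral => w _ /=; congr (expR _)%:E.
  rewrite (big_tnth _ _ s); apply: eq_bigr => i _.
  by rewrite tnth_mktuple tnth_map.
rewrite !E//.
have mm d (T : measurableType d) (P : probability T R) (U : R -> T -> R)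
    (mU : forall t, measurable_fun setT (U t)) :
    {m : {measure set (n.-tuple R) -> \bar R} |
      (m : set (n.-tuple R) -> \bar R) = pushforward P (fdd_vector U ts)}.
  pose fM := isMeasurableFun.Build _ _ _ _ _ (mfdd _ _ _ mU).
  pose f : {mfun T >-> n.-tuple R} := HB.pack (fdd_vector U ts) fM.
  by exists (distribution P f).
have [m1 m1E] := mm _ _ P1 X mX; have [m2 m2E] := mm _ _ P2 Y mY.
rewrite -m1E -m2E; apply: eq_measure_integral => A mA _.
rewrite m1E m2E; apply: XY => // i.
by rewrite tnth_map s0// mem_tnth.
Qed.

End same_law_expectation.

Fixpoint gapsum (R : zmodType) (V : nmodType) (f : R -> V) (t : R) (l : seq R) : V :=
  if l is u :: l' then f (t - u) + gapsum f u l' else 0.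

Section OU_moments.
Context d (T : measurableType d) (R : realType) (P : probability T R).
Variables (alpha beta lambda : R) (X : R -> {RV P >-> R}).
Hypotheses (halpha : 0 < alpha) (hbeta : 0 < beta) (hlambda : 0 < lambda).
Hypotheses (hX : stationary_OU_type lambda X) (hX0 : gamma_law beta alpha (X 0)).
Local Notation gam := (gam alpha beta).

Lemma OU_marginal_mgf t z : 0 <= t -> z < alpha ->
  'E_P[fun w => expR (z * X t w)]%E = (expR (gam z))%:E.
Proof.
move=> t0 za; case: hX => + _ => /(_ t t0) XX.
have := @same_fdd_expectation_exp _ _ _ _ _ _ _ _ _ id [:: (z, 0)] XX.
move=> h; transitivity ('E_P[fun w => expR (\sum_(p <- [:: (z, 0%R : R)]) p.1 * X (p.2 + t) w)])%E.
  by congr expectation; apply/funext => w; rewrite big_seq1/= add0r.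
rewrite h//; last by move=> p; rewrite inE => /eqP ->.
rewrite expR_gam// -(hX0 za) /mmt_gen_fun; congr expectation.
by apply/funext => w; rewrite big_seq1/= mulrC.
Qed.

(** The innovation contributes an independent factor. Taking an empty past in the same factorisation
    shows this factor to be the ratio of two marginal generating functions, so it is determined by
    the gamma law alone. *)
Lemma OU_markov (s : seq (R * R)) (z r t : R) :
  {in s, forall p, 0 <= p.2 <= r} -> 0 <= r <= t -> z < alpha ->
  let x := z * expR (- lambda * (t - r)) in
  ('E_P[fun w => expR (\sum_(p <- s) p.1 * X p.2 w + z * X t w)] =
   'E_P[fun w => expR (\sum_(p <- s) p.1 * X p.2 w + x * X r w)] *
   (expR (gam z - gam x))%:E)%E.
Proof.
move=> sr /andP[r0 rt] za x; have t0 := le_trans r0 rt.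
case: hX => _ [Z [hZ ZX XI]].
have rtP : 0 <= r <= t by rewrite r0.
have xa : x < alpha.
  have [z0|z0] := leP z 0.
    by rewrite (le_lt_trans _ halpha)// mulr_le0_ge0// expR_ge0.
  rewrite (le_lt_trans _ za)// /x ler_piMr ?(ltW z0)// -expR0 ler_expR mulNr.
  by rewrite oppr_le0 mulr_ge0 ?subr_ge0// ltW.
have split1 (s' : seq (R * R)) : {in s', forall p, 0 <= p.2 <= r} ->
  ('E_P[fun w => expR (\sum_(p <- s') p.1 * X p.2 w + z * X t w)] =
   'E_P[fun w => expR (\sum_(p <- s') p.1 * X p.2 w + x * X r w)] *
   'E_P[fun w => expR (z * (X t w - expR (- lambda * (t - r)) * X r w))])%E.
  move=> sr'.
  have sr'' : {in (x, r) :: s', forall p, 0 <= p.2 <= r}.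
    by move=> p; rewrite inE => /orP[/eqP ->|/sr'//]; rewrite r0 /=.
  have := OU_innovation_independent hlambda hZ ZX XI z sr'' rtP.
  move=> h.
  transitivity ('E_P[fun w => expR (\sum_(p <- (x, r) :: s') p.1 * X p.2 w +
    z * (X t w - expR (- lambda * (t - r)) * X r w))])%E.
    congr expectation; apply/funext => w; congr expR.
    by rewrite big_cons /= /x; ring.
  rewrite h; congr (_ * _)%E; congr expectation; apply/funext => w; congr expR.
  by rewrite big_cons/= addrC.
rewrite split1//; congr (_ * _)%E.
have := split1 [::] (fun _ => ltac:(by [])).
have E0 (y u : R) : ('E_P[fun w => expR (\sum_(p <- [::] : seq (R * R)) p.1 * X p.2 w
    + y * X u w)] = 'E_P[fun w => expR (y * X u w)])%E.
  by congr expectation; apply/funext => w; rewrite big_nil add0r.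
rewrite (E0 z t) (E0 x r) (OU_marginal_mgf t0 za) (OU_marginal_mgf r0 xa).
move=> /(congr1 (fun y => (expR (- gam x))%:E * y)%E).
by rewrite -EFinM muleA -EFinM -!expRD addNr expR0 mul1e addrC => ->.
Qed.

Lemma OU_two_point (a z r t : R) : 0 <= r <= t -> z < alpha ->
  let e := expR (- lambda * (t - r)) in a + z * e < alpha ->
  'E_P[fun w => expR (a * X r w + z * X t w)]%E =
  (expR (gam (a + z * e) + gam z - gam (z * e)))%:E.
Proof.
move=> rt za e aza; have /andP[r0 _] := rt.
have := @OU_markov [:: (a, r)] z r t _ rt za.
have sr : {in [:: (a, r)], forall p : R * R, 0 <= p.2 <= r}.
  by move=> p; rewrite inE => /eqP ->; rewrite r0 /=.
move=> /(_ sr) /=; rewrite -/e.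
under eq_fun do rewrite big_seq1/=.
move=> ->.
transitivity ('E_P[fun w => expR ((a + z * e) * X r w)] *
  (expR (gam z - gam (z * e)))%:E)%E.
  congr (_ * _)%E; congr expectation; apply/funext => w; congr expR.
  by rewrite big_seq1/= mulrDl.
by rewrite OU_marginal_mgf// -EFinM -expRD addrA.
Qed.

Variable m : nat.
Hypotheses (m1 : (1 < m)%N) (ma : m%:R < alpha).
Local Notation slope := (slope alpha beta m%:R).
Local Notation log_gap := (log_gap alpha beta m%:R lambda).

(** Times are listed from the latest to the earliest. Removing [t] leaves the exponent [1 + x] at
    [u], with [x <= z], so the budget [z + size l <= m] is preserved, and [log_gap_step] accounts
    for the change of the bound. The general [z] is there for the induction; the use is at
    [z = 1]. *)
Lemma OU_product_moment (t : R) (l : seq R) (z : R) :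
  path >=%R t l -> {in t :: l, forall u, 0 <= u} ->
  1 <= z -> z + (size l)%:R <= m%:R ->
  ('E_P[fun w => expR (\sum_(u <- l) X u w + z * X t w)] <=
   (expR (gam 1 * ((size l)%:R + z) + slope * (z - 1) + gapsum log_gap t l))%:E)%E.
Proof.
have m1R : 1 < m%:R :> R by rewrite ltr1n.
elim: l t z => [|u l ih] t z /= pl t0 z1 zm.
  rewrite addr0 in zm.
  have za : z < alpha := le_lt_trans zm ma.
  under eq_fun do rewrite big_nil add0r.
  rewrite OU_marginal_mgf// ?t0 ?mem_head// lee_fin ler_expR add0r addr0.
  by rewrite gam_le_slope// z1.
have /andP[ut pl'] := pl.
have tt : 0 <= t by rewrite t0// mem_head.
have uu : 0 <= u by rewrite t0// inE mem_head orbT.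
have sl0 : (0 : R) <= (size l)%:R by [].
have zm' : z <= m%:R by move: zm; rewrite -natr1; lra.
have za : z < alpha := le_lt_trans zm' ma.
have utP : 0 <= u <= t by rewrite uu.
pose x := z * expR (- lambda * (t - u)).
have tu0 : 0 <= t - u by rewrite subr_ge0.
have /andP[e0 e1] : 0 < expR (- lambda * (t - u)) <= 1.
  by rewrite mulNr expRN_le1// mulr_ge0// ltW.
have z0 : 0 < z by rewrite (lt_le_trans _ z1).
have x0 : 0 <= x by rewrite mulr_ge0// ltW.
have xz : x <= z by rewrite /x ler_piMr// ltW.
have sr : {in [seq (1 : R, v) | v <- u :: l], forall p : R * R, 0 <= p.2 <= u}.
  move=> p /mapP[v vl ->] /=; rewrite t0 /=; last by rewrite inE vl orbT.
  move: vl; rewrite inE => /orP[/eqP ->//|vl].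
  by have /allP/(_ v vl) := order_path_min (rev_trans le_trans) pl'.
have := @OU_markov [seq (1 : R, v) | v <- u :: l] z u t sr utP za.
cbv zeta; rewrite -/x.
set L := 'E_P[_]%E; set L' := 'E_P[_]%E => LE.
have -> : 'E_P[fun w => expR (\sum_(v <- u :: l) X v w + z * X t w)]%E = L.
  congr expectation; apply/funext => w; congr expR; congr (_ + _).
  by rewrite big_map; apply: eq_bigr => v _; rewrite mul1r.
have L'E : L' = 'E_P[fun w => expR (\sum_(v <- l) X v w + (1 + x) * X u w)]%E.
  congr expectation; apply/funext => w; congr expR.
  rewrite big_map big_cons /= (eq_bigr (fun v => X v w)); last first.
    by move=> v _; rewrite mul1r.
  by ring.
rewrite LE L'E.
have := ih u (1 + x) pl' _ _ _.
have u0 : {in u :: l, forall v, 0 <= v} by move=> v vl; rewrite t0// inE vl orbT.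
have x1 : 1 <= 1 + x by rewrite lerDl.
have xm : 1 + x + (size l)%:R <= m%:R by move: zm; rewrite -natr1; lra.
move=> /(_ u0 x1 xm) h.
apply: (@le_trans _ _ ((expR (gam 1 * ((size l)%:R + (1 + x)) + slope * (1 + x - 1) +
   gapsum log_gap u l))%:E * (expR (gam z - gam x))%:E)%E).
  by apply: lee_wpmul2r => //; rewrite lee_fin expR_ge0.
rewrite -EFinM -expRD lee_fin ler_expR.
have zz : 1 <= z <= m%:R by rewrite z1.
have := log_gap_step halpha hbeta m1R ma hlambda zz tu0 (erefl x).
rewrite -natr1; set g1 := gam 1; set sl := slope.
set gs := gapsum _ _ _; set lg := log_gap _ => h2.
have -> : g1 * ((size l)%:R + 1 + z) + sl * (z - 1) + (lg + gs) =
  g1 * ((size l)%:R + (1 + x)) + sl * (1 + x - 1) + gs + (lg + g1 * (z - x) +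
    sl * (z - 1 - x)) by ring.
by move: h2; rewrite -/gam; lra.
Qed.

End OU_moments.

(** * Moments of sums *)

Section gap_sums.
Context (R : realType).

Lemma expRN_le_half (y : R) : 0 <= y <= 1 -> expR (- y) <= 1 - y / 2.
Proof.
move=> /andP[y0 y1]; rewrite expRN.
have h : (expR y)^-1 <= (1 + y)^-1.
  by rewrite lef_pV2 ?posrE ?expR_gt0 ?expR_ge1Dx// ltr_wpDr.
apply: (le_trans h); rewrite -div1r ler_pdivrMr ?ltr_wpDr//.
by nra.
Qed.

(** A discrete substitute for integrating [x ^ (a - 1)]; the factor 2 is the price of the elementary
    bound [expR (- y) <= 1 - y / 2]. *)
Lemma powR_diff_ge (a : R) (k : nat) : 0 < a <= 1 ->
  k.+1%:R `^ (a - 1) <= 2 / a * (k.+1%:R `^ a - k%:R `^ a) :> R.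
Proof.
move=> /andP[a0 a1].
have a2 : 1 <= 2 / a by rewrite ler_pdivlMr// mul1r (le_trans a1)// ler1n.
case: k => [|k]; first by rewrite !powR1 powR0 ?gt_eqF// subr0 mulr1.
set x : R := k.+2%:R; have x0 : 0 < x by rewrite ltr0n.
have x1 : 1 <= x by rewrite ler1n.
have xE : k.+1%:R = x * (1 - x^-1) :> R.
  by rewrite mulrBr divff ?gt_eqF// mulr1 /x -[X in _ = X - _]natr1 addrK.
have xm : 0 < 1 - x^-1 by rewrite subr_gt0 invf_lt1// ltr1n.
have h1 : k.+1%:R `^ a <= x `^ a * (1 - a / x / 2).
  rewrite xE powRM ?(ltW x0) ?(ltW xm)// ler_wpM2l ?powR_ge0//.
  rewrite {1}/powR gt_eqF//.
  apply: (@le_trans _ _ (expR (- (a / x)))).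
    rewrite ler_expR -mulrN ler_pM2l//; apply: le_ln1Dx.
    by rewrite ltrN2 invf_lt1// ltr1n.
  apply: expRN_le_half; rewrite divr_ge0 ?(ltW a0) ?(ltW x0)//=.
  by rewrite ler_pdivrMr// mul1r (le_trans a1).
have h2 : x `^ (a - 1) = x `^ a / x.
  by rewrite -(mulr_powRB1 (ltW x0) a0) mulrC mulKf ?gt_eqF.
rewrite -/x h2; set y := x `^ a in h1 *.
have -> : y / x = 2 / a * (y * (a / x / 2)) by field; rewrite !gt_eqF.
rewrite ler_wpM2l ?divr_ge0 ?(ltW a0)//.
by move: h1; rewrite mulrBr mulr1; move: (y * _) (_ `^ a) => u v; lra.
Qed.

Lemma sum_powR_le (a : R) (M : nat) : 0 < a <= 1 ->
  \sum_(1 <= k < M.+1) k%:R `^ (a - 1) <= 2 / a * M%:R `^ a :> R.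
Proof.
move=> a01; have /andP[a0 a1] := a01; rewrite big_add1 /=.
apply: (@le_trans _ _ (\sum_(0 <= k < M) 2 / a * (k.+1%:R `^ a - k%:R `^ a))).
  by apply: ler_sum => k _; exact: powR_diff_ge.
rewrite -mulr_sumr (telescope_sumr (fun k => k%:R `^ a))//.
by rewrite powR0 ?gt_eqF// subr0.
Qed.

Variables (Theta A C lambda b : R) (g : R -> R).
Hypotheses (Theta0 : 0 <= Theta) (A0 : 0 <= A) (C0 : 0 <= C) (lambda0 : 0 < lambda).
Hypotheses (b1 : 1 < b) (Thetab : Theta < ln b).
Hypothesis g_near : forall D, 0 <= D -> g D <= Theta + A * D.
Hypothesis g_far : forall D, 0 <= D -> g D <= C * expR (- lambda * D).

Let theta := Theta / ln b.
(** Fitted to the step from [D] to [D * b]: [A' * D] grows by exactly [A * D], [B' / D] drops by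
    exactly [C / (lambda * D)], and [theta * ln D] grows by [Theta]. The sum [gap_cst] pays for the
    one step that crosses [D = 1]. *)
Let A' := A / (b - 1).
Let B' := C / lambda * b / (b - 1).
Definition gap_cst : R := A' + B' + A + Theta.
Let lnb : 0 < ln b. Proof. by rewrite (le_lt_trans Theta0). Qed.
Let bm1 : 0 < b - 1. Proof. by rewrite subr_gt0. Qed.
Let b0 : 0 < b. Proof. exact: lt_trans b1. Qed.
Let A'0 : 0 <= A'. Proof. by rewrite divr_ge0// ltW. Qed.
Let B'0 : 0 <= B'.
Proof. by rewrite !(mulr_ge0, divr_ge0)// ?invr_ge0 ltW. Qed.
Let theta0 : 0 <= theta. Proof. by rewrite divr_ge0// ltW. Qed.

(* A potential whose decrement from [D] to [b * D] dominates [g D]. *)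
Let V (D : R) : R :=
  if D <= 1 then gap_cst - theta * ln D - A' * D else B' / D.

Let V_ge0 D : 0 < D -> 0 <= V D.
Proof.
move=> D0; rewrite /V; case: ifPn => [D1|_]; last by rewrite divr_ge0// ltW.
have : theta * ln D <= 0 by rewrite mulr_ge0_le0// ln_le0.
have : A' * D <= A' by rewrite ler_piMr.
have := A'0; have := B'0; have := Theta0; have := A0.
  by rewrite /gap_cst; lra.
Qed.

Let V_step D : 0 < D -> g D + V (D * b) <= V D.
Proof.
move=> D0; have Db0 : 0 < D * b by rewrite mulr_gt0.
have DDb : D < D * b by rewrite ltr_pMr.
rewrite /V; case: ifPn => Db1.
  have D1 : D <= 1 by rewrite (le_trans (ltW DDb)).
  rewrite D1 lnM ?posrE// mulrDr.
  have -> : theta * ln b = Theta by rewrite divfK// gt_eqF.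
  have := g_near (ltW D0).
  have -> : A * D = A' * (D * b) - A' * D by rewrite /A'; field; rewrite gt_eqF.
  by lra.
rewrite -ltNge in Db1; case: ifPn => D1.
  have h1 := g_near (ltW D0).
  have : theta * ln D <= 0 by rewrite mulr_ge0_le0// ln_le0.
  have : A' * D <= A' by rewrite ler_piMr.
  have : A * D <= A by rewrite ler_piMr.
  have : B' / (D * b) <= B' by rewrite ler_pdivrMr// ler_peMr// ltW.
  have := A'0; have := B'0; have := Theta0; have := A0.
  by rewrite /gap_cst; lra.
have h1 := g_far (ltW D0).
have h2 : expR (- lambda * D) <= (lambda * D)^-1.
  rewrite mulNr expRN lef_pV2 ?posrE ?expR_gt0 ?mulr_gt0//.
  by have := expR_ge1Dx (lambda * D); lra.
have h3 : C * expR (- lambda * D) <= C / (lambda * D) by rewrite ler_wpM2l.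
have -> : B' / D = C / (lambda * D) + B' / (D * b).
  by rewrite /B'; field; rewrite !gt_eqF.
by lra.
Qed.

Lemma geometric_gap_sum (n N : nat) (D : R) : 0 < D -> D * b ^+ n <= 1 ->
  \sum_(n <= j < N) g (D * b ^+ j) <= gap_cst - theta * ln (D * b ^+ n).
Proof.
move=> D0 Dn; have E0 : 0 < D * b ^+ n by rewrite mulr_gt0// exprn_gt0.
apply: (@le_trans _ _ (V (D * b ^+ n))); last first.
  rewrite /V Dn; have : 0 <= A' * (D * b ^+ n) by rewrite mulr_ge0// ltW.
  by lra.
have [Nn|nN] := leqP N n; first by rewrite big_geq// V_ge0.
suff main k i : 0 < D * b ^+ i -> \sum_(i <= j < k + i) g (D * b ^+ j) <= V (D * b ^+ i).
  by rewrite -(subnK (ltnW nN)); exact: main.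
elim: k i => [|k ih] i Ei0; first by rewrite big_geq// V_ge0.
rewrite addSnnS big_ltn; last by rewrite addnS ltnS leq_addl.
have Ei1 : 0 < D * b ^+ i.+1 by rewrite exprSr mulrA mulr_gt0.
by have := ih i.+1 Ei1; have := V_step Ei0; rewrite exprSr mulrA; lra.
Qed.

(** The term [k = 0] has no decay and can reach [expR (Theta * (N - n))]; division by [M] makes it
    harmless, which is the reason for the condition on [M]. The other terms are at most a constant
    times [(k * t * b ^+ n / M) ^ (- theta)], a Riemann sum of a singularity that is integrable
    because [theta < 1]. *)
Lemma gap_sum_bound (n N M : nat) (t : R) : 0 <= t -> t * b ^+ n <= 1 ->
  (0 < M)%N -> expR (Theta * (N - n)%:R) <= M%:R ->
  t * b ^+ n * ((\sum_(0 <= k < M)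
    expR (\sum_(n <= j < N) g (k%:R * (t / M%:R) * b ^+ j))) / M%:R)
  <= 1 + expR gap_cst * (2 / (1 - theta)).
Proof.
move=> t0 tau1 M0 MN; set tau := t * b ^+ n.
have a0 : 0 < 1 - theta by rewrite subr_gt0 ltr_pdivrMr// mul1r.
have a1 : 1 - theta <= 1 by rewrite gerBl.
have rhs0 : 0 <= expR gap_cst * (2 / (1 - theta)).
  by rewrite mulr_ge0 ?expR_ge0// divr_ge0// ltW.
have [t00|tn0] := eqVneq t 0.
  by rewrite /tau t00 mul0r mul0r addr_ge0.
have tp : 0 < t by rewrite lt0r tn0.
have tau0 : 0 < tau by rewrite mulr_gt0// exprn_gt0.
have MR : 0 < M%:R :> R by rewrite ltr0n.
have gap0 : \sum_(n <= j < N) g (0%:R * (t / M%:R) * b ^+ j) <= Theta * (N - n)%:R.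
  rewrite mulr_natr -sumr_const_nat; apply: ler_sum => j _; rewrite !mul0r.
  by have := g_near (lexx 0); rewrite mulr0 addr0.
rewrite big_ltn// mulrDl mulrDr lerD//.
  rewrite mulrA ler_pdivrMr// mul1r.
  apply: (@le_trans _ _ (expR (Theta * (N - n)%:R))) => //.
  by rewrite -[leRHS]mul1r ler_pM ?expR_ge0 ?ler_expR ?(ltW tau0).
pose a := 1 - theta.
have term k : (1 <= k < M)%N ->
    expR (\sum_(n <= j < N) g (k%:R * (t / M%:R) * b ^+ j)) <=
    expR gap_cst * (tau / M%:R) `^ (a - 1) * k%:R `^ (a - 1).
  move=> /andP[k1 kM]; have kR : 0 < k%:R :> R by rewrite ltr0n.
  have D0 : 0 < k%:R * (t / M%:R) by rewrite mulr_gt0// divr_gt0.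
  have DE : k%:R * (t / M%:R) * b ^+ n = (tau / M%:R) * k%:R by rewrite /tau; ring.
  have tM0 : 0 < tau / M%:R by rewrite divr_gt0.
  have Dn1 : k%:R * (t / M%:R) * b ^+ n <= 1.
    rewrite DE mulrAC ler_pdivrMr// mul1r.
    rewrite (@le_trans _ _ (1 * k%:R))// ?ler_wpM2r// mul1r ler_nat ltnW//.
  rewrite -mulrA -powRM ?(ltW tM0) ?(ltW kR)// -DE.
  rewrite /powR gt_eqF; last by rewrite mulr_gt0// exprn_gt0.
  rewrite -expRD ler_expR (_ : a - 1 = - theta) ?mulNr; last by rewrite /a; ring.
  exact: geometric_gap_sum.
apply: (@le_trans _ _ (tau * ((\sum_(1 <= k < M.+1)
    expR gap_cst * (tau / M%:R) `^ (a - 1) * k%:R `^ (a - 1)) / M%:R))).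
  rewrite ler_pM2l// ler_pM2r ?invr_gt0// big_nat_recr//=.
  apply: (@le_trans _ _ (\sum_(1 <= k < M)
    expR gap_cst * (tau / M%:R) `^ (a - 1) * k%:R `^ (a - 1))).
    by apply: ler_sum_nat.
  by rewrite lerDl !mulr_ge0 ?expR_ge0 ?powR_ge0.
rewrite -mulr_sumr.
have a01 : 0 < a <= 1 by rewrite a0.
have h := sum_powR_le M a01.
have tM0 : 0 < tau / M%:R by rewrite divr_gt0.
set S := \sum_(1 <= k < M.+1) _ in h *.
have -> : tau * (expR gap_cst * (tau / M%:R) `^ (a - 1) * S / M%:R) =
  expR gap_cst * (((tau / M%:R) * (tau / M%:R) `^ (a - 1)) * S) by ring.
rewrite (mulr_powRB1 (ltW tM0) a0) ler_pM2l ?expR_gt0//.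
apply: (@le_trans _ _ ((tau / M%:R) `^ a * (2 / a * M%:R `^ a))).
  by rewrite ler_wpM2l// powR_ge0.
rewrite mulrCA -powRM ?(ltW tM0) ?(ltW MR)// divfK ?gt_eqF//.
rewrite ler_piMr ?divr_ge0 ?(ltW a0)//.
have : tau `^ a <= 1 `^ a.
  by apply: ge0_ler_powR; rewrite ?nnegrE ?(ltW a0) ?(ltW tau0).
by rewrite powR1.
Qed.
End gap_sums.

(** * Powers of sums as sums over ordered chains *)

Section nested_sums.
Context (R : realType).

(* The sum of [a i_1 * ... * a i_r] over the chains [k <= i_1 <= ... <= i_r < M]. *)
Fixpoint nested (M : nat) (a : nat -> R) (r k : nat) : R :=
  if r is r'.+1 then \sum_(k <= i < M) a i * nested M a r' i else 1.

Lemma nested_ge0 M (a : nat -> R) r k : (forall i, 0 <= a i) -> 0 <= nested M a r k.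
Proof.
move=> a0; elim: r k => [|r ih] k //=.
by apply: sumr_ge0 => i _; rewrite mulr_ge0.
Qed.

Lemma exprD_le (x a : R) (n : nat) : 0 <= x -> 0 <= a ->
  (x + a) ^+ n.+1 <= x ^+ n.+1 + n.+1%:R * a * (x + a) ^+ n.
Proof.
move=> x0 a0; elim: n => [|n ih]; first by rewrite !expr1 expr0 !mulr1 mul1r.
have xa : 0 <= x + a by rewrite addr_ge0.
rewrite exprS (le_trans (ler_wpM2l xa ih))//.
have h : x ^+ n.+1 <= (x + a) ^+ n.+1.
  by rewrite ler_pXn2r ?nnegrE ?lerDl.
have := ler_wpM2l a0 h.
rewrite [X in _ -> _ <= X + _]exprS [X in _ -> _ <= _ + _ * X]exprS -[n.+2%:R]natr1.
set y := (x + a) ^+ n; set z := x ^+ n.+1; rewrite exprS -/y => h1.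
have -> : (x + a) * (z + n.+1%:R * a * y) =
  x * z + n.+1%:R * a * ((x + a) * y) + a * z by ring.
have -> : (n.+1%:R + 1) * a * ((x + a) * y) =
  n.+1%:R * a * ((x + a) * y) + a * ((x + a) * y) by ring.
by lra.
Qed.

(** A multiset of [m] indices arises from at most [m!] ordered tuples. The induction on [m] contains
    one that lowers the end [k] step by step; [exprD_le] accounts for the new smallest index. *)
Lemma pow_sum_le_nested M (a : nat -> R) (m k : nat) : (forall i, 0 <= a i) ->
  (\sum_(k <= i < M) a i) ^+ m <= m`!%:R * nested M a m k.
Proof.
move=> a0; elim: m k => [|m ihm] k; first by rewrite expr0 fact0 mul1r.
have [Mk|kM] := leqP M k; first by rewrite /= !big_geq// exprS mul0r mulr0.
rewrite -(subKn (ltnW kM)); elim: (M - k)%N (leq_subr k M) => [|i ih] iM.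
  by rewrite subn0 /= !big_geq// exprS mul0r mulr0.
set k' := (M - i.+1)%N.
have k'E : k'.+1 = (M - i)%N by rewrite /k' subnSK.
have k'M : (k' < M)%N by rewrite /k' ltn_subrL/= (leq_trans _ iM).
rewrite /= big_ltn//= addrC (le_trans (exprD_le m _ _))//.
  by apply: sumr_ge0.
rewrite [X in _ <= _ * X]big_ltn// mulrDr addrC lerD//.
  rewrite factS natrM -!mulrA ler_wpM2l// mulrCA ler_wpM2l//.
  by have := ihm k'; rewrite (big_ltn k'M) addrC; exact.
by rewrite k'E; apply: ih; exact: ltnW.
Qed.

End nested_sums.

Section nested_moments.
Context d (T : measurableType d) (R : realType) (P : probability T R).
Local Notation mf := (measurable_fun [set: T]).
Variables (f : nat -> T -> R) (M m : nat) (s : nat -> R) (G : R -> R) (sigma : R).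
Hypothesis mf_ : forall i, mf (f i).
Hypothesis f0 : forall i w, 0 <= f i w.
Hypothesis sigma0 : 0 <= sigma.
Hypothesis sigmaG : forall i, (i < M)%N ->
  \sum_(i <= k < M) expR (G (s k - s i)) <= sigma.
Hypothesis fG : forall i (l : seq nat), (size l).+1 = m ->
  path geq i l -> (i < M)%N ->
  ('E_P[fun w => (\prod_(k <- i :: l) f k w)%R] <=
   (expR (gapsum G (s i) [seq s k | k <- l]))%:E)%E.

Lemma measurable_nested r k : mf (fun w => nested M (f^~ w) r k).
Proof.
elim: r k => [|r ih] k /=; first exact: measurable_cst.
by apply: measurable_sum => i; exact: measurable_funM.
Qed.

Let mprod (l : seq nat) : mf (fun w => \prod_(k <- l) f k w).
Proof. by apply: measurable_prod. Qed.

Let prod0 (l : seq nat) w : 0 <= \prod_(k <- l) f k w.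
Proof. exact: prodr_ge0. Qed.

(** [i :: l] is the chain built so far, largest index first. A further index on top adds a single
    gap to the exponent, and summing over it costs a factor [sigma] whatever the rest of the
    chain. *)
Lemma nested_expectation_le r i l : (size l + r).+1 = m ->
  path geq i l -> (i < M)%N ->
  (expectation P (fun w => nested M (f^~ w) r i * \prod_(k <- i :: l) f k w)%R <=
   (sigma ^+ r * expR (gapsum G (s i) [seq s k | k <- l]))%:E)%E.
Proof.
elim: r i l => [|r ih] i l; rewrite ?addn0 => szl il iM.
  rewrite expr0 mul1r; under eq_fun do rewrite mul1r.
  exact: fG.
have -> : (fun w => nested M (f^~ w) r.+1 i * \prod_(k <- i :: l) f k w) =
  (fun w => \sum_(k <- index_iota i M)
     (nested M (f^~ w) r k * \prod_(k' <- k :: i :: l) f k' w)).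
  apply/funext => w /=; rewrite mulr_suml; apply: eq_bigr => k _.
  by rewrite [in RHS]big_cons; ring.
rewrite expectation_bigsum; last 2 first.
- by move=> k; apply: measurable_funM; [exact: measurable_nested|exact: mprod].
- by move=> k w; rewrite mulr_ge0// nested_ge0.
apply: (@le_trans _ _ (\sum_(k <- index_iota i M)
   (sigma ^+ r * expR (gapsum G (s k) [seq s k' | k' <- i :: l]))%:E)%E).
  rewrite big_seq [leRHS]big_seq; apply: lee_sum => k.
  rewrite mem_index_iota => /andP[ik kM].
  by apply: ih => //=; [rewrite addSnnS|rewrite ik].
rewrite sumEFin lee_fin /=.
under eq_bigr do rewrite expRD.
have -> : \sum_(k <- index_iota i M) sigma ^+ r * (expR (G (s k - s i)) *
    expR (gapsum G (s i) [seq s k' | k' <- l])) =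
  sigma ^+ r * (\sum_(i <= k < M) expR (G (s k - s i))) *
    expR (gapsum G (s i) [seq s k' | k' <- l]).
  by rewrite mulr_sumr mulr_suml; apply: eq_bigr => k _; rewrite mulrA.
rewrite ler_wpM2r ?expR_ge0// exprSr ler_wpM2l ?exprn_ge0//.
exact: sigmaG.
Qed.

(** The smallest index of a chain is free and costs [M]; each of the [m.-1] others costs [sigma]. *)
Lemma sum_moment_le : (0 < m)%N ->
  (expectation P (fun w => (\sum_(0 <= i < M) f i w) ^+ m)%R <=
   (m`!%:R * (M%:R * sigma ^+ m.-1))%:E)%E.
Proof.
move=> m0.
apply: (@le_trans _ _
    (expectation P (fun w => m`!%:R * nested M (f^~ w) m 0))).
  apply: expectation_mono.
  - by apply: measurable_funX; exact: measurable_sum.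
  - by apply: measurable_funM => //; exact: measurable_nested.
  - by move=> w; rewrite exprn_ge0// sumr_ge0.
  - by move=> w; exact: pow_sum_le_nested.
rewrite expectation_scale//; last 2 first.
- exact: measurable_nested.
- by move=> w; exact: nested_ge0.
rewrite EFinM lee_wpmul2l ?lee_fin//.
have -> : (fun w => nested M (f^~ w) m 0) =
  (fun w => \sum_(i <- index_iota 0 M)
     (nested M (f^~ w) m.-1 i * \prod_(k <- [:: i]) f k w)).
  apply/funext => w; rewrite -[in LHS](prednK m0) /=; apply: eq_bigr => i _.
  by rewrite big_seq1 mulrC.
rewrite expectation_bigsum; last 2 first.
- by move=> k; apply: measurable_funM; [exact: measurable_nested|exact: mprod].
- by move=> k w; rewrite mulr_ge0// nested_ge0.
apply: (@le_trans _ _ (\sum_(i <- index_iota 0 M) (sigma ^+ m.-1)%:E)%E).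
  rewrite big_seq [leRHS]big_seq; apply: lee_sum => k.
  rewrite mem_index_iota => /andP[_ kM].
  have := @nested_expectation_le m.-1 k [::] _ isT kM.
  by rewrite /= expR0 mulr1; apply; rewrite add0n prednK.
by rewrite sumEFin lee_fin sumr_const_nat subn0 mulr_natl.
Qed.

End nested_moments.

Section prod_exp.
Context (R : realType).

Lemma prod_expR (I : Type) (r : seq I) (f : I -> R) :
  (\prod_(i <- r) (expR (f i))%:E)%E = (expR (\sum_(i <- r) f i))%:E.
Proof.
elim: r => [|i r ih]; first by rewrite !big_nil expR0.
by rewrite !big_cons ih expRD EFinM.
Qed.

Lemma lee_prod_nneg (I : eqType) (r : seq I) (f g : I -> \bar R) :
  {in r, forall i, (0 <= f i <= g i)%E} ->
  (0 <= \prod_(i <- r) f i <= \prod_(i <- r) g i)%E.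
Proof.
elim: r => [_|i r ih h]; first by rewrite !big_nil lexx andbT lee_fin.
rewrite !big_cons.
have /andP[f0 fg] := h i (mem_head _ _).
have /andP[p0 pp] := ih (fun k kr => h k ltac:(by rewrite inE kr orbT)).
by rewrite mule_ge0//= lee_pmul.
Qed.

Lemma prod_le_expR (I : eqType) (r : seq I) (f : I -> \bar R) (g : I -> R) :
  {in r, forall i, (0 <= f i <= (expR (g i))%:E)%E} ->
  (\prod_(i <- r) f i <= (expR (\sum_(i <- r) g i))%:E)%E.
Proof. by move=> /lee_prod_nneg/andP[_]; rewrite prod_expR. Qed.

Lemma prod_ge_expR (I : eqType) (r : seq I) (f : I -> \bar R) (g : I -> R) :
  {in r, forall i, ((expR (g i))%:E <= f i)%E} ->
  ((expR (\sum_(i <- r) g i))%:E <= \prod_(i <- r) f i)%E.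
Proof.
move=> h; rewrite -prod_expR.
have /andP[_ //] : (0 <= \prod_(i <- r) (expR (g i))%:E <= \prod_(i <- r) f i)%E.
by apply: lee_prod_nneg => i ir; rewrite h// lee_fin expR_ge0.
Qed.

Lemma gapsum_sum (I : Type) (r : seq I) (f : I -> R -> R) (t : R) (l : seq R) :
  \sum_(i <- r) gapsum (f i) t l = gapsum (fun u => \sum_(i <- r) f i u) t l.
Proof.
elim: l t => [|u l ih] t /=; first by rewrite big1.
by rewrite big_split/= ih.
Qed.

Lemma gapsum_scale (f : R -> R) (a t : R) (l : seq R) :
  gapsum f (t * a) [seq u * a | u <- l] = gapsum (fun u => f (u * a)) t l.
Proof. by elim: l t => [|u l ih] t //=; rewrite ih mulrBl. Qed.

End prod_exp.

(** * Integrals of measurable processes *)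

Section process_integral.
Context d (T : measurableType d) (R : realType) (P : probability T R).
Local Notation mf := (measurable_fun [set: T]).
Local Notation leb := (@lebesgue_measure R).
Variable U : R -> T -> R.
Hypothesis mU : measurable_fun [set: R * T] (fun p => U p.1 p.2).
Hypothesis U0 : forall s w, 0 <= U s w.

Lemma measurable_process_at s : mf (U s).
Proof.
have mp : measurable_fun [set: T] (fun w => (s, w)) by exact: measurable_fun_pair.
exact: measurableT_comp mU mp.
Qed.

Lemma measurable_process_path w : measurable_fun [set: R] (U ^~ w).
Proof.
have mp : measurable_fun [set: R] (fun s => (s, w)) by exact: measurable_fun_pair.
exact: measurableT_comp mU mp.
Qed.

Variable I : set R.
Hypothesis mI : measurable I.

Let F (p : R * T) : \bar R := (U p.1 p.2 * \1_I p.1)%:E.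

Let mF : measurable_fun [set: R * T] F.
Proof.
apply/measurable_EFinP; apply: measurable_funM => //.
apply: (measurableT_comp (f := \1_I : R -> R)) => //; exact: measurable_indic.
Qed.

Let F0 p : (0 <= F p)%E. Proof. by rewrite lee_fin mulr_ge0. Qed.

Let FE w : (\int[leb]_(s in I) (U s w)%:E = \int[leb]_s F (s, w))%E.
Proof.
rewrite integral_mkcond; apply: eq_integral => s _; rewrite /F /patch /=.
by rewrite indicE; case: ifP => _; rewrite ?mulr1 ?mulr0.
Qed.

Lemma measurable_process_integral :
  measurable_fun setT (fun w => \int[leb]_(s in I) (U s w)%:E)%E.
Proof.
rewrite (_ : (fun w => _) = fubini_G leb F); last first.
  by apply/funext => w; exact: FE.
exact: measurable_fun_fubini_tonelli_G.
Qed.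

Lemma process_tonelli : (\int[P]_w \int[leb]_(s in I) (U s w)%:E =
  \int[leb]_(s in I) 'E_P[U s])%E.
Proof.
rewrite (eq_integral (fun w => \int[leb]_s F (s, w))%E); last first.
  by move=> w _; exact: FE.
transitivity (\int[leb]_s \int[P]_w F (s, w))%E.
  by apply/esym; exact: fubini_tonelli.
rewrite [RHS]integral_mkcond.
apply: eq_integral => s _; rewrite /patch unlock /F /=.
rewrite indicE; case: ifP => _.
  by apply: eq_integral => w _; rewrite mulr1.
by apply: integral0_eq => w _; rewrite mulr0.
Qed.

End process_integral.

Section riemann_sum.
Context (R : realType).
Local Notation leb := (@lebesgue_measure R).

Lemma integral_itvco_cst (u v : R) (k : R) : u <= v ->
  (\int[leb]_(s in `[u, v[) (cst k%:E) s = (k * (v - u))%:E)%E.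
Proof.
move=> uv; rewrite integral_cst//= lebesgue_measure_itv/= lte_fin.
case: ltP => [_|vu]; first by rewrite -EFinB -EFinM.
have -> : v = u by apply/le_anti; rewrite vu.
by rewrite subrr mulr0 mule0.
Qed.

Lemma ge0_integral_itvco_split (h : R -> \bar R) (u v w : R) :
  measurable_fun setT h -> (forall s, 0 <= h s)%E -> u <= v -> v <= w ->
  (\int[leb]_(s in `[u, w[) h s =
   \int[leb]_(s in `[u, v[) h s + \int[leb]_(s in `[v, w[) h s)%E.
Proof.
move=> mh h0 uv vw.
have -> : [set` `[u, w[] = [set` `[u, v[] `|` [set` `[v, w[].
  apply/seteqP; split => s /=; rewrite !in_itv/=.
    move=> /andP[us sw]; have [sv|vs] := ltP s v; [left|right].
      by rewrite us.
    by rewrite sw.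
  move=> [/andP[us sv]|/andP[vs sw]].
    by rewrite us (lt_le_trans sv vw).
  by rewrite (le_trans uv vs).
rewrite ge0_integral_setU//.
- exact: measurable_funS mh.
- apply/disj_set2P/seteqP; split => s //= []; rewrite !in_itv/=.
  by move=> /andP[_ sv] /andP[vs _]; move: sv; rewrite ltNge vs.
Qed.

Lemma riemann_sum_error (h : R -> R) (delta : R) (k : nat) :
  measurable_fun setT h -> (forall s, 0 <= h s) -> 0 <= delta ->
  (\int[leb]_(s in `[0%R, (k%:R * delta)%R[) (h s)%:E < +oo)%E ->
  ((`|fine (\int[leb]_(s in `[0%R, (k%:R * delta)%R[) (h s)%:E) -
     delta * \sum_(0 <= i < k) h (i%:R * delta)|%R)%:E <=
  \sum_(0 <= i < k) \int[leb]_(s in `[(i%:R * delta)%R, (i.+1%:R * delta)%R[)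
     (`|h s - h (i%:R * delta)|%R)%:E)%E.
Proof.
move=> mh h0 d0.
have mhE : measurable_fun setT (fun s => (h s)%:E) by exact/measurable_EFinP.
have hE0 s : (0 <= (h s)%:E)%E by rewrite lee_fin.
elim: k => [|k ih] fin.
  rewrite !big_geq// mulr0 subr0 mul0r set_itvco0 integral_set0/=.
  by rewrite normr0.
have k0 : 0 <= k%:R * delta by rewrite mulr_ge0.
have kk : k%:R * delta <= k.+1%:R * delta by rewrite ler_wpM2r// ler_nat.
move: fin; rewrite (ge0_integral_itvco_split mhE hE0 k0 kk) !big_nat_recr//=.
set A := (\int[leb]_(s in `[0%R, _[) _)%E.
set B := (\int[leb]_(s in `[(k%:R * delta)%R, _[) (h s)%:E)%E.
set E := (\int[leb]_(s in `[(k%:R * delta)%R, _[) (`|_|)%:E)%E.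
move=> fin.
have A0 : (0 <= A)%E by apply: integral_ge0.
have B0 : (0 <= B)%E by apply: integral_ge0.
have E0 : (0 <= E)%E by apply: integral_ge0 => s _; rewrite lee_fin.
have Afin : (A < +oo)%E by rewrite (le_lt_trans _ fin)// leeDl.
have Bfin : (B < +oo)%E by rewrite (le_lt_trans _ fin)// leeDr.
have BE : ((`|fine B - delta * h (k%:R * delta)|%R)%:E <= E)%E.
  have [->|Efin] := eqVneq E +oo%E; first exact: leey.
  have {}Efin : E \is a fin_num by rewrite ge0_fin_numE// lt_neqAle Efin leey.
  have mn : measurable_fun setT (fun s => `|h s - h (k%:R * delta)|).
    by apply: measurableT_comp; [exact: normr_measurable|exact: measurable_funB].
  have dE : (\int[leb]_(s in `[(k%:R * delta)%R, (k.+1%:R * delta)%R[)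
      (cst (h (k%:R * delta))%:E) s = (delta * h (k%:R * delta))%:E)%E.
    rewrite integral_itvco_cst//; congr EFin; rewrite -natr1; ring.
  have le1 : (B <= (delta * h (k%:R * delta))%:E + E)%E.
    rewrite -dE -ge0_integralD//=; last first.
      by apply/measurable_EFinP; exact: measurable_funS mn.
    apply: ge0_le_integral => //=.
    + exact: measurable_funS mhE.
    + apply/measurable_EFinP; apply: measurable_funD => //.
      exact: measurable_funS mn.
    + move=> s _; rewrite -EFinD lee_fin.
      by have := ler_norm (h s - h (k%:R * delta)); lra.
  have le2 : ((delta * h (k%:R * delta))%:E <= B + E)%E.
    rewrite -dE -ge0_integralD//=; last 2 first.
    + exact: measurable_funS mhE.
    + by apply/measurable_EFinP; exact: measurable_funS mn.
    apply: ge0_le_integral => //=.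
    + apply/measurable_EFinP; apply: measurable_funD => //.
        exact: measurable_funS mh.
      exact: measurable_funS mn.
    + move=> s _; rewrite -EFinD lee_fin.
      by have := ler_norm (h (k%:R * delta) - h s); rewrite distrC; lra.
  have Bf : B = (fine B)%:E by rewrite fineK// ge0_fin_numE.
  move: le1 le2; rewrite {1 2}Bf -(fineK Efin) -!EFinD !lee_fin => le1 le2.
  by rewrite ler_norml; lra.
have fAB : fine (A + B) = fine A + fine B by rewrite fineD// ge0_fin_numE.
rewrite fAB mulrDr.
apply: le_trans (leeD (ih Afin) BE); rewrite -EFinD lee_fin.
set x := fine A; set y := fine B; set u := delta * _; set v := delta * _.
have -> : x + y - (u + v) = (x - u) + (y - v) by ring.
exact: ler_normD.
Qed.

End riemann_sum.

Lemma measurable_process_expectation (R : realType) d (T : measurableType d)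
    (P : probability T R) (U : R -> T -> R) :
  measurable_fun [set: R * T] (fun p => U p.1 p.2) -> (forall s w, 0 <= U s w) ->
  measurable_fun setT (fun s => expectation P (U s)).
Proof.
move=> mU U0; have := measurable_fun_fubini_tonelli_F (m2 := P) (fun p => (U p.1 p.2)%:E).
rewrite unlock; apply; first by apply/measurable_EFinP.
by move=> p; rewrite lee_fin.
Qed.

Lemma integral_itv_cst1 (R : realType) (t : R) : 0 <= t ->
  (\int[@lebesgue_measure R]_(s in `[0%R, t]) 1 = t%:E)%E.
Proof.
move=> t0; rewrite integral_cst//= mul1e lebesgue_measure_itv/= lte_fin.
by case: ltP => [_|t0']; rewrite ?sube0//; congr EFin; apply/le_anti; rewrite t0.
Qed.

Lemma integral_sub_cst (R : realType) (f : R -> \bar R) (k t : R) : 0 <= t ->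
  measurable_fun setT f -> (forall s, 0 <= f s)%E ->
  (\int[lebesgue_measure]_(s in `[0%R, t]) f s < +oo)%E ->
  (\int[lebesgue_measure]_(s in `[0%R, t]) (f s - k%:E) =
   \int[lebesgue_measure]_(s in `[0%R, t]) f s - (k * t)%:E)%E.
Proof.
move=> t0 mf_ f0 fin.
have fI : lebesgue_measure.-integrable [set` `[0, t]] f.
  apply/integrableP; split; first exact: measurable_funTS.
  by under eq_integral do rewrite gee0_abs//.
have lt : lebesgue_measure [set` `[0%R, t]] = t%:E.
  by rewrite -[RHS](integral_itv_cst1 t0) integral_cst// mul1e.
have kI : lebesgue_measure.-integrable [set` `[0, t]] (cst k%:E).
  apply/integrableP; split; first exact: measurable_cst.
  under eq_integral do rewrite abse_EFin.
  by rewrite integral_cst// [X in (_ * X)%E]lt -EFinM ltry.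
apply: (etrans (integralB _ fI kI)) => //.
rewrite [X in (_ - X)%E]integral_cst//.
by rewrite [X in (_ * X)%E]lt -EFinM.
Qed.

(** * Limits of moments *)

Section power_inequalities.
Context (R : realType).

Lemma powR_add_le (q x y : R) : 0 < q -> 0 <= x -> 0 <= y ->
  (x + y) `^ q <= 2 `^ q * (x `^ q + y `^ q).
Proof.
move=> q0 x0 y0.
have key (u v : R) : 0 <= u -> 0 <= v -> v <= u -> (u + v) `^ q <= 2 `^ q * u `^ q.
  move=> u0 v0 vu; rewrite -powRM//.
  by apply: ge0_ler_powR; rewrite ?nnegrE ?addr_ge0 ?mulr_ge0 ?(ltW q0)//; lra.
have [xy|/ltW yx] := leP x y.
  rewrite addrC (le_trans (key _ _ y0 x0 xy))// ler_wpM2l ?powR_ge0//.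
  by rewrite lerDr powR_ge0.
rewrite (le_trans (key _ _ x0 y0 yx))// ler_wpM2l ?powR_ge0//.
by rewrite lerDl powR_ge0.
Qed.

(** Small values have a small power, large ones are dominated by [e * x ^+ m], and in between a
    multiple of [x] suffices. It lets smallness in L^1 and boundedness in L^m give smallness in L^q,
    for [q] below 1 as well. *)
Lemma powR_interpolation (q e : R) (m : nat) : 0 < q < m%:R -> 0 < e ->
  exists2 C : R, 0 <= C & forall x : R, 0 <= x ->
    x `^ q <= e * (1 + x ^+ m) + C * x.
Proof.
move=> /andP[q0 qm] e0.
(* The thresholds solve [delta ^ q = e] and [K ^ (q - m) = e]. *)
pose delta := e `^ q^-1; pose K := e `^ (q - m%:R)^-1.
have delta0 : 0 < delta by rewrite powR_gt0.
have K0 : 0 < K by rewrite powR_gt0.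
have deltaq : delta `^ q = e by rewrite -powRrM mulVf ?gt_eqF// powRr1 ?ltW.
have mq0 : 0 < m%:R - q by rewrite subr_gt0.
have KE : K `^ (q - m%:R) = e.
  by rewrite -powRrM mulVf ?powRr1 ?ltW// -opprB oppr_eq0 gt_eqF.
exists (K `^ q / delta); first by rewrite divr_ge0 ?powR_ge0 ?(ltW delta0).
move=> x x0; have xm0 : 0 <= x ^+ m by rewrite exprn_ge0.
have Cx0 : 0 <= K `^ q / delta * x by rewrite !mulr_ge0 ?powR_ge0 ?invr_ge0 ?(ltW delta0).
have exm0 : 0 <= e * x ^+ m by rewrite mulr_ge0// ltW.
have [xd|dx] := leP x delta.
  have : x `^ q <= delta `^ q.
    by apply: ge0_ler_powR; rewrite ?nnegrE ?(ltW q0) ?(ltW delta0).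
  rewrite deltaq => /le_trans; apply.
  by rewrite mulrDr mulr1 -addrA lerDl addr_ge0.
have xp : 0 < x := lt_trans delta0 dx.
have [xK|Kx] := leP x K.
  have h1 : x `^ q <= K `^ q.
    by apply: ge0_ler_powR; rewrite ?nnegrE ?(ltW q0) ?(ltW K0).
  have h2 : K `^ q <= K `^ q / delta * x.
    rewrite mulrAC ler_pdivlMr// ler_wpM2l ?powR_ge0// ltW//.
  apply: (le_trans (le_trans h1 h2)).
  by rewrite lerDr mulr_ge0 ?addr_ge0 ?(ltW e0).
have xE : x `^ q = x `^ (q - m%:R) * x ^+ m.
  rewrite -powR_mulrn ?(ltW xp)// -powRD ?subrK//.
  by rewrite gt_eqF ?implybT.
have : x `^ (q - m%:R) <= e.
  rewrite -KE -[q - _]opprB !powRN lef_pV2 ?posrE ?powR_gt0//.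
  by apply: ge0_ler_powR; rewrite ?nnegrE ?(ltW mq0) ?(ltW K0) ?(ltW xp) ?(ltW Kx).
move=> /(ler_wpM2r xm0); rewrite -xE => /le_trans; apply.
by rewrite mulrDr mulr1 addrAC lerDr addr_ge0 ?(ltW e0).
Qed.

Lemma expr_add_le (m : nat) (x y : R) : 0 <= x -> 0 <= y ->
  (x + y) ^+ m <= 2 ^+ m * (x ^+ m + y ^+ m).
Proof.
move=> x0 y0.
have key (u v : R) : 0 <= u -> 0 <= v -> v <= u -> (u + v) ^+ m <= 2 ^+ m * u ^+ m.
  move=> u0 v0 vu; rewrite -exprMn lerXn2r ?nnegrE ?addr_ge0 ?mulr_ge0//.
  by lra.
have [xy|/ltW yx] := leP x y.
  rewrite addrC (le_trans (key _ _ y0 x0 xy))// ler_wpM2l ?exprn_ge0//.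
  by rewrite lerDr exprn_ge0.
rewrite (le_trans (key _ _ x0 y0 yx))// ler_wpM2l ?exprn_ge0//.
by rewrite lerDl exprn_ge0.
Qed.

End power_inequalities.

Section moment_limits.
Context d (T : measurableType d) (R : realType) (P : probability T R).
Local Notation mf := (measurable_fun [set: T]).
Implicit Types A S D : T -> R.

Lemma measurable_dist A S : mf A -> mf S -> mf (fun w => `|A w - S w|).
Proof.
by move=> mA mS; apply: measurableT_comp; [exact: normr_measurable|exact: measurable_funB].
Qed.

Lemma measurable_powR_fun D (q : R) : mf D -> mf (fun w => D w `^ q).
Proof.
by move=> mD; apply: (measurableT_comp (f := fun x => x `^ q)) => //;
  exact: measurable_powR.
Qed.

Lemma expectation_const_add (k : R) D : 0 <= k -> mf D -> (forall w, 0 <= D w) ->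
  (expectation P (fun w => k + D w)%R = k%:E + expectation P D)%E.
Proof.
move=> k0 mD D0; have := @expectation_add _ _ _ P (cst k) D.
by rewrite expectation_cst; apply.
Qed.

(** Young's inequality [|x| <= eta / 2 + x ^ 2 / (2 * eta)] with a free parameter, in the place of
    Cauchy-Schwarz. *)
Lemma expectation_norm_le (D : T -> R) (eta : R) : 0 < eta -> mf D ->
  (expectation P (fun w => `|D w|)%R <=
   (eta / 2)%:E + (2 * eta)^-1%:E * expectation P (fun w => D w ^+ 2)%R)%E.
Proof.
move=> eta0 mD; have e2 : 0 <= (2 * eta)^-1 by rewrite invr_ge0 mulr_ge0// ltW.
have mD2 : mf (fun w => D w ^+ 2) by exact: measurable_funX.
have D2 w : 0 <= D w ^+ 2 by exact: sqr_ge0.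
rewrite -(expectation_scale _ e2 mD2 D2) -expectation_const_add; last 3 first.
- by rewrite divr_ge0// ltW.
- exact: measurable_funM.
- by move=> w; rewrite mulr_ge0.
apply: expectation_mono.
- by apply: measurableT_comp => //; exact: normr_measurable.
- by apply: measurable_funD => //; exact: measurable_funM.
- by move=> w; exact: normr_ge0.
- move=> w; rewrite -[D w ^+ 2]real_normK ?num_real//.
  set x := `|D w|; have := sqr_ge0 (x - eta); rewrite sqrrB => h.
  have -> : eta / 2 + (2 * eta)^-1 * x ^+ 2 = (x ^+ 2 + eta ^+ 2) / (2 * eta).
    by field; rewrite gt_eqF.
  by rewrite ler_pdivlMr ?mulr_gt0//; lra.
Qed.

(** L^1 closeness does not control the power [m] directly, but it does after capping at [n]: the
    capped [A] is at most [S] plus the capped distance, whose power [m] is at most [n ^ (m - 1)]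
    times the distance. The cap is then removed by monotone convergence. *)
Lemma moment_of_limit (m : nat) (C : R) A : (0 < m)%N -> mf A ->
  (forall w, 0 <= A w) ->
  (forall e, 0 < e -> exists S, [/\ mf S, (forall w, 0 <= S w),
     (expectation P (fun w => `|A w - S w|)%R <= e%:E)%E &
     (expectation P (fun w => S w ^+ m)%R <= C%:E)%E]) ->
  (expectation P (fun w => A w ^+ m)%R <= (2 ^+ m * C)%:E)%E.
Proof.
move=> m0 mA A0 appr.
have C0 : 0 <= C.
  have [S [mS S0 _ SC]] := appr 1 ltr01.
  rewrite -lee_fin (le_trans _ SC)// expectation_ge0// => w; exact: exprn_ge0.
pose f n w := (Num.min (A w) n%:R) ^+ m.
have f0 n w : 0 <= Num.min (A w) n%:R by rewrite le_min A0 ler0n.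
apply: (expectation_le_trunc (f := f)).
- move=> n; apply: measurable_funX; exact: measurable_minr.
- by move=> n w; rewrite exprn_ge0.
- move=> w n n' nn'; rewrite /f lerXn2r ?nnegrE//.
  by rewrite le_min !ge_min lexx ler_nat nn' orbT.
- move=> w; near=> n; rewrite /f min_l//; near: n; exact: nbhs_infty_ger.
move=> n; apply/lee_addgt0Pr => e e0.
(* The summand 1 keeps [k] positive when [n = 0]. *)
pose k : R := 2 ^+ m * (n%:R ^+ m.-1 + 1).
have k0 : 0 < k by rewrite mulr_gt0 ?exprn_gt0 ?ltr_wpDl ?exprn_ge0.
have ek : 0 < e / k by rewrite divr_gt0.
have [S [mS S0 AS SC]] := appr _ ek.
have mAS := measurable_dist mA mS.
have mSm : mf (fun w => S w ^+ m) by exact: measurable_funX.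
apply: (@le_trans _ _ (expectation P (fun w => 2 ^+ m * S w ^+ m + k * `|A w - S w|))).
  apply: expectation_mono.
  - by apply: measurable_funX; exact: measurable_minr.
  - by apply: measurable_funD; exact: measurable_funM.
  - by move=> w; rewrite exprn_ge0.
  - move=> w; set x := `|A w - S w|; have x0 : 0 <= x by exact: normr_ge0.
    have mx0 : 0 <= Num.min x n%:R by rewrite le_min x0 ler0n.
    have h1 : Num.min (A w) n%:R <= S w + Num.min x n%:R.
      have Ax : A w <= S w + x by have := ler_norm (A w - S w); rewrite -/x; lra.
      have := S0 w; have [] := leP x n%:R; have [] := leP (A w) n%:R => *; lra.
    have h2 : f n w <= (S w + Num.min x n%:R) ^+ m.
      by rewrite lerXn2r ?nnegrE ?addr_ge0.
    apply: (le_trans h2); apply: (le_trans (expr_add_le m (S0 w) mx0)).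
    rewrite mulrDr lerD2l /k -mulrA ler_wpM2l ?exprn_ge0//.
    rewrite -{1}(prednK m0) exprSr ler_pM ?exprn_ge0 ?ge_min ?lexx//.
    apply: (@le_trans _ _ (n%:R ^+ m.-1)); last by rewrite lerDl.
    by rewrite lerXn2r ?nnegrE// ge_min lexx orbT.
rewrite expectation_add; last 4 first.
- exact: measurable_funM.
- exact: measurable_funM.
- by move=> w; rewrite mulr_ge0 ?exprn_ge0.
- by move=> w; rewrite mulr_ge0 ?normr_ge0 ?(ltW k0).
have p2 : (0 : R) <= 2 ^+ m by rewrite exprn_ge0.
rewrite (expectation_scale P p2 mSm (fun w => exprn_ge0 m (S0 w))).
rewrite (expectation_scale P (ltW k0) mAS (fun w => normr_ge0 _)).
apply: leeD.
  by rewrite EFinM lee_wpmul2l// lee_fin exprn_ge0.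
apply: (le_trans (lee_wpmul2l _ AS)); first by rewrite lee_fin ltW.
by rewrite -EFinM lee_fin mulrC divfK// gt_eqF.
Unshelve. all: by end_near. Qed.

Lemma Lq_small (m : nat) (q B : R) : 0 < q < m%:R ->  0 <= B ->
  forall e, 0 < e -> exists2 eta, 0 < eta &
  forall D, mf D -> (forall w, 0 <= D w) ->
    (expectation P (fun w => D w ^+ m)%R <= B%:E)%E ->
    (expectation P D <= eta%:E)%E ->
    (expectation P (fun w => D w `^ q)%R <= e%:E)%E.
Proof.
move=> qm B0 e e0; have B1 : 0 < 1 + B by rewrite ltr_pwDl.
have e' : 0 < e / (2 * (1 + B)) by rewrite divr_gt0// mulr_gt0.
have [C C0 qC] := powR_interpolation qm e'.
have C1 : 0 < C + 1 by rewrite ltr_wpDl.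
exists (e / (2 * (C + 1))); first by rewrite divr_gt0// mulr_gt0.
move=> D mD D0 DB De.
have mDm : mf (fun w => D w ^+ m) by exact: measurable_funX.
have Dm0 w : 0 <= D w ^+ m by rewrite exprn_ge0.
have m1D : mf (fun w => 1 + D w ^+ m) by exact: measurable_funD.
have D1 w : 0 <= 1 + D w ^+ m by rewrite addr_ge0.
apply: (@le_trans _ _ (expectation P
   (fun w => e / (2 * (1 + B)) * (1 + D w ^+ m) + C * D w))).
  apply: expectation_mono.
  - exact: measurable_powR_fun.
  - by apply: measurable_funD; exact: measurable_funM.
  - by move=> w; exact: powR_ge0.
  - by move=> w; exact: qC.
rewrite expectation_add; last 4 first.
- exact: measurable_funM.
- exact: measurable_funM.
- by move=> w; rewrite mulr_ge0// ltW.
- by move=> w; rewrite mulr_ge0.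
rewrite (expectation_scale P (f := fun w => 1 + D w ^+ m)) ?(ltW e')//.
rewrite (expectation_scale P (f := D))// expectation_const_add//.
apply: (@le_trans _ _ ((e / (2 * (1 + B)))%:E * (1%:E + B%:E) +
   C%:E * (e / (2 * (C + 1)))%:E)%E).
  apply: leeD; first by rewrite lee_wpmul2l ?leeD2l// lee_fin ltW.
  by rewrite lee_wpmul2l.
rewrite -EFinD lee_fin.
have -> : e / (2 * (1 + B)) * (1 + B) = e / 2 by field; rewrite gt_eqF.
have : C * (e / (2 * (C + 1))) <= e / 2.
  have -> : C * (e / (2 * (C + 1))) = (e / 2) * (C / (C + 1)).
    by field; rewrite gt_eqF.
  by rewrite ler_piMr ?divr_ge0 ?(ltW e0)// ler_pdivrMr// mul1r lerDl.
by lra.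
Qed.

Lemma expectation_powR_triangle (q : R) A S : 0 < q -> mf A -> mf S ->
  (forall w, 0 <= A w) -> (forall w, 0 <= S w) ->
  (expectation P (fun w => A w `^ q)%R <=
   (2 `^ q)%:E * (expectation P (fun w => S w `^ q)%R +
     expectation P (fun w => `|A w - S w| `^ q)%R))%E.
Proof.
move=> q0 mA mS A0 S0.
have mSq := measurable_powR_fun q mS.
have mdq := measurable_powR_fun q (measurable_dist mA mS).
rewrite -(expectation_add P mSq mdq (fun w => powR_ge0 _ _) (fun w => powR_ge0 _ _)).
rewrite -(expectation_scale P (powR_ge0 2 q) (measurable_funD mSq mdq)); last first.
  by move=> w; rewrite addr_ge0 ?powR_ge0.
apply: expectation_mono.
- exact: measurable_powR_fun.
- by apply: measurable_funM => //; exact: measurable_funD.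
- by move=> w; exact: powR_ge0.
- move=> w; apply: le_trans (powR_add_le q0 (S0 w) (normr_ge0 (A w - S w))).
  apply: ge0_ler_powR; rewrite ?nnegrE ?(ltW q0) ?A0 ?addr_ge0//.
  by have := ler_norm (A w - S w); lra.
Qed.

Lemma expectation_dist_expr_le (m : nat) (C C' : R) A S : mf A -> mf S ->
  (forall w, 0 <= A w) -> (forall w, 0 <= S w) ->
  (expectation P (fun w => A w ^+ m)%R <= C%:E)%E ->
  (expectation P (fun w => S w ^+ m)%R <= C'%:E)%E ->
  (expectation P (fun w => `|A w - S w| ^+ m)%R <= (2 ^+ m * (C + C'))%:E)%E.
Proof.
move=> mA mS A0 S0 AC SC.
have mAm : mf (fun w => A w ^+ m) by exact: measurable_funX.
have mSm : mf (fun w => S w ^+ m) by exact: measurable_funX.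
have Am0 w : 0 <= A w ^+ m by rewrite exprn_ge0.
have Sm0 w : 0 <= S w ^+ m by rewrite exprn_ge0.
have p2 : (0 : R) <= 2 ^+ m by rewrite exprn_ge0.
apply: (@le_trans _ _ (expectation P (fun w => 2 ^+ m * (A w ^+ m + S w ^+ m)))).
  apply: expectation_mono.
  - by apply: measurable_funX; exact: measurable_dist.
  - by apply: measurable_funM => //; exact: measurable_funD.
  - by move=> w; rewrite exprn_ge0.
  - move=> w; apply: le_trans (expr_add_le m (A0 w) (S0 w)).
    rewrite lerXn2r ?nnegrE ?addr_ge0//.
    by rewrite (le_trans (ler_normB _ _))// !ger0_norm.
rewrite (expectation_scale P p2 (measurable_funD mAm mSm) (fun w => addr_ge0 (Am0 w) (Sm0 w))).
by rewrite (expectation_add P mAm mSm Am0 Sm0) EFinM lee_wpmul2l ?lee_fin// EFinD leeD.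
Qed.

(** The bound on moments of order [m] upgrades L^1 closeness to L^q; the quasi-triangle inequality,
    used in both directions, then costs a factor [2 ^ q] on each side. *)
Lemma moment_transfer (m : nat) (q C c1 c2 : R) A : 0 < q < m%:R -> mf A ->
  (forall w, 0 <= A w) ->
  (forall e, 0 < e -> exists S, [/\ mf S, (forall w, 0 <= S w),
     (expectation P (fun w => `|A w - S w|)%R <= e%:E)%E,
     (expectation P (fun w => S w ^+ m)%R <= C%:E)%E &
     (c1%:E <= expectation P (fun w => S w `^ q)%R <= c2%:E)%E]) ->
  ((2 `^ (- q) * c1)%:E <= expectation P (fun w => A w `^ q)%R <=
   (2 `^ q * c2)%:E)%E.
Proof.
move=> qm mA A0 appr; have /andP[q0 qm'] := qm.
have m0 : (0 < m)%N by rewrite -(ltr_nat R) (lt_trans q0).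
have C0 : 0 <= C.
  have [S [mS S0 _ SC _]] := appr 1 ltr01.
  rewrite -lee_fin (le_trans _ SC)// expectation_ge0// => w; exact: exprn_ge0.
have AC : (expectation P (fun w => A w ^+ m)%R <= (2 ^+ m * C)%:E)%E.
  apply: moment_of_limit => // e e0.
  by have [S [mS S0 AS SC _]] := appr e e0; exists S.
pose B := 2 ^+ m * (2 ^+ m * C + C).
have B0 : 0 <= B by rewrite mulr_ge0 ?addr_ge0 ?mulr_ge0 ?exprn_ge0.
have p2 : 0 < 2 `^ q :> R by rewrite powR_gt0.
have close e : 0 < e -> exists S, [/\ mf S, (forall w, 0 <= S w),
     (expectation P (fun w => `|A w - S w| `^ q)%R <= e%:E)%E &
     (c1%:E <= expectation P (fun w => S w `^ q)%R <= c2%:E)%E].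
  move=> e0; have [eta eta0 small] := Lq_small qm B0 e0.
  have [S [mS S0 AS SC Sq]] := appr _ eta0; exists S; split => //.
  by apply: small => //; [exact: measurable_dist|exact: expectation_dist_expr_le].
apply/andP; split; apply/lee_addgt0Pr => e e0.
- have [S [mS S0 ASq /andP[Sc1 _]]] := close e e0.
  have h := expectation_powR_triangle q0 mS mA S0 A0.
  have h2 : (c1%:E <= (2 `^ q)%:E *
      (expectation P (fun w => A w `^ q)%R + e%:E))%E.
    apply: (le_trans (le_trans Sc1 h)); rewrite lee_pmul2l ?lte_fin// leeD2l//.
    by under eq_fun do rewrite distrC.
  have p2' : (0 <= (2 `^ (- q))%:E)%E by rewrite lee_fin powR_ge0.
  have := lee_wpmul2l p2' h2; rewrite muleA.
  have -> : ((2 `^ (- q))%:E * (2 `^ q)%:E = 1)%E.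
    by rewrite -EFinM powRN mulVf ?gt_eqF.
  by rewrite mul1e.
- have e' : 0 < e / 2 `^ q by rewrite divr_gt0.
  have [S [mS S0 ASq /andP[_ Sc2]]] := close _ e'.
  apply: (le_trans (expectation_powR_triangle q0 mA mS A0 S0)).
  apply: (@le_trans _ _ ((2 `^ q)%:E * (c2%:E + (e / 2 `^ q)%:E))%E).
    by rewrite lee_pmul2l ?lte_fin// leeD.
  rewrite -EFinD -EFinM -EFinD lee_fin mulrDr lerD2l mulrC divfK// gt_eqF//.
Qed.

End moment_limits.

(** * Completeness of L^2 *)

Section L2_completeness.
Context d (T : measurableType d) (R : realType) (P : probability T R).
Local Notation mf := (measurable_fun [set: T]).

Lemma series_increments_cvg (u : nat -> R) :
  (\sum_(0 <= k <oo) (`|u k.+1 - u k|%R)%:E < +oo)%E -> cvgn u.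
Proof.
move=> fin; pose v k := u k.+1 - u k.
have cv : cvgn [normed series v].
  apply: nondecreasing_is_cvgn.
    apply/nondecreasing_seqP => n.
    by rewrite /normed_series_of /series /= big_nat_recr//= lerDl.
  set S := (\sum_(0 <= k <oo) _)%E in fin.
  have S0 : (0 <= S)%E by apply: nneseries_ge0 => k _ _; rewrite lee_fin.
  exists (fine S) => _ [n _ <-]; rewrite /normed_series_of /series /=.
  rewrite -lee_fin fineK ?ge0_fin_numE// -sumEFin.
  by apply: nneseries_lim_ge => k _ _; rewrite lee_fin.
have /normed_cvg : cvgn [normed series v] by [].
move=> /cvg_ex[l vl]; apply/cvg_ex; exists (u 0%N + l).
have uE n : u 0%N + series v n = u n.
  by rewrite /series /= telescope_sumr// addrC subrK.
have : u 0%N + series v n @[n --> \oo] --> u 0%N + l.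
  by apply: cvgD => //; exact: cvg_cst.
by under eq_fun do rewrite uE.
Qed.

(** The Riesz-Fischer argument: a subsequence with summable L^1 increments converges almost
    everywhere, and Fatou's lemma along it bounds the L^2 distance of the limit to every late
    term. *)
Lemma L2_complete (D : nat -> T -> R) :
  (forall n, mf (D n)) -> (forall n w, 0 <= D n w) ->
  (forall e, 0 < e -> exists n0, forall n N, (n0 <= n)%N -> (n <= N)%N ->
    (expectation P (fun w => (D N w - D n w) ^+ 2)%R <= e%:E)%E) ->
  exists A : T -> R, [/\ mf A, (forall w, 0 <= A w) &
    forall e, 0 < e -> exists n0, forall n, (n0 <= n)%N ->
      (expectation P (fun w => (A w - D n w) ^+ 2)%R <= e%:E)%E].
Proof.
move=> mD D0 cauchy.
pose eps k : R := 1 / (2 ^ k.+1)%:R.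
have eps0 k : 0 < eps k by rewrite divr_gt0// ltr0n expn_gt0.
have /choice[n0 n0P] : forall k, exists n, forall n' N, (n <= n')%N -> (n' <= N)%N ->
    (expectation P (fun w => (D N w - D n' w) ^+ 2)%R <= (eps k ^+ 2)%:E)%E.
  by move=> k; apply: cauchy; rewrite exprn_gt0.
(* Partial sums of the thresholds give a nondecreasing subsequence that dominates both [n0 k] and
   [k]. *)
pose nk k := (k + \sum_(i < k.+1) n0 i)%N.
have nk_ge k : (n0 k <= nk k)%N.
  by rewrite /nk big_ord_recr /= addnA leq_addl.
have nkS k : (nk k <= nk k.+1)%N.
  by rewrite /nk [in leqRHS]big_ord_recr /= leq_add// leq_addr.
have nk_id k : (k <= nk k)%N by rewrite leq_addr.
pose u k := D (nk k).
have mu_ k : mf (u k) by exact: mD.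
have mdu k : mf (fun w => `|u k.+1 w - u k w|) by exact: measurable_dist.
have uE k : (expectation P (fun w => `|u k.+1 w - u k w|)%R <= (eps k)%:E)%E.
  have mB : mf (fun w => u k.+1 w - u k w) by exact: measurable_funB.
  apply: (le_trans (expectation_norm_le P (eps0 k) mB)).
  apply: (@le_trans _ _ ((eps k / 2)%:E + (2 * eps k)^-1%:E * (eps k ^+ 2)%:E)%E).
    rewrite leeD2l// lee_wpmul2l//; last exact: n0P.
    by rewrite lee_fin invr_ge0 mulr_ge0// ltW.
  rewrite -EFinM -EFinD lee_fin.
  have -> : eps k / 2 + (2 * eps k)^-1 * eps k ^+ 2 = eps k.
    by field; rewrite gt_eqF.
  exact: lexx.
pose F w := (\sum_(0 <= k <oo) (`|u k.+1 w - u k w|%R)%:E)%E.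
have mF : measurable_fun setT F.
  by apply: ge0_emeasurable_sum => // k _; exact/measurable_EFinP.
have F0 w : (0 <= F w)%E by apply: nneseries_ge0 => k _ _; rewrite lee_fin.
have Ffin : (\int[P]_w F w < +oo)%E.
  have mdE k : measurable_fun setT (fun w => (`|u k.+1 w - u k w|)%:E).
    exact/measurable_EFinP.
  have dE0 k w : setT w -> (0 <= (`|u k.+1 w - u k w|)%:E)%E.
    by move=> _; rewrite lee_fin.
  rewrite (integral_nneseries P measurableT mdE dE0).
  apply: (@le_lt_trans _ _ (\sum_(0 <= k <oo) (eps k)%:E)%E).
    apply: lee_nneseries => k _.
      by move=> _; apply: integral_ge0 => w _; rewrite lee_fin.
    by have := uE k; rewrite unlock.
  by rewrite (le_lt_trans (epsilon_trick0 _ ler01))// ltry.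
have Fint : P.-integrable setT F.
  apply/integrableP; split => //.
  by under eq_integral do rewrite gee0_abs//.
have ucvg : {ae P, forall w, cvgn (u ^~ w)}.
  apply: filterS (integrable_ae measurableT Fint) => w /(_ Logic.I) Fw.
  by apply: series_increments_cvg; rewrite ltey_eq Fw.
(* The upper limit is measurable and agrees with the limit wherever that exists; the maximum with 0
   gives nonnegativity everywhere, not just almost everywhere. *)
pose A w := Num.max 0 (fine (limn_esup (fun k => (u k w)%:E))).
have mA : mf A.
  apply: measurable_maxr => //; apply: measurableT_comp => //.
  by apply: measurable_fun_limn_esup => k; exact/measurable_EFinP.
have uA : {ae P, forall w, u k w @[k --> \oo] --> A w}.
  apply: filterS ucvg => w /cvg_ex[l ul].
  have l0 : 0 <= l.
    rewrite -(cvg_lim _ ul)//; apply: limr_ge; first by apply/cvg_ex; exists l.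
    by apply: nearW => k; exact: D0.
  have uEl : (u k w)%:E @[k --> \oo] --> l%:E by apply: cvg_EFin => //; exact: nearW.
  suff -> : A w = l by [].
  by rewrite /A (cvg_limn_einf_sup uEl).2 /= max_r.
exists A; split => //.
  by move=> w; rewrite /A le_max lexx.
move=> e e0; have [N0 N0P] := cauchy e e0; exists N0 => n N0n.
have mdA : mf (fun w => (A w - D n w) ^+ 2).
  by apply: measurable_funX; exact: measurable_funB.
have mdk k : mf (fun w => (u k w - D n w) ^+ 2).
  by apply: measurable_funX; exact: measurable_funB.
have EA : (expectation P (fun w => (A w - D n w) ^+ 2)%R =
  \int[P]_w limn_einf (fun k => ((u k w - D n w) ^+ 2)%:E))%E.
  rewrite unlock; apply: ae_eq_integral => //.
  - exact/measurable_EFinP.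
  - under eq_fun do rewrite /limn_einf.
    apply: measurableT_comp => //; apply: measurable_fun_limn_esup => k.
    by apply: measurableT_comp => //; exact/measurable_EFinP.
  - apply: filterS uA => w uA _.
    have h : ((u k w - D n w) ^+ 2)%:E @[k --> \oo] --> ((A w - D n w) ^+ 2)%:E.
      apply: cvg_EFin; first exact: nearW.
      rewrite expr2; under eq_fun do rewrite expr2.
      by apply: cvgM; apply: cvgB => //; exact: cvg_cst.
    by rewrite (cvg_limn_einf_sup h).1.
rewrite EA; apply: le_trans (fatou _ _ _ _) _ => //.
- by move=> k; exact/measurable_EFinP.
- by move=> k w _; rewrite lee_fin sqr_ge0.
rewrite limn_einf_lim; apply: lime_le; first exact: is_cvg_einfs.
near=> k; apply: (@le_trans _ _ (\int[P]_w ((u k w - D n w) ^+ 2)%:E)%E).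
  by apply: ereal_inf_lbound; exists k => //=.
have := N0P n (nk k) N0n; rewrite unlock; apply.
by rewrite (leq_trans _ (nk_id k))//; near: k; exact: nbhs_infty_ge.
Unshelve. all: by end_near. Qed.

End L2_completeness.

(** The equality of the mixed moment with that of [y] is the martingale relation. The cross term is
    moved to the left before expanding, so that only nonnegative functions are integrated. *)
Lemma expectation_sqr_dist (R : realType) d (T : measurableType d)
    (P : probability T R) (x y : T -> R) (vx vy : R) :
  measurable_fun setT x -> measurable_fun setT y ->
  (forall w, 0 <= x w) -> (forall w, 0 <= y w) ->
  expectation P (fun w => x w * x w) = vx%:E ->
  expectation P (fun w => y w * y w) = vy%:E ->
  expectation P (fun w => y w * x w) = vy%:E ->
  expectation P (fun w => (x w - y w) ^+ 2) = (vx - vy)%:E.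
Proof.
move=> mx my x0 y0 Ex Ey Exy.
have mD : measurable_fun setT (fun w => (x w - y w) ^+ 2).
  by apply: measurable_funX; exact: measurable_funB.
have mM : measurable_fun setT (fun w => y w * x w) by exact: measurable_funM.
have m2M : measurable_fun setT (fun w => 2 * (y w * x w)) by exact: measurable_funM.
have M0 w : 0 <= y w * x w by rewrite mulr_ge0.
have M20 w : 0 <= 2 * (y w * x w) by rewrite mulr_ge0.
have mxx : measurable_fun setT (fun w => x w * x w) by exact: measurable_funM.
have myy : measurable_fun setT (fun w => y w * y w) by exact: measurable_funM.
have xx0 w : 0 <= x w * x w by rewrite mulr_ge0.
have yy0 w : 0 <= y w * y w by rewrite mulr_ge0.
have : (expectation P (fun w => (x w - y w) ^+ 2)%R +
    expectation P (fun w => 2 * (y w * x w))%R = (vx + vy)%:E)%E.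
  rewrite -(expectation_add P mD m2M (fun w => sqr_ge0 _) M20) EFinD -Ex -Ey.
  rewrite -(expectation_add P mxx myy xx0 yy0).
  by congr expectation; apply/funext => w; ring.
rewrite (expectation_scale P (ler0n R 2) mM M0) Exy -EFinM => h.
have -> : (vx - vy)%:E = ((vx + vy)%:E - (2 * vy)%:E)%E.
  by rewrite -EFinB; congr EFin; ring.
by rewrite -h addeK.
Qed.

(** * Powers of weighted averages *)

Section power_averages.
Context (R : realType).
Implicit Types (q x y : R) (m M : nat).

Lemma powR_factor q x : 0 < x -> x `^ q = x `^ (q - 1) * x.
Proof.
move=> x0; rewrite -[X in _ * X]powRr1 ?(ltW x0)// -powRD ?subrK//.
by rewrite (gt_eqF x0) implybT.
Qed.

Lemma powR_antitone r x y : r <= 0 -> 0 < x -> x <= y -> y `^ r <= x `^ r.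
Proof.
move=> r0 x0 xy; have y0 : 0 < y by exact: lt_le_trans xy.
rewrite -[r]opprK !(powRN _ (- r)) lef_pV2 ?posrE ?powR_gt0//.
by apply: ge0_ler_powR; rewrite ?nnegrE ?oppr_ge0 ?(ltW x0) ?(ltW y0).
Qed.

Lemma powR_le_1D q m x : 0 < q <= m%:R -> 0 <= x -> x `^ q <= 1 + x ^+ m.
Proof.
move=> /andP[q0 qm] x0; have [x1|/ltW x1] := leP x 1.
  have : x `^ q <= 1 `^ q by apply: ge0_ler_powR; rewrite ?nnegrE ?(ltW q0).
  by rewrite powR1 => /le_trans; apply; rewrite lerDl exprn_ge0.
apply: (@le_trans _ _ (x ^+ m)); last by rewrite lerDr.
by rewrite -powR_mulrn// ler_powR.
Qed.

(** Below the threshold [k] the power [q] controls [x], above it the square does. With mean 1 and a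
    bounded second moment this keeps the moment of order [q <= 1] away from 0. *)
Lemma le_powR_Dsqr q k x : 0 < q <= 1 -> 0 < k -> 0 <= x ->
  x <= k `^ (1 - q) * x `^ q + k^-1 * x ^+ 2.
Proof.
move=> /andP[q0 q1] k0; rewrite le_eqVlt => /orP[/eqP <-|x0].
  by rewrite addr_ge0 ?mulr_ge0 ?powR_ge0 ?invr_ge0 ?(ltW k0).
have [xk|/ltW kx] := leP x k.
  apply: ler_wpDr; first by rewrite mulr_ge0 ?invr_ge0 ?(ltW k0) ?sqr_ge0.
  rewrite -[leLHS]powRr1 ?(ltW x0)// -[X in x `^ X <= _](subrK q).
  rewrite powRD ?(gt_eqF x0) ?implybT// ler_wpM2r ?powR_ge0//.
  by apply: ge0_ler_powR; rewrite ?nnegrE ?subr_ge0 ?(ltW k0) ?(ltW x0).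
apply: ler_wpDl; first by rewrite mulr_ge0 ?powR_ge0.
by rewrite mulrC ler_pdivlMr// expr2 ler_pM2l.
Qed.

(* The next two bounds replace Jensen's inequality where it goes the wrong way. *)
Lemma powR_tilt_ge q (eta x y : R) : 1 <= q -> 0 < eta -> 0 < x -> 0 <= y ->
  eta * (x `^ (q - 1) * y) <= x `^ q + eta `^ q * y `^ q.
Proof.
move=> q1 eta0 x0; rewrite le_eqVlt => /orP[/eqP <-|y0].
  by rewrite !mulr0 addr_ge0 ?mulr_ge0 ?powR_ge0.
have ey0 : 0 < eta * y by rewrite mulr_gt0.
rewrite mulrCA -powRM ?(ltW eta0) ?(ltW y0)//.
have [h|/ltW h] := leP (eta * y) x.
  by apply: ler_wpDr; rewrite ?mulr_ge0 ?powR_ge0// (powR_factor q x0) ler_wpM2l ?powR_ge0.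
apply: ler_wpDl; rewrite ?powR_ge0// [leRHS](powR_factor q ey0).
rewrite ler_pM2r//.
by apply: ge0_ler_powR; rewrite ?nnegrE ?subr_ge0 ?(ltW x0) ?(ltW ey0).
Qed.

Lemma powR_tilt_le q x y : 0 < q <= 1 -> 0 < x -> 0 < y ->
  y `^ q <= x `^ (q - 1) * y + x `^ q.
Proof.
move=> /andP[q0 q1] x0 y0; have [yx|/ltW xy] := leP y x.
  apply: ler_wpDl; first by rewrite mulr_ge0 ?powR_ge0 ?(ltW y0).
  by apply: ge0_ler_powR; rewrite ?nnegrE ?(ltW q0) ?(ltW x0) ?(ltW y0).
apply: ler_wpDr; rewrite ?powR_ge0// (powR_factor q y0) ler_pM2r//.
by apply: powR_antitone => //; rewrite subr_le0.
Qed.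

Variables (M : nat) (f g : nat -> R).
Hypotheses (M0 : (0 < M)%N) (f0 : forall i, 0 < f i) (g0 : forall i, 0 < g i).

Let S := M%:R^-1 * \sum_(0 <= i < M) f i * g i.
Let W := M%:R^-1 * \sum_(0 <= i < M) g i.

Let avg_gt0 (h : nat -> R) : (forall i, 0 < h i) ->
  0 < M%:R^-1 * \sum_(0 <= i < M) h i.
Proof.
move=> h0; rewrite mulr_gt0 ?invr_gt0 ?ltr0n//.
by case: (M) M0 => // k _; rewrite big_nat_recl// ltr_pwDl// sumr_ge0// => i _; exact: ltW.
Qed.

Let S0 : 0 < S. Proof. by apply: avg_gt0 => i; rewrite mulr_gt0. Qed.
Let W0 : 0 < W. Proof. exact: avg_gt0. Qed.

Let avg_le (h : nat -> R) (u v : R) : (forall i, h i <= u + v * f i) ->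
  M%:R^-1 * \sum_(0 <= i < M) h i * g i <= u * W + v * S.
Proof.
move=> huv; rewrite /W /S !mulrA ![_ * M%:R^-1]mulrC -!mulrA -mulrDr.
rewrite ler_pM2l ?invr_gt0 ?ltr0n// !mulr_sumr -big_split/=.
apply: ler_sum => i _; rewrite mulrA -mulrDl ler_pM2r//.
Qed.

Let avg_ge (h : nat -> R) (u v : R) : (forall i, f i <= u + v * h i) ->
  S <= u * W + v * (M%:R^-1 * \sum_(0 <= i < M) h i * g i).
Proof.
move=> huv; rewrite /W /S !mulrA ![_ * M%:R^-1]mulrC -!mulrA -mulrDr.
rewrite ler_pM2l ?invr_gt0 ?ltr0n// !mulr_sumr -big_split/=.
apply: ler_sum => i _; rewrite mulrA -mulrDl ler_pM2r//.
Qed.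

(* Up to constants, this and the next bound are Jensen's inequality for the
   weights [g i]. *)
Lemma average_powR_le q : 1 <= q ->
  S `^ q <= 2 `^ q * (W `^ (q - 1) * (M%:R^-1 * \sum_(0 <= i < M) f i `^ q * g i)).
Proof.
(* Indices with [f i <= y] contribute at most [y * W = S / 2], so the others carry at least half of
   [S]. *)
move=> q1; set J := M%:R^-1 * _; pose y := S / (2 * W).
have y0 : 0 < y by rewrite divr_gt0// mulr_gt0.
have Wy : W * y = S / 2 by rewrite /y; field; rewrite gt_eqF.
have h : S <= y * W + y `^ (1 - q) * J.
  apply: avg_ge => i; have [fy|/ltW yf] := leP (f i) y.
    by apply: ler_wpDr; rewrite ?mulr_ge0 ?powR_ge0.
  apply: ler_wpDl; rewrite ?(ltW y0)// -[leLHS]powRr1 ?(ltW (f0 i))//.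
  rewrite -[X in f i `^ X <= _](subrK q) powRD ?(gt_eqF (f0 i)) ?implybT//.
  by rewrite ler_wpM2r ?powR_ge0//; apply: powR_antitone; rewrite ?subr_le0.
have {}h : W * y `^ q <= J.
  have hy : W * y <= y `^ (1 - q) * J by move: h; rewrite (mulrC y) Wy; lra.
  have -> : J = y `^ (q - 1) * (y `^ (1 - q) * J).
    rewrite mulrA -powRD ?(gt_eqF y0) ?implybT//.
    by rewrite (_ : _ + _ = 0) ?powRr0 ?mul1r//; ring.
  by rewrite (powR_factor q y0) mulrCA ler_wpM2l ?powR_ge0.
apply: (@le_trans _ _ (2 `^ q * (W `^ (q - 1) * (W * y `^ q)))); last first.
  by rewrite ler_wpM2l ?powR_ge0// ler_wpM2l ?powR_ge0.
rewrite (mulrA (W `^ _)) -powR_factor// -(powRM _ (ltW W0) (ltW y0)).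
have Wy0 : 0 <= W * y by rewrite mulr_ge0 ?(ltW W0) ?(ltW y0).
rewrite -(powRM _ (ler0n R 2) Wy0). rewrite Wy.
by rewrite mulrCA divff ?mulr1.
Qed.

Lemma average_powR_ge q : 0 < q <= 1 ->
  W `^ (q - 1) * (M%:R^-1 * \sum_(0 <= i < M) f i `^ q * g i) <= 2 * S `^ q.
Proof.
move=> q01; set J := M%:R^-1 * _; pose y := S / W.
have y0 : 0 < y by rewrite divr_gt0.
have Wy : W * y = S by rewrite /y mulrC divfK// gt_eqF.
have h : J <= y `^ q * W + y `^ (q - 1) * S.
  by apply: avg_le => i; rewrite addrC; exact: powR_tilt_le.
apply: (le_trans (ler_wpM2l (powR_ge0 W (q - 1)) h)).
have -> : y `^ (q - 1) * S = y `^ q * W by rewrite -Wy (powR_factor q y0); ring.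
rewrite -Wy (powRM _ (ltW W0) (ltW y0)) (powR_factor q W0) le_eqVlt; apply/orP; left.
by apply/eqP; ring.
Qed.

End power_averages.

(** * Multifractal products *)

Section multifractal_products.
Context (R : realType) (alpha beta lambda : R) (m : nat).
Hypotheses (halpha : 0 < alpha) (hbeta : 0 < beta) (hlambda : 0 < lambda).
Hypotheses (m1 : (1 < m)%N) (ma : m%:R < alpha).
Context d0 (T0 : measurableType d0) (P0 : probability T0 R).
Context (X : R -> {RV P0 >-> R}).
Hypotheses (hX : stationary_OU_type lambda X) (hX0 : gamma_law beta alpha (X 0)).
Context d (T : measurableType d) (P : probability T R).
Context (Lam : nat -> R -> {RV P >-> R}).
Local Notation gam := (gam alpha beta).
Local Notation c := (gam 1).
Local Notation theta := (slope alpha beta m%:R).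
Local Notation log_gap := (log_gap alpha beta m%:R lambda).
Local Notation mf := (measurable_fun [set: T]).
Local Notation leb := (@lebesgue_measure R).
Hypothesis hfdd : forall j, same_fdd P P0 (fun t => Lam j t)
  (fun t w => expR (X t w - c)).
Hypothesis hind : mutually_independent P (fun j => sigma_process (fun t => Lam j t)).
Variable b : R.
Hypotheses (b1 : 1 < b) (hb : theta < ln b).
Hypothesis hmeas : forall j, measurable_process (fun t => Lam j t).

Let b0 : 0 < b. Proof. exact: lt_trans ltr01 b1. Qed.
Let b_ge0 : 0 <= b. Proof. exact: ltW. Qed.
Let bm1 : 0 < b - 1. Proof. by rewrite subr_gt0. Qed.
Let lnb : 0 < ln b. Proof. exact: ln_gt0. Qed.
Let m0 : (0 < m)%N. Proof. exact: ltnW. Qed.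
Let m1R : 1 < m%:R :> R. Proof. by rewrite ltr1n. Qed.
Let a1 : 1 < alpha. Proof. exact: lt_trans ma. Qed.
Let a2 : 2 < alpha. Proof. by rewrite (le_lt_trans _ ma)// ler_nat. Qed.

(* [ln] is junk where a copy of [Lambda] is nonpositive, which is a null event
   by copy_gt0. *)
Definition log_field (n N : nat) (s : R) (w : T) : R :=
  \sum_(n <= j < N) ln (Lam j (s * b ^+ j) w).

Local Notation Y := log_field.

Definition block_sigma (S : set nat) : set (set T) :=
  \bigcup_(j in S) sigma_process (fun t => Lam j t).

Lemma log_field_block (S : set nat) (n N : nat) (s : R) : 0 <= s ->
  (forall j, (n <= j < N)%N -> S j) ->
  measurable_fun [set: g_sigma_algebraType (block_sigma S)]
    (log_field n N s : g_sigma_algebraType (block_sigma S) -> R).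
Proof.
move=> s0 nNS; rewrite /log_field.
rewrite (_ : (fun w => _) = (fun w : g_sigma_algebraType (block_sigma S) =>
    \sum_(j <- index_iota n N)
      (if j \in index_iota n N then ln (Lam j (s * b ^+ j) w) else 0))); last first.
  by apply/funext => w; apply: eq_big_seq => j jn; rewrite jn.
apply: measurable_sum => j.
case: (boolP (j \in index_iota n N)) => [|_]; last exact: measurable_cst.
rewrite mem_index_iota => /nNS Sj.
apply: measurableT_comp; first exact: measurable_ln.
move=> _ B mB; apply: sub_sigma_algebra; exists j => //; apply: sub_sigma_algebra.
exists (s * b ^+ j); split; last by exists B; rewrite setTI.
by rewrite mulr_ge0// exprn_ge0// ltW// (lt_trans _ b1).
Qed.

Lemma measurable_log_field n N s : mf (log_field n N s).
Proof.
apply: measurable_sum => j; apply: measurableT_comp => //; exact: measurable_ln.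
Qed.

Lemma sub_block_sigma (S : set nat) (f : T -> R) :
  measurable_fun [set: g_sigma_algebraType (block_sigma S)]
    (f : g_sigma_algebraType (block_sigma S) -> R) ->
  sigma_rv f `<=` <<s block_sigma S >>.
Proof.
move=> mfS; apply: sigma_rv_subset => B mB.
by have := mfS measurableT B mB; rewrite setTI.
Qed.

Lemma block_sigma_independent (n : nat) :
  independent2 P <<s block_sigma [set k | (k < n)%N] >>
    <<s block_sigma [set k | (n <= k)%N] >>.
Proof.
apply: block_independence => // k.
- apply: smallest_sub; first exact: sigma_algebra_measurable.
  move=> _ [t [t0 [B [mB ->]]]]; rewrite -[X in measurable X]setTI.
  exact: measurable_funP.
- have : sigma_algebra setT (sigma_process (fun t => Lam k t)).
    exact: smallest_sigma_algebra.
  by case=> s0 /(_ _ s0); rewrite setD0.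
- rewrite /sigma_process; set F := [set E | _].
  exact: (@measurableI _ (g_sigma_algebraType F)).
Qed.

Lemma expectation_blockM (n : nat) (f g : T -> R) :
  measurable_fun [set: g_sigma_algebraType (block_sigma [set k | (k < n)%N])]
    (f : g_sigma_algebraType (block_sigma [set k | (k < n)%N]) -> R) ->
  measurable_fun [set: g_sigma_algebraType (block_sigma [set k | (n <= k)%N])]
    (g : g_sigma_algebraType (block_sigma [set k | (n <= k)%N]) -> R) ->
  mf f -> mf g -> (forall w, 0 <= f w) -> (forall w, 0 <= g w) ->
  ('E_P[fun w => (f w * g w)%R] = 'E_P[f] * 'E_P[g])%E.
Proof.
move=> fS gS mf_ mg f0 g0; apply: expectation_independentM => //.
apply: (independent2_sub _ _ (@block_sigma_independent n)).
  exact: sub_block_sigma.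
exact: sub_block_sigma.
Qed.

Definition OU_log_moment (s : seq (R * R)) : \bar R :=
  'E_P0[fun w => expR (\sum_(p <- s) p.1 * (X p.2 w - c))]%E.

Lemma log_field_moment1 j (s : seq (R * R)) : {in s, forall p, 0 <= p.2} ->
  'E_P[fun w => expR (\sum_(p <- s) p.1 * ln (Lam j p.2 w))]%E = OU_log_moment s.
Proof.
move=> s0.
rewrite (same_fdd_expectation_exp (h := @ln R) (hfdd j) _ _ (@measurable_ln R) s0)//.
  congr expectation; apply/funext => w; congr expR.
  by apply: eq_bigr => p _; rewrite expRK.
by move=> t; apply: measurableT_comp => //; exact: measurable_funB.
Qed.

(** Level [j] sees the times dilated by [b ^+ j]; the topmost level is independent of the lower ones
    and is split off by [expectation_blockM]. *)
Lemma log_field_moment n N (s : seq (R * R)) : {in s, forall p, 0 <= p.2} ->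
  'E_P[fun w => expR (\sum_(p <- s) p.1 * log_field n N p.2 w)]%E =
  (\prod_(n <= j < N) OU_log_moment [seq (p.1, (p.2 * b ^+ j)%R) | p <- s])%E.
Proof.
move=> s0; have [Nn|nN] := leqP N n.
  rewrite big_geq// (_ : (fun w => _) = cst 1) ?expectation_cst//.
  apply/funext => w; rewrite big1 ?expR0// => p _.
  by rewrite /log_field big_geq// mulr0.
elim: N nN => // N ih; rewrite ltnS => nN.
rewrite big_nat_recr//=.
have -> : (\prod_(n <= j < N) OU_log_moment [seq (p.1, (p.2 * b ^+ j)%R) | p <- s])%E =
  'E_P[fun w => expR (\sum_(p <- s) p.1 * log_field n N p.2 w)]%E.
  move: nN; rewrite leq_eqVlt => /orP[/eqP ->|/ih ->//].
  rewrite big_geq// (_ : (fun w => _) = cst 1) ?expectation_cst//.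
  apply/funext => w; rewrite big1 ?expR0// => p _.
  by rewrite /log_field big_geq// mulr0.
rewrite -(log_field_moment1 N); last first.
  by move=> _ /mapP[p ps ->] /=; rewrite mulr_ge0 ?s0// exprn_ge0.
pose f w := expR (\sum_(p <- s) p.1 * log_field n N p.2 w).
pose g w := expR (\sum_(p <- s) p.1 * log_field N N.+1 p.2 w).
have fS : measurable_fun [set: g_sigma_algebraType (block_sigma [set k | (k < N)%N])]
    (f : g_sigma_algebraType (block_sigma [set k | (k < N)%N]) -> R).
  apply: measurableT_comp => //.
  rewrite (_ : (fun w => _) =
      (fun w : g_sigma_algebraType (block_sigma [set k | (k < N)%N]) =>
      \sum_(p <- s) (if p \in s then p.1 * log_field n N p.2 w else 0))); last first.
    by apply/funext => w; apply: eq_big_seq => p ps; rewrite ps.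
  apply: measurable_sum => p.
  case: (boolP (p \in s)) => [ps|_]; last exact: measurable_cst.
  apply: measurable_funM => //; apply: log_field_block; first exact: s0.
  by move=> j /andP[].
have gS : measurable_fun [set: g_sigma_algebraType (block_sigma [set k | (N <= k)%N])]
    (g : g_sigma_algebraType (block_sigma [set k | (N <= k)%N]) -> R).
  apply: measurableT_comp => //.
  rewrite (_ : (fun w => _) =
      (fun w : g_sigma_algebraType (block_sigma [set k | (N <= k)%N]) =>
      \sum_(p <- s) (if p \in s then p.1 * log_field N N.+1 p.2 w else 0))); last first.
    by apply/funext => w; apply: eq_big_seq => p ps; rewrite ps.
  apply: measurable_sum => p.
  case: (boolP (p \in s)) => [ps|_]; last exact: measurable_cst.
  apply: measurable_funM => //; apply: log_field_block; first exact: s0.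
  by move=> j /andP[].
have mfg n' N' : mf (fun w => expR (\sum_(p <- s) p.1 * log_field n' N' p.2 w)).
  apply: measurableT_comp => //; apply: measurable_sum => p.
  by apply: measurable_funM => //; exact: measurable_log_field.
have := expectation_blockM fS gS (mfg _ _) (mfg _ _)
  (fun w => expR_ge0 _) (fun w => expR_ge0 _).
have -> : (fun w => f w * g w) =
    (fun w => expR (\sum_(p <- s) p.1 * log_field n N.+1 p.2 w)).
  apply/funext => w; rewrite /f /g -expRD -big_split/=; congr expR.
  apply: eq_bigr => p _; rewrite -mulrDr; congr (_ * _).
  by rewrite /log_field big_nat1 big_nat_recr.
move=> ->; congr (_ * _)%E; congr expectation; apply/funext => w; congr expR.
by rewrite big_map; apply: eq_bigr => p _; rewrite /log_field big_nat1.
Qed.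

Local Notation logmom := OU_log_moment.

Lemma OU_log_momentE (s : seq (R * R)) :
  logmom s = ((expR (- c * \sum_(p <- s) p.1))%:E *
    'E_P0[fun w => expR (\sum_(p <- s) p.1 * X p.2 w)])%E.
Proof.
have mE : measurable_fun setT (fun w => expR (\sum_(p <- s) p.1 * X p.2 w)).
  by apply: measurableT_comp => //; apply: measurable_sum => p;
    exact: measurable_funM.
rewrite -(expectation_scale _ (expR_ge0 _) mE (fun w => expR_ge0 _)).
rewrite /OU_log_moment; congr expectation; apply/funext => w; rewrite -expRD.
congr expR; rewrite mulr_sumr -big_split/=; apply: eq_bigr => p _; ring.
Qed.

Lemma OU_log_moment_ge0 s : (0 <= logmom s)%E.
Proof. by apply: expectation_ge0 => w; exact: expR_ge0. Qed.

(** The logarithm of the moment of order [q] of [Lambda]; its vanishing at 1 is the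
    normalisation. *)
Definition lognu (q : R) : R := gam q - c * q.

Local Notation logK := lognu.

Lemma log_field_power_moment n N (s q : R) : 0 <= s -> q < alpha ->
  expectation P (fun w => expR (q * Y n N s w)) = (expR ((N - n)%:R * lognu q))%:E.
Proof.
move=> s0 qa; transitivity
  (expectation P (fun w => expR (\sum_(p <- [:: (q, s)]) p.1 * Y n N p.2 w))).
  by congr expectation; apply/funext => w; rewrite big_seq1.
rewrite (log_field_moment); last by move=> p; rewrite inE => /eqP ->.
rewrite (eq_bigr (fun=> (expR (lognu q))%:E)); last first.
  move=> j _; rewrite OU_log_momentE /= big_seq1/=.
  have -> : expectation P0 (fun w => expR (\sum_(p <- [:: (q, s * b ^+ j)%R]) p.1 * X p.2 w)) =
      expectation P0 (fun w => expR (q * X (s * b ^+ j) w)).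
    by congr expectation; apply/funext => w; rewrite big_seq1.
  rewrite (OU_marginal_mgf halpha hX hX0)//; last by rewrite mulr_ge0// exprn_ge0.
  by rewrite -EFinM -expRD /lognu mulNr addrC.
by rewrite prod_expR sumr_const_nat mulr_natl.
Qed.

Definition log_gaps n N (D : R) : R := \sum_(n <= j < N) log_gap (D * b ^+ j).

Lemma log_field_product_moment n N (t : R) (l : seq R) :
  path >=%R t l -> {in t :: l, forall u, 0 <= u} -> (size l).+1 = m ->
  ('E_P[fun w => expR (\sum_(u <- t :: l) Y n N u w)] <=
   (expR (gapsum (log_gaps n N) t l))%:E)%E.
Proof.
move=> tl tl0 szl.
have -> : expectation P (fun w => expR (\sum_(u <- t :: l) Y n N u w)) =
  expectation P (fun w => expR (\sum_(p <- [seq (1%R : R, u) | u <- t :: l]) p.1 * Y n N p.2 w)).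
  congr expectation; apply/funext => w; rewrite big_map; congr expR.
  by apply: eq_bigr => u _; rewrite mul1r.
rewrite (log_field_moment); last by move=> _ /mapP[u ul ->]; exact: tl0.
rewrite /log_gaps -gapsum_sum; apply: prod_le_expR => j _.
rewrite OU_log_moment_ge0/= -gapsum_scale OU_log_momentE.
set a := b ^+ j; have a0 : 0 <= a by rewrite exprn_ge0.
have pl : path >=%R (t * a) [seq u * a | u <- l].
  move: tl; elim: (l) (t) => //= u l' ih t' /andP[ut /ih ->].
  by rewrite ler_wpM2r.
have pl0 : {in t * a :: [seq u * a | u <- l], forall u, 0 <= u}.
  move=> u; rewrite inE => /orP[/eqP ->|/mapP[v vl ->]]; rewrite mulr_ge0//.
    by rewrite tl0// mem_head.
  by rewrite tl0// inE vl orbT.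
have sm : 1 + (size [seq u * a | u <- l])%:R <= m%:R :> R.
  by rewrite size_map -szl -natr1 addrC.
have := OU_product_moment halpha hbeta hlambda hX hX0 m1 ma pl pl0 (lexx 1) sm.
(* At [z = 1] the slope term vanishes, and [gam 1 * m] is cancelled below by the normalisation of
   [Lambda]: only the gaps remain. *)
rewrite subrr mulr0 addr0 size_map natr1 szl => h.
have -> : \sum_(p <- [seq (p.1, p.2 * a) | p <- [seq (1 : R, u) | u <- t :: l]]) p.1 = m%:R.
  rewrite -map_comp big_map /= -szl -[(size l).+1]/(size (t :: l)).
  by rewrite -sum1_size natr_sum.
have -> : expectation P0 (fun w => expR (\sum_(p <- [seq (p.1, p.2 * a)%R |
      p <- [seq (1%R : R, u) | u <- t :: l]]) p.1 * X p.2 w)) =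
  expectation P0 (fun w => expR (\sum_(u <- [seq u * a | u <- l]) X u w + 1 * X (t * a) w)).
  congr expectation; apply/funext => w; congr expR.
  rewrite -map_comp big_map /= big_cons /= addrC; congr (_ + _).
  by rewrite big_map; apply: eq_bigr => u _; rewrite mul1r.
apply: (le_trans (lee_wpmul2l _ h)); first by rewrite lee_fin expR_ge0.
by rewrite -EFinM -expRD lee_fin ler_expR mulNr addKr.
Qed.

(** Exponents and times of the mean at [t] biased by the power [q - 1] of the value at [r]; for
    [r = t] this is the moment of order [q]. *)
Definition tilted_pair (q r t : R) : seq (R * R) := [:: (q - 1, r); (1, t)].

Let two_point_factor (q r t : R) : q < alpha -> 0 <= r <= t -> 0 < q ->
  let e := expR (- lambda * (t - r)) in
  logmom (tilted_pair q r t) =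
  (expR (gam (q - 1 + e) + c - gam e - c * q))%:E.
Proof.
move=> qa rt q0 e; rewrite OU_log_momentE /tilted_pair.
have -> : expectation P0 (fun w => expR (\sum_(p <- [:: (q - 1, r)%R; (1%R, t)]) p.1 * X p.2 w)) =
    expectation P0 (fun w => expR ((q - 1) * X r w + 1 * X t w)).
  by congr expectation; apply/funext => w; rewrite !big_cons big_nil addr0.
have e1 : e <= 1.
  case/andP: rt => r0 rt; rewrite -expR0 ler_expR mulNr oppr_le0.
  by rewrite mulr_ge0 ?subr_ge0// ltW.
rewrite (OU_two_point halpha hlambda hX hX0 rt)//; last first.
  by rewrite mul1r -/e; lra.
rewrite !big_cons big_nil /= mul1r -/e -EFinM -expRD.
by congr (expR _)%:E; ring.
Qed.

Let e_bounds (r t : R) : 0 <= r <= t ->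
  0 < expR (- lambda * (t - r)) <= 1 /\
  1 - expR (- lambda * (t - r)) <= lambda * (t - r).
Proof.
move=> /andP[r0 rt]; split.
  by rewrite mulNr expRN_le1// mulr_ge0 ?subr_ge0// ltW.
by have := expR_ge1Dx (- lambda * (t - r)); lra.
Qed.

(** At coinciding times the exponents add up to [q]. Separating the times replaces [q] by
    [q - 1 + e] with [1 - e] at most [lambda * (t - r)], and the slope bound on [gam] makes the loss
    linear in the gap. *)
Lemma OU_log_moment2_ge (q r t : R) : 1 <= q < alpha -> 0 <= r <= t ->
  ((expR (lognu q - beta * lambda / (alpha - q) * (t - r)))%:E <=
   logmom (tilted_pair q r t))%E.
Proof.
move=> /andP[q1 qa] rt; have q0 : 0 < q by rewrite (lt_le_trans _ q1).
rewrite two_point_factor// lee_fin ler_expR.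
have [/andP[] ] := e_bounds rt; set e := expR _ => e0 e1 eD.
have ce : gam e <= c by rewrite gam_nd.
have qe : q - 1 + e < alpha by lra.
have h := gam_sub_le halpha hbeta qe qa.
have aq : 0 < alpha - q by rewrite subr_gt0.
suff : beta * (q - (q - 1 + e)) / (alpha - q) <= beta * lambda / (alpha - q) * (t - r).
  by rewrite /lognu; lra.
have -> : beta * (q - (q - 1 + e)) / (alpha - q) = (beta / (alpha - q)) * (1 - e) by ring.
have -> : beta * lambda / (alpha - q) * (t - r) = (beta / (alpha - q)) * (lambda * (t - r)) by ring.
by rewrite ler_wpM2l// divr_ge0// ltW.
Qed.

Lemma OU_log_moment2_le (q r t : R) : 0 < q <= 1 -> 0 <= r <= t ->
  (logmom (tilted_pair q r t) <=
   (expR (lognu q + beta * lambda / (alpha - 1) * (t - r)))%:E)%E.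
Proof.
move=> /andP[q0 q1] rt.
have qa : q < alpha by rewrite (le_lt_trans q1).
rewrite two_point_factor// lee_fin ler_expR.
have [/andP[] ] := e_bounds rt; set e := expR _ => e0 e1 eD.
have qe : gam (q - 1 + e) <= gam q by rewrite gam_nd//; lra.
have ea : e < alpha by rewrite (le_lt_trans e1).
have h := gam_sub_le halpha hbeta ea a1.
have aq : 0 < alpha - 1 by rewrite subr_gt0.
suff : beta * (1 - e) / (alpha - 1) <= beta * lambda / (alpha - 1) * (t - r).
  by rewrite /lognu; lra.
have -> : beta * (1 - e) / (alpha - 1) = (beta / (alpha - 1)) * (1 - e) by ring.
have -> : beta * lambda / (alpha - 1) * (t - r) = (beta / (alpha - 1)) * (lambda * (t - r)) by ring.
by rewrite ler_wpM2l// divr_ge0// ltW.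
Qed.

(** * Moments of Riemann averages over a block of levels *)

Definition block_avg (n N M : nat) (t : R) (w : T) : R :=
  M%:R^-1 * \sum_(0 <= i < M) expR (Y n N (i%:R * (t / M%:R)) w).

Local Notation avg := block_avg.

Lemma measurable_block_avg n N M t : mf (block_avg n N M t).
Proof.
apply: measurable_funM => //; apply: measurable_sum => i.
by apply: measurableT_comp => //; exact: measurable_log_field.
Qed.

Lemma block_avg_ge0 n N M t w : 0 <= block_avg n N M t w.
Proof. by rewrite mulr_ge0 ?invr_ge0// sumr_ge0// => i _; exact: expR_ge0. Qed.

Definition block_avg_cst : R :=
  m`!%:R * (1 + expR (gap_cst theta (near_cst alpha beta m%:R lambda)
    (far_cst alpha beta m%:R) lambda b) * (2 / (1 - theta / ln b))) ^+ m.-1.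

Lemma block_avg_cst_ge0 : 0 <= block_avg_cst.
Proof.
rewrite mulr_ge0// exprn_ge0// addr_ge0// mulr_ge0 ?expR_ge0// divr_ge0//.
by rewrite subr_ge0 ler_pdivrMr// mul1r ltW.
Qed.

(** Ordered chains reduce the moment to [m.-1] gap sums, each of which is bounded after
    multiplication by [t * b ^+ n], the length of the interval as seen by level [n]. The last
    condition is the fineness required by [gap_sum_bound]. *)
Lemma block_avg_moment n N M t : 0 <= t -> t * b ^+ n <= 1 -> (0 < M)%N ->
  expR (theta * (N - n)%:R) <= M%:R ->
  (((t * b ^+ n) ^+ m.-1)%:E * expectation P (fun w => block_avg n N M t w ^+ m)%R
    <= block_avg_cst%:E)%E.
Proof.
move=> t0 tau1 M0 MN; have MR : 0 < M%:R :> R by rewrite ltr0n.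
pose s (i : nat) : R := i%:R * (t / M%:R).
have tM : 0 <= t / M%:R by rewrite divr_ge0// ltW.
have s0 i : 0 <= s i by rewrite mulr_ge0.
pose G := log_gaps n N.
pose sigma := \sum_(0 <= k < M) expR (G (s k)).
have sigma0 : 0 <= sigma by apply: sumr_ge0 => k _; exact: expR_ge0.
have sigmaG i : (i < M)%N -> \sum_(i <= k < M) expR (G (s k - s i)) <= sigma.
  move=> iM; rewrite -{1}[i]add0n big_addn /sigma.
  rewrite [leRHS](big_cat_nat (n := M - i)) ?leq_subr//=.
  rewrite ler_wpDr//; first by apply: sumr_ge0 => k _; exact: expR_ge0.
  rewrite le_eqVlt; apply/orP; left; apply/eqP; apply: eq_bigr => k _.
  by congr (expR (G _)); rewrite /s natrD; ring.
pose f i w := expR (Y n N (s i) w).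
have mf_ i : mf (f i).
  by apply: measurableT_comp => //; exact: measurable_log_field.
have f0 i w : 0 <= f i w by exact: expR_ge0.
have fG i (l : seq nat) : (size l).+1 = m -> path geq i l -> (i < M)%N ->
   ('E_P[fun w => (\prod_(k <- i :: l) f k w)%R] <=
   (expR (gapsum G (s i) [seq s k | k <- l]))%:E)%E.
  move=> szl il _.
  have pl : path >=%R (s i) [seq s k | k <- l].
    elim: l (i) il {szl} => //= k l ih i' /andP[ki /ih ->]; rewrite andbT.
    by rewrite ler_wpM2r// ler_nat.
  have pl0 : {in s i :: [seq s k | k <- l], forall u, 0 <= u}.
    by move=> u; rewrite inE => /orP[/eqP -> //|/mapP[k _ ->]].
  have szl' : (size [seq s k | k <- l]).+1 = m by rewrite size_map.
  have := log_field_product_moment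
    n N pl pl0 szl'.
  apply: le_trans; rewrite le_eqVlt; apply/orP; left; apply/eqP.
  congr expectation; apply/funext => w; rewrite /f -expR_sum; congr expR.
  by rewrite !big_cons big_map.
have := sum_moment_le mf_ f0 sigma0 sigmaG fG (ltnW m1).
set E1 := expectation P _ => hE1.
have -> : expectation P (fun w => block_avg n N M t w ^+ m) =
    ((M%:R ^- m)%:E * E1)%E.
  rewrite -expectation_scale ?invr_ge0 ?exprn_ge0//; last 2 first.
  - by apply: measurable_funX; exact: measurable_sum.
  - by move=> w; rewrite exprn_ge0// sumr_ge0.
  congr expectation; apply/funext => w; rewrite /block_avg exprMn exprVn.
  by [].
rewrite muleA -EFinM.
have k0 : 0 <= (t * b ^+ n) ^+ m.-1 / M%:R ^+ m.
  by rewrite divr_ge0 ?exprn_ge0// mulr_ge0// exprn_ge0// ltW// (lt_trans _ b1).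
apply: (le_trans (lee_wpmul2l _ hE1)); first by rewrite lee_fin.
rewrite -EFinM lee_fin.
have -> : (t * b ^+ n) ^+ m.-1 / M%:R ^+ m * (m`!%:R * (M%:R * sigma ^+ m.-1)) =
  m`!%:R * (t * b ^+ n * (sigma / M%:R)) ^+ m.-1.
  rewrite [in RHS]mulrA [in RHS]exprMn [in RHS]exprMn exprVn.
  rewrite -{2}(prednK (ltnW m1)) exprS; field.
  by rewrite expf_neq0 gt_eqF.
have sb : t * b ^+ n * (sigma / M%:R) <= 1 + expR (gap_cst theta
    (near_cst alpha beta m%:R lambda) (far_cst alpha beta m%:R) lambda b) *
    (2 / (1 - theta / ln b)).
  apply: gap_sum_bound => //.
  - exact: slope_ge0.
  - exact: near_cst_ge0.
  - exact: far_cst_ge0.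
  - by move=> D D0; rewrite /log_gap ge_min lexx.
  - by move=> D D0; rewrite /log_gap ge_min lexx orbT.
have s1 : 0 <= t * b ^+ n * (sigma / M%:R).
  by rewrite mulr_ge0 ?divr_ge0// mulr_ge0// exprn_ge0// ltW.
rewrite ler_wpM2l// lerXn2r ?nnegrE//.
exact: le_trans sb.
Qed.

Let tilt_moment n N q r t : 0 <= r -> 0 <= t ->
  expectation P (fun w => expR ((q - 1) * Y n N r w + Y n N t w)) =
  (\prod_(n <= j < N) OU_log_moment (tilted_pair q (r * b ^+ j) (t * b ^+ j)))%E.
Proof.
move=> r0 t0.
have s0 : {in tilted_pair q r t, forall p, 0 <= p.2}.
  by move=> p; rewrite !inE => /orP[/eqP ->|/eqP ->].
rewrite -(log_field_moment n N s0).
congr expectation; apply/funext => w; congr expR.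
by rewrite !big_cons big_nil /= mul1r addr0.
Qed.

Lemma log_field_tilt_ge n N q r t : 1 <= q < alpha -> 0 <= r <= t ->
  ((expR ((N - n)%:R * logK q -
     beta * lambda / (alpha - q) * (t - r) * \sum_(n <= j < N) b ^+ j))%:E <=
   expectation P (fun w => expR ((q - 1) * Y n N r w + Y n N t w))%R)%E.
Proof.
move=> qa /andP[r0 rt]; rewrite tilt_moment ?(le_trans r0 rt)//.
have -> : (N - n)%:R * logK q -
     beta * lambda / (alpha - q) * (t - r) * \sum_(n <= j < N) b ^+ j =
   \sum_(n <= j < N) (logK q - beta * lambda / (alpha - q) * (t * b ^+ j - r * b ^+ j)).
  rewrite big_split/= sumr_const_nat mulr_natl; congr (_ + _).
  rewrite mulr_sumr -sumrN; apply: eq_bigr => j _; ring.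
apply: prod_ge_expR => j _; apply: (OU_log_moment2_ge) => //.
have bj : 0 <= b ^+ j by rewrite exprn_ge0// ltW// (lt_trans ltr01 b1).
by rewrite mulr_ge0//= ler_wpM2r.
Qed.

Lemma log_field_tilt_le n N q r t : 0 < q <= 1 -> 0 <= r <= t ->
  (expectation P (fun w => expR ((q - 1) * Y n N r w + Y n N t w))%R <=
   (expR ((N - n)%:R * logK q +
     beta * lambda / (alpha - 1) * (t - r) * \sum_(n <= j < N) b ^+ j))%:E)%E.
Proof.
move=> qa /andP[r0 rt]; rewrite tilt_moment ?(le_trans r0 rt)//.
have -> : (N - n)%:R * logK q +
     beta * lambda / (alpha - 1) * (t - r) * \sum_(n <= j < N) b ^+ j =
   \sum_(n <= j < N) (logK q + beta * lambda / (alpha - 1) * (t * b ^+ j - r * b ^+ j)).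
  rewrite big_split/= sumr_const_nat mulr_natl; congr (_ + _).
  rewrite mulr_sumr; apply: eq_bigr => j _; ring.
apply: prod_le_expR => j _; rewrite OU_log_moment_ge0/=.
apply: (OU_log_moment2_le) => //.
have bj : 0 <= b ^+ j by rewrite exprn_ge0// ltW// (lt_trans ltr01 b1).
by rewrite mulr_ge0//= ler_wpM2r.
Qed.

Lemma sum_geometric_le (n : nat) : \sum_(0 <= j < n) b ^+ j <= b ^+ n / (b - 1).
Proof.
have bm : 0 < b - 1 by rewrite subr_gt0.
rewrite ler_pdivlMr// mulrC.
have -> : (b - 1) * \sum_(0 <= j < n) b ^+ j = b ^+ n - 1.
  rewrite big_mkord -subrX1//.
by rewrite gerBl.
Qed.

(* Clipping the time at [0] makes the density jointly measurable on the whole plane: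
   nothing is assumed on the copies at negative times. *)
Definition density (n : nat) (s : R) (w : T) : R := expR (Y 0 n (Num.max 0 s) w).

Lemma density_ge0 n s w : 0 <= density n s w. Proof. exact: expR_ge0. Qed.

Lemma densityE n s w : 0 <= s -> density n s w = expR (Y 0 n s w).
Proof. by move=> s0; rewrite /density max_r. Qed.

Lemma measurable_dilation j : measurable_fun [set: R * T]
  (fun p => Lam j (Num.max 0 p.1 * b ^+ j) p.2).
Proof.
pose g (p : R * T) := (Num.max 0 p.1 * b ^+ j, p.2).
have mg : measurable_fun [set: R * T] g.
  apply: measurable_fun_pair => //; apply: measurable_funM => //.
  exact: measurable_maxr.
have mD : measurable ([set p | 0 <= p.1] : set (R * T)).
  rewrite (_ : [set p | _] = [set` `[0, +oo[] `*` setT).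
    exact: measurableX.
  by apply/seteqP; split => p /=; rewrite in_itv/= andbT// => -[].
have gD : g @` setT `<=` [set p : R * T | 0 <= p.1].
  move=> _ [p _ <-] /=.
  by rewrite mulr_ge0 ?exprn_ge0 ?(ltW b0)// le_max lexx.
exact: (measurable_comp (f := fun p : R * T => Lam j p.1 p.2) mD gD (hmeas j) mg).
Qed.

Lemma measurable_density n :
  measurable_fun [set: R * T] (fun p => density n p.1 p.2).
Proof.
apply: measurableT_comp => //; apply: measurable_sum => j.
apply: measurableT_comp; first exact: measurable_ln.
exact: measurable_dilation.
Qed.

Lemma measurable_density_at n s : mf (density n s).
Proof. exact: (measurable_process_at (U := density n) (measurable_density n)). Qed.

Lemma lognu1 : logK 1 = 0. Proof. by rewrite /lognu mulr1 subrr. Qed.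

Lemma expectation_density n s : expectation P (density n s) = 1%E.
Proof.
have s0 : 0 <= Num.max 0 s by rewrite le_max lexx.
have := log_field_power_moment 0 n s0 a1.
rewrite lognu1 mulr0 expR0 => <-; congr expectation; apply/funext => w.
by rewrite mul1r.
Qed.

(** * Masses of intervals and their second moments *)

Definition mass_ereal (n : nat) (t : R) (w : T) : \bar R :=
  (\int[leb]_(s in `[0%R, t]) (density n s w)%:E)%E.

(** For [t >= 0] it agrees almost surely with [mass_ereal], whose mean is [t]. The index counts
    levels: [mass n] uses the levels below [n]. *)
Definition mass n t w : R := fine (mass_ereal n t w).

Lemma mass_ereal_ge0 n t w : (0 <= mass_ereal n t w)%E.
Proof. by apply: integral_ge0 => s _; rewrite lee_fin density_ge0. Qed.

Lemma measurable_mass_ereal n t : measurable_fun setT (mass_ereal n t).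
Proof.
by apply: (measurable_process_integral (U := density n)) => //;
  [exact: measurable_density|exact: density_ge0].
Qed.

Lemma mass_ge0 n t w : 0 <= mass n t w.
Proof. by rewrite fine_ge0// mass_ereal_ge0. Qed.

Lemma measurable_mass n t : mf (mass n t).
Proof. by apply: measurableT_comp => //; exact: measurable_mass_ereal. Qed.

Lemma integral_mass_ereal n t : 0 <= t -> (\int[P]_w mass_ereal n t w = t%:E)%E.
Proof.
move=> t0; rewrite (process_tonelli P (measurable_density n) (density_ge0 n))//.
rewrite -(integral_itv_cst1 t0); apply: eq_integral => s _.
exact: expectation_density.
Qed.

Lemma mass_ereal_fin n t : 0 <= t ->
  {ae P, forall w, mass_ereal n t w = (mass n t w)%:E}.
Proof.
move=> t0; have : P.-integrable setT (mass_ereal n t).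
  apply/integrableP; split; first exact: measurable_mass_ereal.
  under eq_integral do rewrite gee0_abs ?mass_ereal_ge0//.
  by rewrite integral_mass_ereal// ltry.
move=> /(integrable_ae measurableT); apply: filterS => w /(_ Logic.I) fw.
by rewrite /mass fineK.
Qed.

Lemma expectation_mass n t : 0 <= t -> expectation P (mass n t) = t%:E.
Proof.
move=> t0; rewrite -(integral_mass_ereal n t0) unlock.
apply: ae_eq_integral => //.
- by apply/measurable_EFinP; exact: measurable_mass.
- exact: measurable_mass_ereal.
- by apply: filterS (mass_ereal_fin n t0) => w ->.
Qed.

(** The additional levels at [v] are independent of both lower densities and have mean 1. *)
Lemma expectation_densityM n N u v : (n <= N)%N ->
  expectation P (fun w => density n u w * density N v w) =
  expectation P (fun w => density n u w * density n v w).
Proof.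
move=> nN; set s := Num.max 0 v; have s0 : 0 <= s by rewrite le_max lexx.
have r0 : 0 <= Num.max 0 u by rewrite le_max lexx.
pose f w := density n u w * density n v w; pose g w := expR (Y n N s w).
have fS : measurable_fun [set: g_sigma_algebraType (block_sigma [set k | (k < n)%N])]
    (f : g_sigma_algebraType (block_sigma [set k | (k < n)%N]) -> R).
  apply: measurable_funM; apply: measurableT_comp => //;
    by apply: log_field_block => // j /andP[].
have gS : measurable_fun [set: g_sigma_algebraType (block_sigma [set k | (n <= k)%N])]
    (g : g_sigma_algebraType (block_sigma [set k | (n <= k)%N]) -> R).
  by apply: measurableT_comp => //; apply: log_field_block => // j /andP[].
have mf_ : mf f by apply: measurable_funM; exact: measurable_density_at.
have mg : mf g by apply: measurableT_comp => //; exact: measurable_log_field.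
have f0 w : 0 <= f w by rewrite mulr_ge0 ?density_ge0.
have := expectation_blockM fS gS mf_ mg f0 (fun w => expR_ge0 _).
have -> : expectation P g = 1%E.
  have := log_field_power_moment n N s0 a1.
  rewrite lognu1 mulr0 expR0 => <-; congr expectation; apply/funext => w.
  by rewrite mul1r.
rewrite mule1 => <-; congr expectation; apply/funext => w.
rewrite /f /g -mulrA; congr (_ * _); rewrite /density -expRD; congr expR.
by rewrite /log_field -/s -big_cat_nat.
Qed.

Definition mass_energy (n : nat) (t : R) : \bar R :=
  (\int[leb]_(u in `[0%R, t]) \int[leb]_(v in `[0%R, t])
     expectation P (fun w => density n u w * density n v w)%R)%E.

Lemma expectation_density_mass n N u t : 0 <= t -> (n <= N)%N ->
  (expectation P (fun w => density n u w * mass N t w)%R =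
   \int[leb]_(v in `[0%R, t])
     expectation P (fun w => density n u w * density n v w)%R)%E.
Proof.
move=> t0 nN.
have mdd : measurable_fun [set: R * T] (fun p => density n u p.2 * density N p.1 p.2).
  apply: measurable_funM; last exact: measurable_density.
  by apply: (measurableT_comp (f := density n u)) => //; exact: measurable_density_at.
have dd0 v w : 0 <= density n u w * density N v w by rewrite mulr_ge0 ?density_ge0.
transitivity (\int[P]_w \int[leb]_(v in `[0%R, t]) (density n u w * density N v w)%:E)%E.
  rewrite unlock; apply: ae_eq_integral => //.
  - apply/measurable_EFinP; apply: measurable_funM; last exact: measurable_mass.
    exact: measurable_density_at.
  - exact: (measurable_process_integral (U := fun v w => density n u w * density N v w)).
  - apply: filterS (mass_ereal_fin N t0) => w fw _.
    under eq_integral do rewrite EFinM.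
    rewrite ge0_integralZl_EFin//=.
    + by rewrite -/(mass_ereal N t w) fw EFinM.
    + by move=> v _; rewrite lee_fin density_ge0.
    + apply/measurable_EFinP; apply: measurable_funTS.
      exact: (measurable_process_path (U := density N) (measurable_density N)).
    + exact: density_ge0.
rewrite (process_tonelli (U := fun v w => density n u w * density N v w) P mdd dd0
  (measurable_itv `[0%R, t])).
by apply: eq_integral => v _; exact: expectation_densityM.
Qed.

Lemma expectation_massM n N t : 0 <= t -> (n <= N)%N ->
  expectation P (fun w => mass n t w * mass N t w) = mass_energy n t.
Proof.
move=> t0 nN.
have mdM : measurable_fun [set: R * T] (fun p => density n p.1 p.2 * mass N t p.2).
  apply: measurable_funM; first exact: measurable_density.
  by apply: (measurableT_comp (f := mass N t)) => //; exact: measurable_mass.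
have dM0 u w : 0 <= density n u w * mass N t w by rewrite mulr_ge0 ?density_ge0 ?mass_ge0.
transitivity (\int[P]_w \int[leb]_(u in `[0%R, t]) (density n u w * mass N t w)%:E)%E.
  rewrite unlock; apply: ae_eq_integral => //.
  - by apply/measurable_EFinP; apply: measurable_funM; exact: measurable_mass.
  - exact: (measurable_process_integral (U := fun u w => density n u w * mass N t w)).
  - apply: filterS (mass_ereal_fin n t0) => w fw _.
    under eq_integral do rewrite EFinM.
    rewrite ge0_integralZr//=.
    + by rewrite -/(mass_ereal n t w) fw EFinM.
    + apply/measurable_EFinP; apply: measurable_funTS.
      exact: (measurable_process_path (U := density n) (measurable_density n)).
    + by move=> u _; rewrite lee_fin density_ge0.
    + by rewrite lee_fin mass_ge0.
rewrite (process_tonelli (U := fun u w => density n u w * mass N t w) P mdM dM0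
  (measurable_itv `[0%R, t])).
apply: eq_integral => u _.
exact: expectation_density_mass.
Qed.

Let md n s : mf (density n s).
Proof. exact: measurable_density_at. Qed.
Let mm n t : mf (mass n t). Proof. exact: measurable_mass. Qed.

(** The first factor is the second moment of the density. The second bounds the relative loss in the
    mixed moment per unit of time, from [log_field_tilt_ge] at [q = 2] and the geometric sum of the
    dilations. *)
Definition modulus_cst (n : nat) : R :=
  expR (n%:R * logK 2) * (beta * lambda / (alpha - 2) * (b ^+ n / (b - 1))).

Lemma modulus_cst_ge0 n : 0 <= modulus_cst n.
Proof.
have h1 : 0 <= alpha - 2 by rewrite subr_ge0 ltW.
have h2 : 0 <= beta * lambda by rewrite mulr_ge0 ?(ltW hbeta) ?(ltW hlambda).
have h3 : 0 <= b ^+ n by rewrite exprn_ge0 ?(ltW b0).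
by rewrite mulr_ge0 ?expR_ge0// mulr_ge0 ?divr_ge0 ?(ltW bm1).
Qed.

Lemma density_L2_modulus n s t : 0 <= s <= t ->
  (expectation P (fun w => (density n t w - density n s w) ^+ 2)%R <=
   (2 * modulus_cst n * (t - s))%:E)%E.
Proof.
move=> st; have /andP[s0 s_t] := st; have t0 := le_trans s0 s_t.
pose K := expR (n%:R * logK 2).
have Esq u : 0 <= u -> expectation P (fun w => density n u w ^+ 2) = K%:E.
  move=> u0; have := log_field_power_moment 0 n u0 a2.
  rewrite subn0 => <-; congr expectation; apply/funext => w.
  by rewrite densityE// expr2 -expRD; congr expR; ring.
pose k := beta * lambda / (alpha - 2) * (t - s) * \sum_(0 <= j < n) b ^+ j.
have Exy : ((K * (1 - k))%:E <= expectation P (fun w => density n s w * density n t w)%R)%E.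
  have q2 : 1 <= (2 : R) < alpha by rewrite ler1n a2.
  have := log_field_tilt_ge 0 n q2 st.
  rewrite subn0 -/k => h; apply: (@le_trans _ _ (expR (n%:R * logK 2 - k))%:E).
    by rewrite lee_fin expRD -/K ler_pM2l ?expR_gt0// expR_ge1Dx.
  apply: (le_trans h); rewrite le_eqVlt; apply/orP; left; apply/eqP.
  congr expectation; apply/funext => w.
  by rewrite !densityE// -expRD; congr expR; ring.
have mD : mf (fun w => (density n t w - density n s w) ^+ 2).
  by apply: measurable_funX; exact: measurable_funB.
have mM : mf (fun w => 2 * (density n s w * density n t w)).
  by apply: measurable_funM => //; exact: measurable_funM.
have M0 w : 0 <= 2 * (density n s w * density n t w).
  by rewrite !mulr_ge0 ?density_ge0.
have sum : (expectation P (fun w => (density n t w - density n s w) ^+ 2)%R +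
    expectation P (fun w => 2 * (density n s w * density n t w))%R = (K + K)%:E)%E.
  rewrite -(expectation_add P mD mM (fun w => sqr_ge0 _) M0).
  rewrite EFinD -{1}(Esq t t0) -(Esq s s0).
  have mS u : mf (fun w => density n u w ^+ 2) by exact: measurable_funX.
  rewrite -(expectation_add P (mS t) (mS s) (fun w => sqr_ge0 _) (fun w => sqr_ge0 _)).
  by congr expectation; apply/funext => w; ring.
have mM' : mf (fun w => density n s w * density n t w) by exact: measurable_funM.
have M0' w : 0 <= density n s w * density n t w by rewrite mulr_ge0 ?density_ge0.
move: sum; rewrite (expectation_scale P (ler0n R 2) mM' M0').
set p := expectation P _; set r := expectation P _ in Exy * => sum.
have kb : k <= beta * lambda / (alpha - 2) * (b ^+ n / (b - 1)) * (t - s).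
  rewrite /k mulrAC ler_wpM2r ?subr_ge0//.
  have c0 : 0 <= beta * lambda / (alpha - 2).
    by rewrite divr_ge0 ?mulr_ge0 ?(ltW hbeta) ?(ltW hlambda) ?subr_ge0 ?(ltW a2).
  by rewrite ler_wpM2l// sum_geometric_le.
have h1 : (p + (2 * (K * (1 - k)))%:E <= (K + K)%:E)%E.
  by rewrite -sum EFinM leeD2l// lee_pmul2l.
move: h1; rewrite -leeBrDr//; move=> /le_trans; apply.
rewrite -EFinB lee_fin /modulus_cst -/K.
have := ler_wpM2l (expR_ge0 (n%:R * logK 2)) kb; rewrite -/K.
by set A := beta * lambda / _ * _; nra.
Qed.

Lemma density_L1_modulus n s t (eta : R) : 0 <= s <= t -> 0 < eta ->
  (expectation P (fun w => `|density n t w - density n s w|)%R <=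
   (eta / 2 + modulus_cst n * (t - s) / eta)%:E)%E.
Proof.
move=> st eta0; have mB : mf (fun w => density n t w - density n s w).
  exact: measurable_funB.
apply: (le_trans (expectation_norm_le P eta0 mB)).
rewrite EFinD leeD2l//.
have e2 : (0 <= ((2 * eta)^-1)%:E)%E by rewrite lee_fin invr_ge0 mulr_ge0// ltW.
apply: (le_trans (lee_wpmul2l e2 (density_L2_modulus n st))).
rewrite -EFinM lee_fin le_eqVlt; apply/orP; left; apply/eqP.
by field; rewrite gt_eqF.
Qed.

(** The error is at most the sum over the cells of the mean deviation from the left endpoint, which
    the L^1 modulus bounds by [e / 2 + C * delta / e] per unit of time. *)
Lemma mass_riemann n t (e : R) : 0 <= t <= 1 -> 0 < e -> exists M0 : nat,
  forall M, (M0 <= M)%N -> (0 < M)%N ->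
  (expectation P (fun w => `|mass n t w - t * avg 0 n M t w|)%R <= e%:E)%E.
Proof.
move=> /andP[t0 t1] e0.
have [C C0 HC] : exists2 C : R, 0 <= C & forall s t', 0 <= s <= t' ->
    (expectation P (fun w => `|density n t' w - density n s w|)%R <=
     (e / 2 + C * (t' - s) / e)%:E)%E.
  exists (modulus_cst n); first exact: modulus_cst_ge0.
  by move=> s t' st; exact: density_L1_modulus.
(* This many cells give [C / M <= e ^+ 2 / 2], so the second half of the modulus is at most
   [e / 2]. *)
exists (Num.bound (2 * C / e ^+ 2)) => M MM M0.
have MR : 0 < M%:R :> R by rewrite ltr0n.
have CM : C / M%:R <= e ^+ 2 / 2.
  have : 2 * C / e ^+ 2 <= M%:R.
    apply: (@le_trans _ _ (Num.bound (2 * C / e ^+ 2))%:R); last by rewrite ler_nat.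
    by apply/ltW/archi_boundP; rewrite divr_ge0 ?mulr_ge0 ?exprn_ge0 ?(ltW e0).
  by rewrite ler_pdivrMr ?exprn_gt0// ler_pdivrMr//; lra.
pose delta := t / M%:R; have dl0 : 0 <= delta by rewrite divr_ge0// ltW.
have Md : M%:R * delta = t by rewrite mulrC divfK// gt_eqF.
pose U i s w := `|density n s w - density n (i%:R * delta) w|.
have mU i : measurable_fun [set: R * T] (fun p => U i p.1 p.2).
  apply: measurableT_comp; first exact: normr_measurable.
  apply: measurable_funB; first exact: measurable_density.
  by apply: (measurableT_comp (f := density n (i%:R * delta))) => //; exact: md.
have U0 i s w : 0 <= U i s w by exact: normr_ge0.
pose G i w := (\int[leb]_(s in `[(i%:R * delta)%R, (i.+1%:R * delta)%R[) (U i s w)%:E)%E.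
have mG i : measurable_fun setT (G i).
  exact: (measurable_process_integral (mU i)).
have G0 i w : (0 <= G i w)%E by apply: integral_ge0 => s _; rewrite lee_fin U0.
have GE i : (\int[P]_w G i w <= (delta * (e / 2 + C * delta / e))%:E)%E.
  rewrite /G (process_tonelli P (mU i) (U0 i))//.
  have id0 : 0 <= i%:R * delta by rewrite mulr_ge0.
  have ii : i%:R * delta <= i.+1%:R * delta by rewrite ler_wpM2r// ler_nat.
  have ce0 : 0 <= C * delta / e by rewrite divr_ge0 ?mulr_ge0 ?(ltW e0).
  apply: (@le_trans _ _ (\int[leb]_(s in `[(i%:R * delta)%R, (i.+1%:R * delta)%R[)
      (cst (e / 2 + C * delta / e)%:E) s)%E).
    apply: ge0_le_integral => //=.
    - by move=> s _; apply: expectation_ge0 => w; exact: U0.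
    - apply: measurable_funTS; exact: (measurable_process_expectation P (mU i) (U0 i)).
    - move=> s; rewrite in_itv/= => /andP[is_ si].
      have st : 0 <= i%:R * delta <= s by rewrite id0 is_.
      apply: (le_trans (HC _ _ st)).
      rewrite lee_fin lerD2l ler_pM2r ?invr_gt0// ler_wpM2l//.
      by move: si; rewrite -natr1 mulrDl mul1r; lra.
  rewrite integral_itvco_cst// lee_fin le_eqVlt; apply/orP; left; apply/eqP.
  by rewrite -natr1; ring.
have mS : mf (fun w => `|mass n t w - t * avg 0 n M t w|).
  apply: measurable_dist => //; apply: measurable_funM => //.
  exact: measurable_block_avg.
rewrite unlock; apply: (@le_trans _ _ (\int[P]_w \sum_(0 <= i < M) G i w)%E).
  have h1 w : setT w -> (0 <= (`|mass n t w - t * avg 0 n M t w|)%:E)%E.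
    by move=> _; rewrite lee_fin.
  have h2 w : setT w -> (0 <= \sum_(0 <= i < M) G i w)%E.
    by move=> _; apply: sume_ge0 => i _; exact: G0.
  have mSE : measurable_fun setT (fun w => (`|mass n t w - t * avg 0 n M t w|)%:E).
    exact/measurable_EFinP.
  have mGE : measurable_fun setT (fun w => \sum_(0 <= i < M) G i w)%E.
    exact: emeasurable_sum.
  apply: (ae_ge0_le_integral measurableT h1 mSE h2 mGE).
  apply: filterS (mass_ereal_fin n t0) => w fw _.
  have mh : measurable_fun setT (density n ^~ w).
    exact: (measurable_process_path (U := density n) (measurable_density n)).
  have h0 s : 0 <= density n s w by exact: density_ge0.
  have Eo : (\int[leb]_(s in `[0%R, (M%:R * delta)%R[) (density n s w)%:E =
      mass_ereal n t w)%E.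
    rewrite Md integral_itv_bndo_bndc//; apply/measurable_EFinP.
    exact: measurable_funTS.
  have := @riemann_sum_error _ _ delta M mh h0 dl0; rewrite Eo => h.
  apply: le_trans (h _); last by rewrite fw ltry.
  rewrite lee_fin le_eqVlt; apply/orP; left; apply/eqP; congr (`|_ - _|).
  rewrite /block_avg mulrA -/delta; congr (_ * _); apply: eq_bigr => i _.
  by rewrite densityE// mulr_ge0.
rewrite ge0_integral_sum//.
apply: (@le_trans _ _ (\sum_(0 <= i < M) (delta * (e / 2 + C * delta / e))%:E)%E).
  by apply: lee_sum => i _; exact: GE.
rewrite sumEFin lee_fin sumr_const_nat subn0 -[leLHS]mulr_natl mulrA Md.
have h : C * delta / e <= e / 2.
  rewrite ler_pdivrMr//; apply: (@le_trans _ _ (C / M%:R)).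
    by rewrite /delta mulrA ler_pM2r ?invr_gt0// ler_piMr.
  by move: CM; rewrite expr2; lra.
have h' : 0 <= C * delta / e by rewrite divr_ge0 ?mulr_ge0 ?(ltW e0).
apply: (@le_trans _ _ (1 * (e / 2 + C * delta / e))); last by lra.
by rewrite ler_wpM2r// addr_ge0// divr_ge0// ltW.
Qed.

Local Notation C := block_avg_cst.

Lemma block_avg0_moment n M t : 0 <= t <= 1 -> (0 < M)%N ->
  expR (theta * n%:R) <= M%:R ->
  (expectation P (fun w => (t * avg 0 n M t w) ^+ m)%R <= C%:E)%E.
Proof.
move=> /andP[t0 t1] M0 MN.
have tb : t * b ^+ 0 <= 1 by rewrite expr0 mulr1.
have MN' : expR (theta * (n - 0)%:R) <= M%:R by rewrite subn0.
have := block_avg_moment t0 tb M0 MN'.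
rewrite expr0 mulr1 => h.
have ma_ : mf (fun w => avg 0 n M t w ^+ m).
  by apply: measurable_funX; exact: measurable_block_avg.
have a0 w : 0 <= avg 0 n M t w ^+ m by rewrite exprn_ge0// block_avg_ge0.
have -> : expectation P (fun w => (t * avg 0 n M t w) ^+ m) =
    ((t ^+ m)%:E * expectation P (fun w => avg 0 n M t w ^+ m)%R)%E.
  rewrite -(expectation_scale P (exprn_ge0 m t0) ma_ a0).
  by congr expectation; apply/funext => w; rewrite exprMn.
rewrite -[in t ^+ m](prednK m0) exprS EFinM -muleA.
apply: (le_trans (lee_wpmul2l _ h)); first by rewrite lee_fin.
rewrite -EFinM lee_fin ler_piMl//.
exact: (block_avg_cst_ge0).
Qed.

Lemma mass_moment n t : 0 <= t <= 1 ->
  (expectation P (fun w => mass n t w ^+ m)%R <= (2 ^+ m * C)%:E)%E.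
Proof.
move=> t01; have /andP[t0 t1] := t01.
apply: (moment_of_limit m0 (mm n t)) => [w|e e0]; first exact: mass_ge0.
have [M0 M0P] := mass_riemann n t01 e0.
(* Two demands on the grid: closeness to the mass in L^1, and the fineness under which coinciding
   times are harmless in the moment bound. *)
pose M := (maxn M0 (Num.bound (expR (theta * n%:R)))).+1.
have MN : expR (theta * n%:R) <= M%:R.
  apply: (@le_trans _ _ (Num.bound (expR (theta * n%:R)))%:R).
    by apply/ltW/archi_boundP; exact: expR_ge0.
  by rewrite ler_nat /M leqW// leq_maxr.
exists (fun w => t * avg 0 n M t w); split.
- by apply: measurable_funM => //; exact: measurable_block_avg.
- by move=> w; rewrite mulr_ge0// block_avg_ge0.
- by apply: M0P => //; rewrite /M leqW// leq_maxl.
- exact: block_avg0_moment.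
Qed.

Lemma mass_energy_le n t : 0 <= t <= 1 ->
  (mass_energy n t <= (1 + 2 ^+ m * C)%:E)%E.
Proof.
move=> t01; have /andP[t0 t1] := t01.
rewrite -(expectation_massM t0 (leqnn n)).
have mx : mf (fun w => mass n t w ^+ m) by exact: measurable_funX.
have x0 w : 0 <= mass n t w ^+ m by rewrite exprn_ge0// mass_ge0.
apply: (@le_trans _ _ (expectation P (fun w => 1 + mass n t w ^+ m))).
  apply: expectation_mono.
  - exact: measurable_funM.
  - exact: measurable_funD.
  - by move=> w; rewrite mulr_ge0 ?mass_ge0.
  - move=> w; set x := mass n t w; have xx0 : 0 <= x by exact: mass_ge0.
    have [x1|x1] := leP x 1.
      have : x * x <= 1 by rewrite mulr_ile1.
      by have := x0 w; rewrite -/x; lra.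
    rewrite -expr2; have : x ^+ 2 <= x ^+ m by rewrite ler_weXn2l// ltW.
    by lra.
rewrite expectation_const_add// EFinD leeD2l//.
exact: mass_moment.
Qed.

Lemma mass_energy_real t : 0 <= t <= 1 ->
  exists v : nat -> R, forall n, mass_energy n t = (v n)%:E.
Proof.
move=> t01; exists (fun n => fine (mass_energy n t)) => n; move: (mass_energy_le n t01).
have : (0 <= mass_energy n t)%E.
  by apply: integral_ge0 => u _; apply: integral_ge0 => v _; apply: expectation_ge0 => w;
    rewrite mulr_ge0// density_ge0.
move: (mass_energy n t) => x x0 xC.
by rewrite fineK// ge0_fin_numE// (le_lt_trans xC) ?ltry.
Qed.

Lemma mass_L2_dist n N t (vN vn : R) : 0 <= t -> (n <= N)%N ->
  mass_energy N t = vN%:E -> mass_energy n t = vn%:E ->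
  expectation P (fun w => (mass N t w - mass n t w) ^+ 2) = (vN - vn)%:E.
Proof.
move=> t0 nN eN en.
have EM := expectation_massM t0.
apply: expectation_sqr_dist; [exact: mm|exact: mm|exact: mass_ge0|exact: mass_ge0|..].
- exact: etrans (EM N N (leqnn N)) eN.
- exact: etrans (EM n n (leqnn n)) en.
- exact: etrans (EM n N nN) en.
Qed.

(** By orthogonality of increments the squared distance is a difference of energies, which form a
    nondecreasing sequence bounded through the moments of order [m]. *)
Lemma mass_cauchy t e : 0 <= t <= 1 -> 0 < e -> exists n0, forall n N,
  (n0 <= n)%N -> (n <= N)%N ->
  (expectation P (fun w => (mass N t w - mass n t w) ^+ 2)%R <= e%:E)%E.
Proof.
move=> t01 e0; have /andP[t0 t1] := t01; have [v vE] := mass_energy_real t01.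
have L2 n N : (n <= N)%N ->
    expectation P (fun w => (mass N t w - mass n t w) ^+ 2) = (v N - v n)%:E.
  by move=> nN; exact: mass_L2_dist t0 nN (vE N) (vE n).
have vC n : ((v n)%:E <= (1 + 2 ^+ m * C)%:E)%E.
  by apply: le_trans (mass_energy_le n t01); rewrite vE.
have vnd : nondecreasing_seq v.
  move=> n N nN; rewrite -subr_ge0 -lee_fin -(L2 n N nN).
  by apply: expectation_ge0 => w; exact: sqr_ge0.
have vub : has_ubound (range v).
  by exists (1 + 2 ^+ m * C) => _ [n _ <-]; rewrite -lee_fin.
have cv := nondecreasing_is_cvgn vnd vub.
have [n0 _ n0P] : \forall n \near \oo, limn v - v n < e.
  have /cvgrPdist_lt/(_ e e0) := cv.
  by apply: filterS => n /(le_lt_trans (ler_norm _)).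
exists n0 => n N n0n nN; rewrite (L2 n N nN) lee_fin.
have := n0P n n0n; rewrite /=.
by have := nondecreasing_cvgn_le vnd cv N; lra.
Qed.

(** * The limit: convergence, moments and energy *)

Lemma mass_limit t : 0 <= t <= 1 -> exists A : T -> R,
  [/\ mf A, (forall w, 0 <= A w) & forall e, 0 < e -> exists n0, forall n,
     (n0 <= n)%N -> (expectation P (fun w => (A w - mass n t w) ^+ 2)%R <= e%:E)%E].
Proof.
move=> t01; apply: L2_complete => [n|n w|e e0].
- exact: mm.
- exact: mass_ge0.
- exact: mass_cauchy.
Qed.

Section limit_properties.
Variables (t : R) (A : T -> R).
Hypotheses (t01 : 0 <= t <= 1) (mA : mf A) (A0 : forall w, 0 <= A w).
Hypothesis LA : forall e, 0 < e -> exists n0, forall n, (n0 <= n)%N ->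
  (expectation P (fun w => (A w - mass n t w) ^+ 2)%R <= e%:E)%E.

Lemma limit_L1 e : 0 < e -> exists n0, forall n, (n0 <= n)%N ->
  (expectation P (fun w => `|A w - mass n t w|)%R <= e%:E)%E.
Proof.
move=> e0; have [n0 n0P] := LA (exprn_gt0 2 e0).
exists n0 => n n0n; have mB : mf (fun w => A w - mass n t w) by exact: measurable_funB.
apply: (le_trans (expectation_norm_le P e0 mB)).
apply: (@le_trans _ _ ((e / 2)%:E + (2 * e)^-1%:E * (e ^+ 2)%:E)%E).
  rewrite leeD2l// lee_wpmul2l//; last exact: n0P.
  by rewrite lee_fin invr_ge0 mulr_ge0// ltW.
rewrite -EFinM -EFinD lee_fin le_eqVlt; apply/orP; left; apply/eqP.
by field; rewrite gt_eqF.
Qed.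

Lemma limit_moment : (expectation P (fun w => A w ^+ m)%R <= (2 ^+ m * (2 ^+ m * C))%:E)%E.
Proof.
apply: (moment_of_limit m0 mA A0) => e e0; have [n n0P] := limit_L1 e0.
exists (mass n t); split => //.
- by move=> w; exact: mass_ge0.
- exact: n0P.
- exact: mass_moment.
Qed.

Lemma mass_Lq_cvg q e : 0 < q < m%:R -> 0 < e -> exists n0, forall n, (n0 <= n)%N ->
  (expectation P (fun w => `|mass n t w - A w| `^ q)%R <= e%:E)%E.
Proof.
move=> qm e0; have C0 : 0 <= C by apply: (block_avg_cst_ge0).
pose B := 2 ^+ m * (2 ^+ m * (2 ^+ m * C) + 2 ^+ m * C).
have p2m : (0 : R) <= 2 ^+ m by rewrite exprn_ge0.
have B0 : 0 <= B.
  by rewrite /B; move: C0; generalize C => C' C0; rewrite mulr_ge0// addr_ge0 ?mulr_ge0.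
have [eta eta0 small] := Lq_small P qm B0 e0.
have [n0 n0P] := limit_L1 eta0; exists n0 => n n0n.
apply: small.
- exact: measurable_dist.
- by move=> w; exact: normr_ge0.
- under eq_fun do rewrite distrC; apply: expectation_dist_expr_le => //.
  + by move=> w; exact: mass_ge0.
  + exact: limit_moment.
  + exact: mass_moment.
- by under eq_fun do rewrite distrC; exact: n0P.
Qed.

Lemma limit_expectation : expectation P A = t%:E.
Proof.
have /andP[t0 t1] := t01.
have EM n := expectation_mass n t0.
apply/eqP; rewrite eq_le; apply/andP; split; apply/lee_addgt0Pr => e e0;
  have [n n0P] := limit_L1 e0; have := n0P n (leqnn n);
  have mS := measurable_dist mA (mm n t) => h.
- rewrite -(EM n).
  apply: (@le_trans _ _ (expectation P (fun w => mass n t w + `|A w - mass n t w|))).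
    apply: expectation_mono => //.
      exact: measurable_funD.
    by move=> w; have := ler_norm (A w - mass n t w); lra.
  rewrite (expectation_add P (mm n t) mS (mass_ge0 n t) (fun w => normr_ge0 _)).
  by rewrite leeD2l.
- rewrite -(EM n).
  apply: (@le_trans _ _ (expectation P (fun w => A w + `|A w - mass n t w|))).
    apply: expectation_mono => //.
    + exact: measurable_funD.
    + by move=> w; exact: mass_ge0.
    + by move=> w; have := ler_norm (mass n t w - A w); rewrite distrC; lra.
  rewrite (expectation_add P mA mS A0 (fun w => normr_ge0 _)).
  by rewrite leeD2l.
Qed.

(** Young's inequality [y ^ 2 <= (1 + k) * x ^ 2 + (1 + k^-1) * (x - y) ^ 2], used at a late index
    [N] since energies are nondecreasing. First [k] is taken small against the second moment of [A],
    then the L^2 error small against [k]. *)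
Lemma limit_energy n : (mass_energy n t <= expectation P (fun w => A w * A w)%R)%E.
Proof.
have /andP[t0 t1] := t01.
have EM := expectation_massM t0.
have key k e : 0 < e -> 0 < k -> (mass_energy n t <=
    (1 + k)%:E * expectation P (fun w => A w * A w)%R + (e * (1 + k^-1))%:E)%E.
  move=> e0 k0; have [n0 n0P] := LA e0; pose N := maxn n n0.
  have k1 : 0 <= 1 + k by rewrite addr_ge0// ltW.
  have k1' : 0 <= 1 + k^-1 by rewrite addr_ge0// invr_ge0 ltW.
  have nN : (mass_energy n t <= mass_energy N t)%E.
    have [v vE] := mass_energy_real t01.
    rewrite (vE n) (vE N) lee_fin -subr_ge0 -lee_fin.
    rewrite -(mass_L2_dist t0 (leq_maxl n n0) (vE N) (vE n)).
    by apply: expectation_ge0 => w; exact: sqr_ge0.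
  apply: (le_trans nN); rewrite -(EM N N (leqnn N)).
  have mAA : mf (fun w => A w * A w) by exact: measurable_funM.
  have AA0 w : 0 <= A w * A w by rewrite mulr_ge0.
  have mD : mf (fun w => (A w - mass N t w) ^+ 2).
    by apply: measurable_funX; exact: measurable_funB.
  apply: (@le_trans _ _ (expectation P (fun w => (1 + k) * (A w * A w) +
      (1 + k^-1) * (A w - mass N t w) ^+ 2))).
    apply: expectation_mono.
    - exact: measurable_funM.
    - by apply: measurable_funD; exact: measurable_funM.
    - by move=> w; rewrite mulr_ge0 ?mass_ge0.
    - move=> w; set x := A w; set y := mass N t w.
      have h := sqr_ge0 (k * x + (x - y)).
      have -> : (1 + k) * (x * x) + (1 + k^-1) * (x - y) ^+ 2 =
        y * y + k^-1 * (k * x + (x - y)) ^+ 2 by field; rewrite gt_eqF.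
      by rewrite lerDl mulr_ge0// invr_ge0 ltW.
  rewrite (expectation_add P (measurable_funM (measurable_cst _) mAA)
    (measurable_funM (measurable_cst _) mD)); last 2 first.
  - by move=> w; rewrite mulr_ge0.
  - by move=> w; rewrite mulr_ge0// sqr_ge0.
  rewrite (expectation_scale P k1 mAA AA0).
  rewrite (expectation_scale P k1' mD (fun w => sqr_ge0 _)).
  rewrite leeD2l// mulrC EFinM lee_wpmul2l//.
  by apply: n0P; exact: leq_maxr.
set EA := expectation P _ in key *.
have EA0 : (0 <= EA)%E by apply: expectation_ge0 => w; rewrite mulr_ge0.
have [->|EAfin] := eqVneq EA +oo%E; first exact: leey.
have {}EAfin : EA \is a fin_num by rewrite ge0_fin_numE// lt_neqAle EAfin leey.
apply/lee_addgt0Pr => r r0; pose x := fine EA.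
have x0 : 0 <= x by rewrite fine_ge0.
pose k := r / (2 * (x + 1)); have x1 : 0 < x + 1 by rewrite ltr_wpDl.
have k0 : 0 < k by rewrite divr_gt0// mulr_gt0.
have kk : 0 < 1 + k^-1 by rewrite ltr_wpDr// ltW// invr_gt0.
have e0 : 0 < r / (2 * (1 + k^-1)) by rewrite divr_gt0// mulr_gt0.
apply: (le_trans (key k _ e0 k0)); rewrite -(fineK EAfin) -/x -EFinM -EFinD lee_fin.
have -> : r / (2 * (1 + k^-1)) * (1 + k^-1) = r / 2.
  by field; rewrite !gt_eqF ?addr_gt0.
have : k * x <= r / 2.
  rewrite /k -mulrA (_ : r / 2 = r * ((2 * (x + 1))^-1 * (x + 1))); last first.
    by field; rewrite gt_eqF.
  rewrite ler_pM2l// ler_pM2l ?lerDl// invr_gt0 mulr_gt0//.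
by rewrite mulrDl mul1r; lra.
Qed.

End limit_properties.

(* At scale [t ~ b^-n] the levels below [n] (factors [f]) are almost constant on
   [0, t], and the levels from [n] on (factors [g]) form a cascade at scale 1. *)
Section fixed_block.
Variables (q t : R) (n N M : nat).
Hypotheses (qm : 0 < q < m%:R) (t0 : 0 <= t) (tb : b^-1 <= t * b ^+ n <= 1).
Hypotheses (nN : (n <= N)%N) (M0 : (0 < M)%N) (MN : expR (theta * N%:R) <= M%:R).

Let s (i : nat) : R := i%:R * (t / M%:R).
Let f i w := expR (Y 0 n (s i) w).
Let g i w := expR (Y n N (s i) w).
Let S w := M%:R^-1 * \sum_(0 <= i < M) f i w * g i w.
Let W w := M%:R^-1 * \sum_(0 <= i < M) g i w.
Let K := expR (n%:R * logK q).

Let MR : 0 < M%:R :> R. Proof. by rewrite ltr0n. Qed.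
Let qa : q < alpha. Proof. by have /andP[_ /lt_trans] := qm; exact. Qed.
Let s0 i : 0 <= s i. Proof. by rewrite mulr_ge0// divr_ge0. Qed.
Let st i : (i < M)%N -> s i <= t.
Proof.
move=> iM; rewrite /s mulrCA ler_piMr// ler_pdivrMr// mul1r ler_nat.
exact: ltnW.
Qed.
Let f0 i w : 0 < f i w. Proof. exact: expR_gt0. Qed.
Let g0 i w : 0 < g i w. Proof. exact: expR_gt0. Qed.
Let fg0 i w : 0 <= f i w * g i w.
Proof. by apply: mulr_ge0; exact: expR_ge0. Qed.
Let mf_ i : mf (f i).
Proof. by apply: measurableT_comp => //; exact: measurable_log_field. Qed.
Let mg i : mf (g i).
Proof. by apply: measurableT_comp => //; exact: measurable_log_field. Qed.
Let mW : mf W. Proof. exact: measurable_block_avg. Qed.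
Let W0 w : 0 <= W w. Proof. exact: block_avg_ge0. Qed.
Let S0 w : 0 <= S w.
Proof. by rewrite mulr_ge0 ?invr_ge0// sumr_ge0. Qed.
Let mS : mf S.
Proof. by apply: measurable_funM => //; apply: measurable_sum => i; exact: measurable_funM. Qed.

Let expR_powR (x p : R) : expR x `^ p = expR (p * x).
Proof. by rewrite /powR gt_eqF ?expR_gt0// expRK. Qed.

Let Ef i p : p < alpha -> expectation P (fun w => f i w `^ p) = (expR (n%:R * logK p))%:E.
Proof.
move=> pa; rewrite -[n in n%:R]subn0.
rewrite -(log_field_power_moment 0 n (s0 i) pa).
by congr expectation; apply/funext => w; rewrite expR_powR.
Qed.

Let Eg i : expectation P (g i) = 1%E.
Proof.
have := log_field_power_moment n N (s0 i) a1.
rewrite lognu1 mulr0 expR0 => <-; congr expectation; apply/funext => w.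
by rewrite mul1r.
Qed.

Let average_expectation (h : nat -> T -> R) : (forall i, mf (h i)) ->
  (forall i w, 0 <= h i w) ->
  expectation P (fun w => M%:R^-1 * \sum_(0 <= i < M) h i w) =
  ((M%:R^-1)%:E * \sum_(0 <= i < M) expectation P (h i))%E.
Proof.
move=> mh h0; rewrite -(expectation_bigsum P _ mh h0).
have Mi0 : 0 <= M%:R^-1 :> R by rewrite invr_ge0.
apply: (expectation_scale P Mi0); first exact: measurable_sum.
by move=> w; exact: sumr_ge0.
Qed.

Local Notation past := (block_sigma [set k | (k < n)%N]).
Local Notation future := (block_sigma [set k | (n <= k)%N]).
Local Notation past_measurable F := (measurable_fun [set: g_sigma_algebraType past]
  (F : g_sigma_algebraType past -> R)).
Local Notation future_measurable F := (measurable_fun [set: g_sigma_algebraType future]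
  (F : g_sigma_algebraType future -> R)).

Let past_Y u : 0 <= u -> past_measurable (Y 0 n u).
Proof. by move=> u0; apply: log_field_block => // j /andP[]. Qed.
Let future_g i : future_measurable (g i).
Proof.
by apply: measurableT_comp => //; apply: log_field_block => // j /andP[].
Qed.
Let future_W : future_measurable W.
Proof. by apply: measurable_funM => //; apply: measurable_sum => i; exact: future_g. Qed.

(** Each [f i] is independent of all the weights and has moment [K] of order [q], so [K] factors
    out; the weights that remain sum up to [W] and complete its power [q - 1] to [q]. *)
Let weighted_moment : expectation P (fun w =>
    W w `^ (q - 1) * (M%:R^-1 * \sum_(0 <= i < M) f i w `^ q * g i w)) =
  (K%:E * expectation P (fun w => W w `^ q)%R)%E.
Proof.
pose G i w := W w `^ (q - 1) * g i w.
have mWq : mf (fun w => W w `^ (q - 1)) by exact: measurable_powR_fun.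
have mG i : mf (G i) by exact: measurable_funM.
have G0 i w : 0 <= G i w by rewrite mulr_ge0 ?powR_ge0 ?(ltW (g0 _ _)).
have mfq i : mf (fun w => f i w `^ q) by exact: measurable_powR_fun.
have fq0 i w : 0 <= f i w `^ q by exact: powR_ge0.
have EfG i : expectation P (fun w => f i w `^ q * G i w) = (K%:E * expectation P (G i))%E.
  rewrite -(Ef i qa); apply: (expectation_blockM) => //.
    apply: measurable_powR_fun; apply: measurableT_comp => //; exact: past_Y.
  apply: measurable_funM => //; apply: measurable_powR_fun; exact: future_W.
transitivity (expectation P (fun w => M%:R^-1 * \sum_(0 <= i < M) f i w `^ q * G i w)).
  congr expectation; apply/funext => w; rewrite mulrCA; congr (_ * _).
  by rewrite mulr_sumr; apply: eq_bigr => i _; rewrite /G mulrCA.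
rewrite average_expectation//; last 2 first.
- by move=> i; exact: measurable_funM.
- by move=> i w; rewrite mulr_ge0.
under eq_bigr do rewrite EfG.
rewrite -ge0_sume_distrr; last by move=> i _; exact: expectation_ge0.
rewrite muleCA -average_expectation//; congr (_ * _)%E.
congr expectation; apply/funext => w.
rewrite -mulr_sumr mulrCA -/(W w) -powR_factor//.
rewrite mulr_gt0 ?invr_gt0//; case: (M) M0 => // k _.
by rewrite big_nat_recl// ltr_pwDl// sumr_ge0// => i _; exact: ltW.
Qed.

Let EW : expectation P W = 1%E.
Proof.
rewrite average_expectation//; last by move=> i w; exact: ltW.
under eq_bigr do rewrite Eg.
by rewrite sumEFin -EFinM sumr_const_nat subn0 mulVf// gt_eqF.
Qed.

(** The factor [b ^+ m.-1] comes from [t * b ^+ n >= b^-1]: the rescaled interval has length of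
    order 1. *)
Let EWm : (expectation P (fun w => W w ^+ m)%R <= (C * b ^+ m.-1)%:E)%E.
Proof.
have /andP[tb1 tb2] := tb.
have MN' : expR (theta * (N - n)%:R) <= M%:R.
  apply: le_trans MN; rewrite ler_expR ler_wpM2l ?ler_nat ?leq_subr//.
  by rewrite slope_ge0// ?ltr1n.
have h := block_avg_moment t0 tb2 M0 MN'.
have W0m w : 0 <= W w ^+ m by rewrite exprn_ge0.
have E0 : (0 <= expectation P (fun w => W w ^+ m)%R)%E by exact: expectation_ge0.
have bm0 : (0 < (b ^+ m.-1)%:E)%E by rewrite lte_fin exprn_gt0.
have {}h : ((b^-1 ^+ m.-1)%:E * expectation P (fun w => W w ^+ m)%R <= C%:E)%E.
  apply: le_trans h; apply: lee_wpmul2r => //; rewrite lee_fin.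
  by rewrite lerXn2r ?nnegrE ?mulr_ge0 ?invr_ge0 ?exprn_ge0 ?(ltW b0).
rewrite mulrC EFinM -(lee_pdivrMl _ _ _)// ?exprn_gt0//.
by rewrite -exprVn.
Qed.

Let tilt i w : f 0 w `^ (q - 1) * (f i w * g i w) =
  expR ((q - 1) * Y 0 n 0 w + Y 0 n (s i) w) * g i w.
Proof.
by rewrite mulrA /f expR_powR -expRD {1}/s mul0r.
Qed.

(** The weights [g i] have mean 1 and are independent of the past, so they drop out of a mean of [S]
    biased by a past variable. *)
Let tilted_average : expectation P (fun w => f 0 w `^ (q - 1) * S w) =
  ((M%:R^-1)%:E * \sum_(0 <= i < M)
    expectation P (fun w => expR ((q - 1) * Y 0 n 0 w + Y 0 n (s i) w))%R)%E.
Proof.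
pose h i w := expR ((q - 1) * Y 0 n 0 w + Y 0 n (s i) w).
have mh i : mf (h i).
  apply: measurableT_comp => //; apply: measurable_funD; last exact: measurable_log_field.
  by apply: measurable_funM => //; exact: measurable_log_field.
have h0 i w : 0 <= h i w by exact: expR_ge0.
transitivity (expectation P (fun w => M%:R^-1 * \sum_(0 <= i < M) h i w * g i w)).
  congr expectation; apply/funext => w; rewrite mulrCA; congr (_ * _).
  by rewrite mulr_sumr; apply: eq_bigr => i _; rewrite tilt.
rewrite average_expectation; last 2 first.
- by move=> i; exact: measurable_funM.
- by move=> i w; apply: mulr_ge0; exact: expR_ge0.
congr (_ * _)%E; apply: eq_bigr => i _.
rewrite -[RHS]mule1 -(Eg i); apply: (expectation_blockM) => //.
- apply: measurableT_comp => //; apply: measurable_funD; last exact: past_Y.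
  by apply: measurable_funM => //; exact: past_Y.
- by move=> w; exact: ltW.
Qed.

(** Near constancy of the past levels: their dilated gaps form a geometric sum dominated by the last
    one, which is at most of order [t * b ^+ n <= 1]. *)
Let gap_le k i : 0 <= k -> (i < M)%N ->
  k * (s i - 0) * \sum_(0 <= j < n) b ^+ j <= k / (b - 1).
Proof.
move=> k0 iM; have bm : 0 < b - 1 by rewrite subr_gt0.
rewrite subr0 -mulrA ler_wpM2l//.
have g1 := sum_geometric_le n.
have g2 : 0 <= \sum_(0 <= j < n) b ^+ j.
  by apply: sumr_ge0 => j _; rewrite exprn_ge0 ?(ltW b0).
apply: (@le_trans _ _ (t * (b ^+ n / (b - 1)))).
  by apply: ler_pM => //; exact: st.
rewrite mulrA ler_piMl ?invr_ge0 ?(ltW bm)//.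
by have /andP[] := tb.
Qed.

Let avgcst x : ((M%:R^-1)%:E * \sum_(0 <= i < M) x%:E = x%:E :> \bar R)%E.
Proof.
by rewrite sumEFin -EFinM sumr_const_nat subn0 -[x *+ M]mulr_natl mulKf// gt_eqF.
Qed.

Let Ef0 : expectation P (fun w => f 0 w `^ q) = K%:E. Proof. exact: Ef. Qed.
Let mSq : mf (fun w => S w `^ q). Proof. exact: measurable_powR_fun. Qed.
Let mf0q p : mf (fun w => f 0 w `^ p). Proof. exact: measurable_powR_fun. Qed.

Let SE : S = avg 0 N M t.
Proof.
apply/funext => w; rewrite /S /block_avg; congr (_ * _); apply: eq_bigr => i _.
by rewrite /f /g -expRD /log_field -big_cat_nat.
Qed.

(** [average_powR_le] separates [f] from the weights; the past then yields [K], and the future at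
    most [1 + E W^m]. *)
Lemma block_scaling_upper_ge1 : 1 <= q ->
  (expectation P (fun w => avg 0 N M t w `^ q)%R <=
   (2 `^ q * (1 + C * b ^+ m.-1) * K)%:E)%E.
Proof.
move=> q1; rewrite -SE.
pose J w := W w `^ (q - 1) * (M%:R^-1 * \sum_(0 <= i < M) f i w `^ q * g i w).
have mJ : mf J.
  apply: measurable_funM; first exact: measurable_powR_fun.
  apply: measurable_funM => //; apply: measurable_sum => i.
  by apply: measurable_funM => //; exact: measurable_powR_fun.
have J0 w : 0 <= J w.
  rewrite mulr_ge0 ?powR_ge0// mulr_ge0 ?invr_ge0// sumr_ge0// => i _.
  by rewrite mulr_ge0 ?powR_ge0 ?(ltW (g0 _ _)).
apply: (@le_trans _ _ (expectation P (fun w => 2 `^ q * J w))).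
  apply: expectation_mono => //.
  - exact: measurable_funM.
  - by move=> w; exact: powR_ge0.
  - by move=> w; exact: (average_powR_le M0 (f0 ^~ w) (g0 ^~ w)).
rewrite (expectation_scale P (powR_ge0 2 q) mJ J0) weighted_moment.
rewrite -mulrA EFinM lee_wpmul2l ?lee_fin ?powR_ge0// [leRHS]EFinM [leRHS]muleC.
rewrite lee_wpmul2l ?lee_fin ?expR_ge0//.
have mWm : mf (fun w => W w ^+ m) by exact: measurable_funX.
apply: (@le_trans _ _ (expectation P (fun w => 1 + W w ^+ m))).
  apply: expectation_mono.
  - exact: measurable_powR_fun.
  - exact: measurable_funD.
  - by move=> w; exact: powR_ge0.
  - move=> w; apply: powR_le_1D => //; have /andP[-> /ltW] := qm; exact.
rewrite expectation_const_add//; last by move=> w; rewrite exprn_ge0.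
by rewrite EFinD leeD2l.
Qed.

(** The danger is that the weights concentrate and make [E W^q] small; [E W = 1] and a bound on
    [E W^2] exclude this. *)
Lemma block_scaling_lower_le1 : q <= 1 ->
  ((((2 * (1 + C * b ^+ m.-1)) `^ (1 - q))^-1 / 4 * K)%:E <=
   expectation P (fun w => avg 0 N M t w `^ q)%R)%E.
Proof.
move=> q1; rewrite -SE; have /andP[q0 _] := qm.
have C0 : 0 <= C by apply: (block_avg_cst_ge0).
(* Chosen so that [k^-1 * E W^2 <= 1 / 2], which leaves half of [E W = 1] to the moment of order
   [q]. The other factor 2 inside the 4 comes from [average_powR_ge]. *)
pose k := 2 * (1 + C * b ^+ m.-1).
have k0 : 0 < k by rewrite mulr_gt0// ltr_wpDr// mulr_ge0// exprn_ge0 ?(ltW b0).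
rewrite -/k; have kq0 : 0 < k `^ (1 - q) by rewrite powR_gt0.
have mWm j : mf (fun w => W w ^+ j) by exact: measurable_funX.
have mWq : mf (fun w => W w `^ q) by exact: measurable_powR_fun.
have h2 : (1%:E <= (k `^ (1 - q))%:E * expectation P (fun w => W w `^ q)%R + (2^-1)%:E)%E.
  rewrite -EW; apply: (@le_trans _ _ (expectation P (fun w =>
      k `^ (1 - q) * W w `^ q + k^-1 * W w ^+ 2))).
    apply: expectation_mono => //.
      by apply: measurable_funD; exact: measurable_funM.
    by move=> w; apply: le_powR_Dsqr => //; rewrite q0.
  have ki0 : 0 <= k^-1 by rewrite invr_ge0 ltW.
  rewrite (expectation_add P (measurable_funM (measurable_cst _) mWq)
    (measurable_funM (measurable_cst _) (mWm 2)))//; last 2 first.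
  - by move=> w; rewrite mulr_ge0 ?powR_ge0.
  - by move=> w; rewrite mulr_ge0 ?sqr_ge0.
  rewrite (expectation_scale P (ltW kq0) mWq (fun w => powR_ge0 _ _)).
  rewrite leeD2l// (expectation_scale P ki0 (mWm 2) (fun w => sqr_ge0 _)).
  have -> : 2^-1 = k^-1 * (1 + C * b ^+ m.-1).
    by rewrite /k invfM -mulrA mulVf ?mulr1// gt_eqF// -(pmulr_rgt0 _ (ltr0n R 2)).
  rewrite EFinM lee_wpmul2l//.
  apply: (@le_trans _ _ (expectation P (fun w => 1 + W w ^+ m))).
    apply: expectation_mono => //.
    - exact: measurable_funD.
    - by move=> w; exact: sqr_ge0.
    move=> w; have h : W w `^ 2%:R <= 1 + W w ^+ m.
      by apply: powR_le_1D => //; rewrite ltr0n/= ler_nat.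
    by rewrite -(powR_mulrn 2 (W0 w)).
  rewrite expectation_const_add//; last by move=> w; rewrite exprn_ge0.
  by rewrite EFinD leeD2l.
pose J w := W w `^ (q - 1) * (M%:R^-1 * \sum_(0 <= i < M) f i w `^ q * g i w).
have mJ : mf J.
  apply: measurable_funM; first exact: measurable_powR_fun.
  apply: measurable_funM => //; apply: measurable_sum => i.
  by apply: measurable_funM => //; exact: measurable_powR_fun.
have J0 w : 0 <= J w.
  rewrite mulr_ge0 ?powR_ge0// mulr_ge0 ?invr_ge0// sumr_ge0// => i _.
  by rewrite mulr_ge0 ?powR_ge0 ?(ltW (g0 _ _)).
have h3 : (K%:E * expectation P (fun w => W w `^ q)%R <=
    2%:E * expectation P (fun w => S w `^ q)%R)%E.
  rewrite -weighted_moment -(expectation_scale P (ler0n R 2) mSq (fun w => powR_ge0 _ _)).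
  apply: expectation_mono => //.
  - exact: measurable_funM.
  - move=> w; apply: (average_powR_ge M0 (f0 ^~ w) (g0 ^~ w)).
    by rewrite q0.
set EWq := expectation P (fun w => W w `^ q) in h2 h3.
set ESq := expectation P _ in h3 *.
have K0 : 0 < K by exact: expR_gt0.
have : ((2^-1)%:E <= (k `^ (1 - q))%:E * EWq)%E.
  rewrite -(leeD2rE _ _ (fin_numE (2^-1 : R)%:E))//.
  by apply: le_trans h2; rewrite -EFinD lee_fin; lra.
have : (0 <= EWq)%E by apply: expectation_ge0 => w; exact: powR_ge0.
have : (0 <= ESq)%E by apply: expectation_ge0 => w; exact: powR_ge0.
move: ESq EWq h3 {h2} => [x| |] [y| |] //; rewrite ?leey//; last first.
  by rewrite (gt0_muley (x := K%:E)) ?lte_fin// -EFinM leye_eq.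
rewrite -!EFinM !lee_fin => xy x0 y0 ky.
have h4 := ler_wpM2l (ltW K0) ky; have h5 := ler_wpM2l (ltW kq0) xy.
move: (k `^ (1 - q)) K kq0 h4 h5 => u v u0 h4 h5.
have -> : u^-1 / 4 * v = u^-1 * (v / 4) by field; rewrite gt_eqF.
by rewrite ler_pdivrMl//; lra.
Qed.

Let mtS : mf (fun w => f 0 w `^ (q - 1) * S w). Proof. exact: measurable_funM. Qed.
Let tS0 w : 0 <= f 0 w `^ (q - 1) * S w. Proof. by rewrite mulr_ge0 ?powR_ge0. Qed.

Lemma block_scaling_lower_ge1 : 1 <= q ->
  (((2 * expR (beta * lambda / (alpha - q) / (b - 1))) `^ (- q) * K)%:E <=
   expectation P (fun w => avg 0 N M t w `^ q)%R)%E.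
Proof.
move=> q1; rewrite -SE; set D := beta * lambda / _ / _.
(* The biased mean of [S] is at least [K * expR (- D)]. Multiplied by this [eta] it gives [2 * K],
   of which one [K] absorbs the moment of [f 0]. *)
pose eta := 2 * expR D; have eta0 : 0 < eta by rewrite mulr_gt0 ?expR_gt0.
rewrite -/eta; have q1a : 1 <= q < alpha by rewrite q1.
have k0 : 0 <= beta * lambda / (alpha - q).
  by rewrite divr_ge0 ?subr_ge0 ?(ltW qa)// mulr_ge0 ?(ltW hbeta) ?(ltW hlambda).
have hT : ((K * expR (- D))%:E <= expectation P (fun w => f 0 w `^ (q - 1) * S w)%R)%E.
  rewrite tilted_average -[leLHS]avgcst lee_wpmul2l ?lee_fin ?invr_ge0//.
  rewrite big_nat [leRHS]big_nat; apply: lee_sum => i /andP[_ iM].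
  have s0i : 0 <= (0 : R) <= s i by rewrite lexx s0.
  apply: le_trans (log_field_tilt_ge 0 n q1a s0i).
  rewrite lee_fin /K -expRD ler_expR subn0 lerD2l lerN2.
  exact: gap_le.
have key : (eta%:E * expectation P (fun w => f 0 w `^ (q - 1) * S w)%R <=
    K%:E + (eta `^ q)%:E * expectation P (fun w => S w `^ q)%R)%E.
  rewrite -Ef0 -(expectation_scale P (ltW eta0) mtS tS0).
  rewrite -(expectation_scale P (powR_ge0 eta q) mSq (fun w => powR_ge0 _ _)).
  have meS : mf (fun w => eta `^ q * S w `^ q) by exact: measurable_funM.
  have eS0 w : 0 <= eta `^ q * S w `^ q by rewrite mulr_ge0 ?powR_ge0.
  rewrite -(expectation_add P (mf0q q) meS (fun w => powR_ge0 _ _) eS0).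
  apply: expectation_mono.
  - exact: measurable_funM.
  - exact: measurable_funD.
  - by move=> w; rewrite mulr_ge0 ?(ltW eta0).
  - by move=> w; apply: powR_tilt_ge.
have eta0' : (0 <= eta%:E)%E by rewrite lee_fin ltW.
have := le_trans (lee_wpmul2l eta0' hT) key.
set ESq := expectation P (fun w => S w `^ q).
have -> : (eta%:E * (K * expR (- D))%:E = K%:E + K%:E)%E.
  rewrite -EFinM -EFinD; congr EFin; rewrite /eta expRN; field.
  by rewrite gt_eqF ?expR_gt0.
rewrite leeD2lE// powRN EFinM lee_pdivrMl//.
exact: powR_gt0.
Qed.

(** [powR_tilt_le] with [x = f 0] and [y = S] bounds the power of [S] by a biased copy of [S] plus a
    power of [f 0], both of mean at most a constant times [K]. *)
Lemma block_scaling_upper_le1 : q <= 1 ->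
  (expectation P (fun w => avg 0 N M t w `^ q)%R <=
   ((expR (beta * lambda / (alpha - 1) / (b - 1)) + 1) * K)%:E)%E.
Proof.
move=> q1; rewrite -SE; set D := beta * lambda / _ / _; have /andP[q0 _] := qm.
have q01 : 0 < q <= 1 by rewrite q0.
have k0 : 0 <= beta * lambda / (alpha - 1).
  by rewrite divr_ge0 ?subr_ge0 ?(ltW a1)// mulr_ge0 ?(ltW hbeta) ?(ltW hlambda).
have hT : (expectation P (fun w => f 0 w `^ (q - 1) * S w)%R <= (K * expR D)%:E)%E.
  rewrite tilted_average -[leRHS]avgcst lee_wpmul2l ?lee_fin ?invr_ge0//.
  rewrite big_nat [leRHS]big_nat; apply: lee_sum => i /andP[_ iM].
  have s0i : 0 <= (0 : R) <= s i by rewrite lexx s0.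
  apply: (le_trans (log_field_tilt_le 0 n q01 s0i)).
  rewrite lee_fin /K -expRD ler_expR subn0 lerD2l.
  exact: gap_le.
apply: (@le_trans _ _ (expectation P (fun w => f 0 w `^ (q - 1) * S w + f 0 w `^ q))).
  apply: expectation_mono => //.
  - exact: measurable_funD.
  - by move=> w; exact: powR_ge0.
  - move=> w; apply: powR_tilt_le => //; rewrite mulr_gt0 ?invr_gt0//.
    case: (M) M0 => // k _; rewrite big_nat_recl// ltr_pwDl ?mulr_gt0// sumr_ge0// => i _.
rewrite (expectation_add P mtS (mf0q q) tS0 (fun w => powR_ge0 _ _)) Ef0.
by rewrite mulrDl mul1r EFinD leeD2r// mulrC.
Qed.

End fixed_block.

(** * Power laws for the limit *)

Lemma scale_index (t : R) : 0 < t <= 1 ->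
  exists n : nat, n%:R <= - ln t / ln b < n.+1%:R.
Proof.
move=> /andP[t0 t1]; exists (Num.truncn (- ln t / ln b)); apply: truncn_itv.
by rewrite divr_ge0 ?(ltW lnb)// oppr_ge0 ln_le0.
Qed.

Lemma scale_index_le (t : R) (n : nat) : 0 < t ->
  n%:R <= - ln t / ln b < n.+1%:R -> b^-1 <= t * b ^+ n <= 1.
Proof.
move=> t0; rewrite ler_pdivlMr// ltr_pdivrMr// -natr1 mulrDl mul1r => /andP[n1 n2].
have -> : t * b ^+ n = expR (ln t + n%:R * ln b).
  by rewrite expRD lnK ?posrE// expRM_natl lnK ?posrE.
have -> : b^-1 = expR (- ln b) by rewrite expRN lnK ?posrE.
rewrite ler_expR; apply/andP; split; first by lra.
by rewrite expR_le1; lra.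
Qed.

Lemma gamma_scalingE q : gamma_scaling beta alpha b q = q - logK q / ln b.
Proof.
rewrite /gamma_scaling -/(mean_log_factor beta alpha) mean_log_factorE// /lognu /gam.
by field; rewrite gt_eqF.
Qed.

(** For [q <= 1] convexity gives [lognu q <= 0]; for [q >= 1] the chord gives
    [lognu q <= theta * (q - 1)], and [theta < ln b]. Positivity serves at [t = 0], where the power
    must vanish, whereas a zeroth power of 0 would be 1. *)
Lemma gamma_scaling_gt0 q : 0 < q < m%:R -> 0 < gamma_scaling beta alpha b q.
Proof.
move=> /andP[q0 qm]; rewrite gamma_scalingE subr_gt0 ltr_pdivrMr// /lognu.
have th0 : 0 <= theta by rewrite slope_ge0// ltr1n.
have [q1|/ltW q1] := leP q 1.
  apply: (@le_lt_trans _ _ 0); last by rewrite mulr_gt0.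
  have q01 : 0 <= q <= 1 by rewrite q1 ltW.
  by rewrite subr_le0; exact: (gam_le_linear halpha hbeta m1R ma).
apply: (@le_lt_trans _ _ (theta * (q - 1))).
  have z1m : 1 <= q <= m%:R by rewrite q1 ltW.
  by rewrite lerBlDl; exact: gam_le_slope.
apply: (@le_lt_trans _ _ (theta * q)); first by rewrite ler_wpM2l// gerBl.
by rewrite mulrC ltr_pM2l.
Qed.

(** Replacing [- ln t / ln b] by its integer part [n] changes the exponent by at most the absolute
    value of [lognu q]. *)
Lemma power_scale q t (n : nat) : 0 < t -> n%:R <= - ln t / ln b < n.+1%:R ->
  expR (- `|logK q|) * t `^ gamma_scaling beta alpha b q <=
    t `^ q * expR (n%:R * logK q) <=
  expR `|logK q| * t `^ gamma_scaling beta alpha b q.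
Proof.
move=> t0 nt; rewrite gamma_scalingE /powR gt_eqF// -!expRD !ler_expR.
move: nt; rewrite -natr1; set L := logK q; set x := - ln t / ln b => /andP[n1 n2].
have -> : (q - L / ln b) * ln t = q * ln t + L * x.
  by rewrite /x; field; rewrite gt_eqF.
have : `|L * (n%:R - x)| <= `|L|.
  by rewrite normrM ler_piMr// ler_norml; apply/andP; split; lra.
by rewrite ler_norml mulrBr (mulrC L n%:R) => /andP[h1 h2]; apply/andP; split; lra.
Qed.

Lemma block_scaling q : 0 < q < m%:R -> exists c1 c2 : R, 0 < c1 /\ 0 < c2 /\
  forall t (n N M : nat), 0 <= t -> b^-1 <= t * b ^+ n <= 1 -> (n <= N)%N ->
  (0 < M)%N -> expR (theta * N%:R) <= M%:R ->
  ((c1 * expR (n%:R * logK q))%:E <= expectation P (fun w => avg 0 N M t w `^ q)%R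
     <= (c2 * expR (n%:R * logK q))%:E)%E.
Proof.
move=> qm; have C0 : 0 <= C by apply: (block_avg_cst_ge0).
have k0 : 0 < 1 + C * b ^+ m.-1 by rewrite ltr_wpDr// mulr_ge0// exprn_ge0 ?(ltW b0).
have [q1|/ltW q1] := leP q 1.
  exists (((2 * (1 + C * b ^+ m.-1)) `^ (1 - q))^-1 / 4).
  exists (expR (beta * lambda / (alpha - 1) / (b - 1)) + 1); split; [|split].
  - by rewrite divr_gt0// invr_gt0 powR_gt0// mulr_gt0.
  - by rewrite addr_gt0// expR_gt0.
  move=> t n N M t0 tb nN M0 MN; apply/andP; split.
    exact: (block_scaling_lower_le1).
  exact: (block_scaling_upper_le1).
exists ((2 * expR (beta * lambda / (alpha - q) / (b - 1))) `^ (- q)).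
exists (2 `^ q * (1 + C * b ^+ m.-1)); split; [|split].
- by rewrite powR_gt0// mulr_gt0// expR_gt0.
- by rewrite mulr_gt0// powR_gt0.
move=> t n N M t0 tb nN M0 MN; apply/andP; split.
  exact: (block_scaling_lower_ge1).
exact: (block_scaling_upper_ge1).
Qed.

Lemma limit_scaling q : 0 < q < m%:R -> exists C1 C2 : R, 0 < C1 /\ C1 <= C2 /\
  forall t (A : T -> R), 0 <= t <= 1 -> mf A -> (forall w, 0 <= A w) ->
  (forall e, 0 < e -> exists n0, forall n, (n0 <= n)%N ->
    (expectation P (fun w => (A w - mass n t w) ^+ 2)%R <= e%:E)%E) ->
  ((C1 * t `^ gamma_scaling beta alpha b q)%:E <= expectation P (fun w => A w `^ q)%R
     <= (C2 * t `^ gamma_scaling beta alpha b q)%:E)%E.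
Proof.
move=> qm; have /andP[q0 _] := qm; have [c1 [c2 [c10 [c20 cP]]]] := block_scaling qm.
pose u := 2 `^ (- q) * (c1 * expR (- `|logK q|)).
pose v := 2 `^ q * (c2 * expR `|logK q|).
have u0 : 0 < u by rewrite mulr_gt0 ?powR_gt0// mulr_gt0// expR_gt0.
have v0 : 0 < v by rewrite mulr_gt0 ?powR_gt0// mulr_gt0// expR_gt0.
(* [u + v] rather than [v] makes the ordering of the two constants evident. *)
exists u, (u + v); split => //; split; first by rewrite lerDl ltW.
move=> t A t01 mA A0 LA; have /andP[t0 t1] := t01.
(* At [t = 0] there is no scale index. The limit then has mean 0, and the zero function approximates
   it in L^1. *)
move: (t0); rewrite le_eqVlt => /orP[/eqP t0E|tp].
  have EA : expectation P A = 0%E.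
    by rewrite (limit_expectation t01 mA A0 LA) -t0E.
  have -> : t `^ gamma_scaling beta alpha b q = 0.
    by rewrite -t0E powR0// gt_eqF// gamma_scaling_gt0.
  rewrite !mulr0.
  have := @moment_transfer _ _ _ P m q 0 0 0 A qm mA A0; rewrite !mulr0; apply.
  move=> e e0; exists (fun=> 0); split => //.
  - rewrite (_ : (fun _ => _) = A); last by apply/funext => w; rewrite subr0 ger0_norm.
    by rewrite EA lee_fin ltW.
  - by rewrite expr0n gtn_eqF// expectation_cst.
  - by rewrite powR0 ?gt_eqF// expectation_cst lexx.
have [n nt] := scale_index (t := t) (introT andP (conj tp t1)).
have tb := scale_index_le tp nt.
have /andP[p1 p2] := power_scale q tp nt.
set K := expR (n%:R * logK q) in p1 p2.
have : ((2 `^ (- q) * (c1 * (t `^ q * K)))%:E <= expectation P (fun w => A w `^ q)%R <=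
    (2 `^ q * (c2 * (t `^ q * K)))%:E)%E.
  apply: (@moment_transfer _ _ _ P m q C) => // e e0.
  have e20 : 0 < e / 2 by rewrite divr_gt0.
  have [n0 n0P] := limit_L1 mA LA e20.
  pose N := maxn n n0.
  have [M0 M0P] := mass_riemann N t01 e20.
  pose M := (maxn M0 (Num.bound (expR (theta * N%:R)))).+1.
  have MN : expR (theta * N%:R) <= M%:R.
    apply: (@le_trans _ _ (Num.bound (expR (theta * N%:R)))%:R).
      by apply/ltW/archi_boundP; exact: expR_ge0.
    by rewrite ler_nat /M leqW// leq_maxr.
  have mS : mf (fun w => t * avg 0 N M t w).
    by apply: measurable_funM => //; exact: measurable_block_avg.
  exists (fun w => t * avg 0 N M t w); split => //.
  - by move=> w; rewrite mulr_ge0// block_avg_ge0.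
  - have mN := measurable_mass N t.
    have mAN := measurable_dist mA mN; have mNS := measurable_dist mN mS.
    apply: (@le_trans _ _ (expectation P (fun w => `|A w - mass N t w| +
        `|mass N t w - t * avg 0 N M t w|))).
      apply: expectation_mono.
      + exact: measurable_dist.
      + exact: measurable_funD.
      + by move=> w; exact: normr_ge0.
      + by move=> w; exact: ler_distD.
    rewrite (expectation_add P mAN mNS (fun w => normr_ge0 _) (fun w => normr_ge0 _)).
    rewrite [e](splitr e) EFinD; apply: leeD.
      by apply: n0P; exact: leq_maxr.
    by apply: M0P => //; rewrite /M leqW// leq_maxl.
  - exact: (block_avg0_moment).
  have tq0 : 0 < t `^ q by exact: powR_gt0.
  have -> : expectation P (fun w => (t * avg 0 N M t w) `^ q) =
      ((t `^ q)%:E * expectation P (fun w => avg 0 N M t w `^ q)%R)%E.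
    have mq : mf (fun w => avg 0 N M t w `^ q).
      by apply: measurable_powR_fun; exact: measurable_block_avg.
    rewrite -(expectation_scale P (ltW tq0) mq (fun w => powR_ge0 _ _)).
    by congr expectation; apply/funext => w; rewrite powRM// block_avg_ge0.
  have /andP[h1 h2] := cP t n N M t0 tb (leq_maxl _ _) (ltn0Sn _) MN.
  have tq0' : (0 <= (t `^ q)%:E)%E by rewrite lee_fin ltW.
  by rewrite ![_ * (t `^ q * _)]mulrCA ![(t `^ q * _)%:E]EFinM !lee_wpmul2l.
move=> /andP[h1 h2]; apply/andP; split.
  apply: le_trans h1; rewrite lee_fin /u -!mulrA.
  by rewrite ler_wpM2l ?powR_ge0// ler_wpM2l// ltW.
apply: (le_trans h2); rewrite lee_fin mulrDl.
apply: (@le_trans _ _ (v * t `^ gamma_scaling beta alpha b q)).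
  by rewrite /v -!mulrA ler_wpM2l ?powR_ge0// ler_wpM2l// ltW.
by rewrite lerDr mulr_ge0 ?powR_ge0// ltW.
Qed.

(** * From densities back to the cascade *)

Lemma copy_gt0 j t : 0 <= t -> {ae P, forall w, 0 < Lam j t w}.
Proof.
move=> t0; pose ts : 1.-tuple R := [tuple t].
pose B : set (1.-tuple R) := (fun v => tnth v ord0) @^-1` [set` `]-oo, 0]].
have mB : measurable B.
  rewrite -[B]setTI; have mt := @measurable_tnth _ R 1 ord0.
  by apply: (mt measurableT); exact: measurable_itv.
have ts0 i : 0 <= tnth ts i by rewrite (tnth_nth 0) ord1.
have E : P (fdd_vector (fun t => Lam j t) ts @^-1` B) = 0%E.
  rewrite (hfdd j ts0 mB) (_ : _ @^-1` B = set0 :> set T0) ?measure0//.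
  apply/seteqP; split => w //=; rewrite /B /= in_itv/= tnth_mktuple.
  by rewrite leNgt expR_gt0.
exists (fdd_vector (fun t => Lam j t) ts @^-1` B); split => //.
  rewrite (_ : _ @^-1` B = Lam j t @^-1` [set` `]-oo, 0]]).
    rewrite -[_ @^-1` _]setTI; exact: (measurable_funPT (Lam j t)).
  by apply/seteqP; split => w /=; rewrite /B /= !in_itv/= tnth_mktuple.
move=> w /= /negP; rewrite -leNgt /B /= in_itv/= tnth_mktuple.
by [].
Qed.

Lemma prod_density_ae n s : 0 <= s ->
  {ae P, forall w, \prod_(j < n) Lam j (s * b ^+ j) w = density n s w}.
Proof.
move=> s0.
have : {ae P, forall w, forall j : nat, 0 < Lam j (s * b ^+ j) w}.
  apply/ae_foralln => j; apply: copy_gt0.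
  by rewrite mulr_ge0// exprn_ge0 ?(ltW b0).
apply: filterS => w h; rewrite densityE// /log_field expR_sum big_mkord.
by apply: eq_bigr => j _; rewrite lnK// posrE.
Qed.

(** The copies are positive only almost surely while measurability is claimed everywhere, so the
    integral is split into its positive and negative parts. *)
Lemma measurable_cascade n t : mf (cascade b (fun j t => Lam j t) n t).
Proof.
pose p s w := \prod_(j < n.+1) Lam j (Num.max 0 s * b ^+ j) w.
have mp : measurable_fun [set: R * T] (fun z => p z.1 z.2).
  by apply: measurable_prod => j _; exact: (measurable_dilation).
have meas_int (U : R -> T -> R) : measurable_fun [set: R * T] (fun z => U z.1 z.2) ->
    (forall s w, 0 <= U s w) ->
    measurable_fun setT (fun w => \int[leb]_(s in `[0%R, t]) (U s w)%:E)%E.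
  by move=> mU U0; exact: (measurable_process_integral (U := U)).
apply: measurableT_comp => //.
rewrite (_ : (fun w => _) = (fun w => \int[leb]_(s in `[0%R, t]) (Num.max (p s w) 0)%:E -
    \int[leb]_(s in `[0%R, t]) (Num.max (- p s w) 0)%:E)%E).
  apply: emeasurable_funB; apply: meas_int => [|s w].
  - exact: measurable_maxr.
  - by rewrite le_max lexx orbT.
  - by apply: measurable_maxr => //; exact: measurable_funN.
  - by rewrite le_max lexx orbT.
apply/funext => w; rewrite integralE; congr (_ - _)%E; apply: eq_integral => s;
  rewrite inE/= in_itv/= => /andP[s0 _].
- rewrite funeposE EFin_max; congr (maxe _%:E _).
  by apply: eq_bigr => j _; rewrite max_r.
- rewrite funenegE EFin_max EFinN; congr (maxe (- _%:E)%E _).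
  by apply: eq_bigr => j _; rewrite max_r.
Qed.

(** At each fixed time the product equals the density off a null event that depends on the time.
    Tonelli's theorem exchanges the quantifiers: almost surely they agree at almost every time,
    which suffices for the integrals. *)
Lemma cascade_mass_ae n t : 0 <= t ->
  {ae P, forall w, cascade b (fun j t => Lam j t) n t w = mass n.+1 t w}.
Proof.
move=> t0; pose p s w := \prod_(j < n.+1) Lam j (Num.max 0 s * b ^+ j) w.
have mp : measurable_fun [set: R * T] (fun z => p z.1 z.2).
  by apply: measurable_prod => j _; exact: (measurable_dilation).
have mD := measurable_density n.+1.
pose U s w := `|p s w - density n.+1 s w|.
have mU : measurable_fun [set: R * T] (fun z => U z.1 z.2).
  by apply: measurableT_comp; [exact: normr_measurable|exact: measurable_funB].
have U0 s w : 0 <= U s w by exact: normr_ge0.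
have := process_tonelli P mU U0 (measurable_itv `[0%R, t]).
rewrite (_ : \int[leb]_(s in _) _ = 0)%E; last first.
  apply: integral0_eq => s; rewrite /= in_itv/= => /andP[s0 _].
  transitivity (expectation P (cst (0 : R))); last exact: expectation_cst.
  apply: expectation_eq_ae => //.
  - apply: filterS (prod_density_ae n.+1 s0) => w h.
    by rewrite /U /p max_r// h subrr normr0.
  - exact: (measurable_process_at (U := U) mU).
pose G w := (\int[leb]_(s in `[0%R, t]) (U s w)%:E)%E.
have mG : measurable_fun setT G by exact: (measurable_process_integral (U := U)).
have G0 w : (0 <= G w)%E by apply: integral_ge0 => s _; rewrite lee_fin.
move=> EG; have : (\int[P]_w `|G w| = 0)%E.
  by rewrite -[RHS]EG; apply: eq_integral => w _; rewrite gee0_abs.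
move=> /(ae_eq_integral_abs P measurableT mG); apply: filterS => w /(_ Logic.I) Gw.
rewrite /cascade /mass /Rintegral; congr fine.
have mUw : measurable_fun [set` `[0, t]] (fun s => (U s w)%:E).
  apply/measurable_EFinP; apply: measurable_funTS.
  exact: (measurable_process_path (U := U) mU).
have : (\int[leb]_(s in `[0%R, t]) `|(U s w)%:E| = 0)%E.
  by rewrite -[RHS]Gw; apply: eq_integral => s _; rewrite gee0_abs ?lee_fin.
move=> /(ae_eq_integral_abs leb (measurable_itv `[0, t]) mUw) Uw.
transitivity (\int[leb]_(s in `[0%R, t]) (p s w)%:E)%E.
  apply: eq_integral => s; rewrite inE/= in_itv/= => /andP[s0 _].
  by congr EFin; apply: eq_bigr => j _; rewrite max_r.
apply: ae_eq_integral => //.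
- apply/measurable_EFinP; apply: measurable_funTS.
  exact: (measurable_process_path (U := p) mp).
- apply/measurable_EFinP; apply: measurable_funTS.
  exact: (measurable_process_path (U := density n.+1) mD).
- apply: filterS Uw => s h st; have := h st.
  by move=> /eqP; rewrite eqe normr_eq0 subr_eq0 => /eqP ->.
Qed.

(** * The variance bound *)

Local Notation rho := (bivariate_mgf P0 c (fun s => X s) 1 1).

Lemma bivariate_density u v : 0 <= u -> 0 <= v ->
  rho u v = expectation P (fun w => density 1 u w * density 1 v w).
Proof.
move=> u0 v0; pose s := [:: (1, u); (1 : R, v)].
have s0 : {in s, forall p, 0 <= p.2} by move=> p; rewrite !inE => /orP[] /eqP ->.
have h := log_field_moment1 0%N s0.
have me : measurable_fun setT (fun w => expR (1 * X u w + 1 * X v w)).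
  by apply: measurableT_comp => //; apply: measurable_funD; exact: measurable_funM.
rewrite /bivariate_mgf -(expectation_scale P0 (expR_ge0 _) me (fun w => expR_ge0 _)).
transitivity (OU_log_moment s).
  congr expectation; apply/funext => w; rewrite -expRD; congr expR.
  by rewrite /s !big_cons big_nil /=; ring.
rewrite -h; congr expectation; apply/funext => w.
rewrite !densityE// -expRD; congr expR.
by rewrite /log_field !big_nat1 /s !big_cons big_nil /= expr0 !mulr1 !mul1r addr0.
Qed.

Lemma integral_covariance t (v : R) : 0 <= t -> mass_energy 1 t = v%:E ->
  (\int[leb]_(u in `[0%R, t]) \int[leb]_(w in `[0%R, t]) (rho u w - 1) =
   (v - t * t)%:E)%E.
Proof.
move=> t0 ev.
have mM := mm 1 t.
pose g u := expectation P (fun w => density 1 u w * mass 1 t w).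
have mg : measurable_fun setT g.
  apply: measurable_process_expectation => [|u w]; last first.
    by rewrite mulr_ge0 ?density_ge0 ?mass_ge0.
  apply: measurable_funM; first exact: measurable_density.
  exact: (measurableT_comp (f := mass 1 t)).
have g0 u : (0 <= g u)%E.
  by apply: expectation_ge0 => w; rewrite mulr_ge0 ?density_ge0 ?mass_ge0.
have gE u : g u = (\int[leb]_(v in `[0%R, t])
    expectation P (fun w => density 1 u w * density 1 v w)%R)%E.
  exact: (expectation_density_mass u t0 (leqnn 1)).
(* Finiteness makes it legitimate to subtract the constant under the integral; it follows from
   [x * y <= x ^ 2 + y ^ 2]. *)
have gfin u : 0 <= u -> (g u < +oo)%E.
  move=> u0; have := log_field_power_moment 0 1 u0 a2.
  set k := expR _ => Ed.
  have mdd : mf (fun w => density 1 u w ^+ 2) by exact: measurable_funX.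
  have mMM : mf (fun w => mass 1 t w * mass 1 t w) by exact: measurable_funM.
  have MM0 w : 0 <= mass 1 t w * mass 1 t w by rewrite mulr_ge0 ?mass_ge0.
  apply: (@le_lt_trans _ _ (expectation P (fun w => density 1 u w ^+ 2 +
      mass 1 t w * mass 1 t w))).
    apply: expectation_mono.
    - exact: measurable_funM.
    - exact: measurable_funD.
    - by move=> w; rewrite mulr_ge0 ?density_ge0 ?mass_ge0.
    - move=> w; have := sqr_ge0 (density 1 u w - mass 1 t w).
      have : 0 <= density 1 u w * mass 1 t w by rewrite mulr_ge0 ?density_ge0 ?mass_ge0.
      by move: (density 1 u w) (mass 1 t w) => x y; rewrite sqrrB; nra.
  rewrite (expectation_add P mdd mMM (fun w => sqr_ge0 _) MM0).
  rewrite (expectation_massM t0 (leqnn 1)) ev.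
  rewrite (_ : expectation P (fun w => density 1 u w ^+ 2) = k%:E) ?ltry//.
  rewrite -Ed; congr expectation; apply/funext => w.
  by rewrite densityE// expr2 -expRD; congr expR; ring.
have inner u : 0 <= u ->
    (\int[leb]_(w in `[0%R, t]) (rho u w - 1) = g u - t%:E)%E.
  move=> u0; pose r w := expectation P (fun x => density 1 u x * density 1 w x).
  have mr : measurable_fun setT r.
    apply: measurable_process_expectation => [|w x]; last first.
      by rewrite mulr_ge0 ?density_ge0.
    apply: measurable_funM; last exact: measurable_density.
    exact: (measurableT_comp (f := density 1 u)).
  have r0 w : (0 <= r w)%E.
    by apply: expectation_ge0 => x; rewrite mulr_ge0 ?density_ge0.
  have rfin : (\int[leb]_(w in `[0%R, t]) r w < +oo)%E by rewrite -gE gfin.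
  rewrite gE -{3}[t]mul1r -(integral_sub_cst 1 t0 mr r0 rfin).
  apply: eq_integral => w; rewrite inE/= in_itv/= => /andP[w0 _].
  by rewrite bivariate_density.
transitivity (\int[leb]_(u in `[0%R, t]) (g u - t%:E))%E.
  by apply: eq_integral => u; rewrite inE/= in_itv/= => /andP[u0 _]; exact: inner.
have gint : (\int[leb]_(u in `[0%R, t]) g u = v%:E)%E.
  by rewrite -ev; apply: eq_integral => u _; exact: gE.
by rewrite integral_sub_cst// gint ?ltry// EFinB.
Qed.

Lemma limit_variance t (A : T -> R) : 0 <= t <= 1 -> mf A -> (forall w, 0 <= A w) ->
  (forall e, 0 < e -> exists n0, forall n, (n0 <= n)%N ->
    (expectation P (fun w => (A w - mass n t w) ^+ 2)%R <= e%:E)%E) ->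
  (\int[leb]_(u in `[0%R, t]) \int[leb]_(w in `[0%R, t]) (rho u w - 1) <=
   'V_P[A])%E.
Proof.
move=> t01 mA A0 LA; have /andP[t0 t1] := t01.
have [v vE] := mass_energy_real t01.
rewrite (integral_covariance t0 (vE 1%N)).
have EA := limit_expectation t01 mA A0 LA.
(* [mass 1] involves level 0 alone, so its energy is the double integral of the correlation of
   [Lambda]. *)
have EAA := limit_energy t01 mA A0 LA 1.
rewrite vE in EAA.
have -> : 'V_P[A]%E = expectation P (fun w => (A w - t) ^+ 2).
  by rewrite /variance covariance.unlock EA /=; congr expectation; apply/funext => w.
have mD : mf (fun w => (A w - t) ^+ 2).
  by apply: measurable_funX; exact: measurable_funB.
have mtA : mf (fun w => 2 * t * A w) by exact: measurable_funM.
have tA0 w : 0 <= 2 * t * A w by rewrite !mulr_ge0.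
have mAA : mf (fun w => A w * A w) by exact: measurable_funM.
have AA0 w : 0 <= A w * A w by rewrite mulr_ge0.
have t2 : 0 <= 2 * t by rewrite mulr_ge0.
have tt : 0 <= t * t by rewrite mulr_ge0.
have key : (expectation P (fun w => (A w - t) ^+ 2)%R + (2 * t * t)%:E =
    (t * t)%:E + expectation P (fun w => A w * A w)%R)%E.
  rewrite EFinM -EA -(expectation_scale P t2 mA A0).
  rewrite -(expectation_add P mD mtA (fun w => sqr_ge0 _) tA0).
  rewrite -(expectation_const_add P tt mAA AA0).
  by congr expectation; apply/funext => w; ring.
rewrite -(leeD2rE _ _ (fin_numE (2 * t * t)%:E))// key.
apply: le_trans (leeD2l _ EAA); rewrite -!EFinD lee_fin le_eqVlt; apply/orP; left.
by apply/eqP; ring.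
Qed.

End multifractal_products.

(** * The threshold on [b] and the conclusion *)

Lemma gamma_threshold (R : realType) (alpha beta m : R) :
  0 < alpha -> 1 < m -> m < alpha ->
  ((1 - 1 / alpha) `^ (beta * m) / (1 - m / alpha) `^ beta) `^ (1 / (m - 1)) =
  expR (slope alpha beta m).
Proof.
move=> a0 m1 ma.
have p1 : 0 < 1 - 1 / alpha by rewrite subr_gt0 ltr_pdivrMr// mul1r (lt_trans m1).
have pm : 0 < 1 - m / alpha by rewrite subr_gt0 ltr_pdivrMr// mul1r.
rewrite {1}/powR gt_eqF ?divr_gt0 ?powR_gt0//; congr expR.
rewrite lnM ?posrE ?invr_gt0 ?powR_gt0// lnV ?posrE ?powR_gt0// !ln_powR.
rewrite /slope /gam; field; rewrite gt_eqF ?subr_gt0//.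
Qed.

Lemma ge0_ereal_cvg0 (R : realType) (u : nat -> \bar R) : (forall n, 0 <= u n)%E ->
  (forall e, 0 < e -> exists n0, forall n, (n0 <= n)%N -> (u n <= e%:E)%E) ->
  u n @[n --> \oo] --> 0%E.
Proof.
move=> u0 ue; apply/fine_cvgP; split.
  have [n0 n0P] := ue 1 ltr01; exists n0 => // n /= n0n.
  by rewrite ge0_fin_numE// (le_lt_trans (n0P n n0n)) ?ltry.
apply/cvgrPdist_le => e e0; have [n0 n0P] := ue e e0; exists n0 => // n /= n0n.
rewrite sub0r normrN ger0_norm ?fine_ge0//.
move: (u0 n) (n0P n n0n); by case: (u n).
Qed.

Theorem theorem10 (R : realType) (alpha beta lambda : R) (qstar : nat)
  (halpha : 2 < alpha) (hbeta : 0 < beta) (hlambda : 0 < lambda)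
  (hqstar : (2 <= qstar)%N) (hqalpha : qstar%:R < alpha)
  (d0 : measure_display) (T0 : measurableType d0) (P0 : probability T0 R)
  (X : R -> {RV P0 >-> R})
  (hX : stationary_OU_type lambda X) (hX0 : gamma_law beta alpha (X 0))
  (Lambda : R -> T0 -> R)
  (hLambda : forall t w,
    Lambda t w = expR (X t w - mean_log_factor beta alpha))
  (hLmeas : measurable_process Lambda) (hLsep : separable_process P0 Lambda)
  (d : measure_display) (T : measurableType d) (P : probability T R)
  (Lam : nat -> R -> {RV P >-> R})
  (hLam : independent_copies P P0 Lambda (fun j t => Lam j t))
  (b : R)
  (hb : ((1 - 1 / alpha) `^ (beta * qstar%:R)
          / (1 - qstar%:R / alpha) `^ beta) `^ (1 / (qstar%:R - 1)) < b) :
  let A_ := cascade b (fun j t => Lam j t) in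
  exists A : R -> {RV P >-> R},
    (forall q : R, 0 < q < qstar%:R ->
      [/\ forall t : R, 0 <= t <= 1 ->
            ('E_P[fun w => (`|A_ n t w - A t w| `^ q)%R])%E @[n --> \oo] --> 0%E,
          forall t : R, 0 <= t <= 1 -> ('E_P[fun w => (`|A t w| `^ q)%R] < +oo)%E &
          exists C1 C2 : R, 0 < C1 /\ C1 <= C2 /\
            forall t : R, 0 <= t <= 1 ->
              ((C1 * t `^ gamma_scaling beta alpha b q)%:E
                <= 'E_P[fun w => (A t w `^ q)%R]
                <= (C2 * t `^ gamma_scaling beta alpha b q)%:E)%E]) /\
    (forall t : R, 0 <= t <= 1 ->
      (\int[lebesgue_measure]_(u in `[0%R, t]%classic) \int[lebesgue_measure]_(w in `[0%R, t]%classic)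
          (bivariate_mgf P0 (mean_log_factor beta alpha) (fun s => X s) 1%R 1%R u w
             - 1)
        <= 'V_P[A t])%E).
Proof.
have a0 : 0 < alpha by exact: lt_trans halpha.
have a1 : 1 < alpha by apply: lt_trans halpha; rewrite ltr1n.
have cE := mean_log_factorE beta a0 a1.
have m1R : 1 < qstar%:R :> R by rewrite ltr1n.
have LambdaE : Lambda = (fun t w => expR (X t w - gam alpha beta 1)).
  by apply/funext => t; apply/funext => w; rewrite hLambda cE.
have [hfdd hpath hind] := hLam; rewrite LambdaE in hfdd.
have hmeas j : measurable_process (fun t => Lam j t) by have [] := hpath j.
have s0 : 0 <= slope alpha beta qstar%:R by exact: slope_ge0.
rewrite (gamma_threshold beta a0 m1R hqalpha) in hb.
(* The threshold is the exponential of the nonnegative [slope], hence at least 1. *)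
have b1 : 1 < b by apply: le_lt_trans hb; apply: le_trans (expR_ge1Dx _); rewrite lerDl.
have {}hb : slope alpha beta qstar%:R < ln b.
  by rewrite -ltr_expR lnK// posrE (lt_trans _ b1).
have lim t : exists A : {RV P >-> R}, 0 <= t <= 1 -> (forall w, 0 <= A w) /\
    forall e, 0 < e -> exists n0, forall n, (n0 <= n)%N ->
      (expectation P (fun w => (A w - mass Lam b n t w) ^+ 2)%R <= e%:E)%E.
  have [t01|nt] := boolP (0 <= t <= 1); last first.
    (* Outside [0, 1] the limit is arbitrary; any random variable serves as a default. *)
    by exists (Lam 0%N 0).
  have [A [mA A0 LA]] :=
    mass_limit a0 hbeta hlambda hqstar hqalpha hX hX0 hfdd hind b1 hb hmeas t01.
  pose mAb := isMeasurableFun.Build _ _ _ _ A mA.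
  pose A' : {RV P >-> R} := HB.pack A mAb.
  by exists A'.
have [A AP] := choice lim; move=> A_.
have mA t : measurable_fun setT (A t : T -> R) by exact: (measurable_funPT (A t)).
exists A; split=> [q qm|t t01]; last first.
  have [A0 LA] := AP t t01; rewrite cE.
  exact: (limit_variance a0 hbeta hlambda hqstar hqalpha hX hX0 hfdd hind b1 hb hmeas
    t01 (mA t) A0 LA).
have [C1 [C2 [C10 [C12 CP]]]] :=
  limit_scaling a0 hbeta hlambda hqstar hqalpha hX hX0 hfdd hind b1 hb hmeas qm.
have scaling t (t01 : 0 <= t <= 1) := CP t (A t) t01 (mA t) (AP t t01).1 (AP t t01).2.
split.
- move=> t t01; have [A0 LA] := AP t t01; have /andP[t0 _] := t01.
  apply: ge0_ereal_cvg0 => [n|e e0]; first by apply: expectation_ge0 => w; exact: powR_ge0.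
  have [n0 n0P] := mass_Lq_cvg a0 hbeta hlambda hqstar hqalpha hX hX0 hfdd hind b1 hb
    hmeas t01 (mA t) A0 LA qm e0.
  (* The cascade of index [n] is a product of [n.+1] levels, hence the shift of the index of
     [mass]. *)
  exists n0 => n n0n; apply: le_trans (n0P n.+1 (leqW n0n)).
  rewrite le_eqVlt; apply/orP; left; apply/eqP; apply: expectation_eq_ae.
  + apply: filterS (cascade_mass_ae hfdd b1 hmeas n t0) => w h.
    by rewrite /A_ h.
  + apply: measurable_powR_fun; apply: measurable_dist => //.
    exact: measurable_cascade.
  + apply: measurable_powR_fun; apply: measurable_dist => //.
    exact: measurable_mass.
- move=> t t01; have [A0 _] := AP t t01; have /andP[_ h] := scaling t t01.
  rewrite (_ : (fun w => `|A t w| `^ q) = (fun w => A t w `^ q)).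
    exact: le_lt_trans h (ltry _).
  by apply/funext => w; rewrite ger0_norm.
- by exists C1, C2; split=> //; split=> // t t01; exact: scaling.
Qed.
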